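(* Let $w\in\mathbb C\setminus\{z_1,\dots,z_N\}$, $n\in\{0,1,\dots,M-1\}$, and suppose $w$ obeys the Bethe equation $$0=\sum_{j=1}^N\frac{\langle\lambda_j,\check\alpha_n\rangle}{w-z_j}.$$ Then, up to twisted derivatives of degree $2$, the weight function $f_n(w)|\bm\lambda\rangle$ is an eigenstate of $q(z)$ with eigenvalue $-M\,v_2(z)$; that is, $$q(z)\,f_n(w)|\bm\lambda\rangle=-M\,v_2(z)\,f_n(w)|\bm\lambda\rangle+D_z^{(2)}|\tilde\varepsilon(z)\rangle$$ for some vector $|\tilde\varepsilon(z)\rangle\in\mathbb M_{\bm\lambda}$ depending rationally on $z$. In particular, for any cycle $\gamma$ in the twisted homology corresponding to $D_z^{(2)}$, $$\hat Q_2^\gamma\,f_n(w)|\bm\lambda\rangle=-M\int_\gamma\mathcal P(z)^{-2/M}v_2(z)\,dz\;f_n(w)|\bm\lambda\rangle .$$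
   Context: Work over $\mathbb C$. Fix an integer $M\ge3$, $(X|Y)=\operatorname{tr}(XY)$ on $\mathfrak{sl}_M$ (trace in the defining representation), $\widehat{\mathfrak{sl}}_M=\mathfrak{sl}_M[t,t^{-1}]\oplus\mathbb C\mathsf k$ with $\mathsf k$ central, $a_n:=a\otimes t^n$, $[a_m,b_n]=[a,b]_{m+n}-n\delta_{m+n,0}(a|b)\mathsf k$, and $\mathfrak g=\widehat{\mathfrak{sl}}_M\oplus\mathbb C\mathsf d$, $[\mathsf d,a_n]=na_n$, $[\mathsf d,\mathsf k]=0$. $\mathfrak g$ is the affine Kac–Moody algebra with Cartan matrix $a_{ij}=2\delta_{ij}-\delta_{i+1,j}-\delta_{i-1,j}$, indices $i,j\in\mathbb Z/M$; Chevalley generators $e_i=E_{i,i+1}$, $f_i=E_{i+1,i}$ ($1\le i\le M-1$), $e_0=E_{M,1}\otimes t$, $f_0=E_{1,M}\otimes t^{-1}$; Cartan subalgebra $\mathfrak h$; simple roots $\alpha_i\in\mathfrak h^*$, simple coroots $\check\alpha_i\in\mathfrak h$, $\langle\alpha_j,\check\alpha_i\rangle=a_{ij}$, $\langle\alpha_i,\mathsf d\rangle=\delta_{i,0}$, $\mathsf k=\sum_i\check\alpha_i$. Let $\rho\in\mathfrak h^*$ be $\rho=M\Lambda+\dot\rho$, where $\Lambda$ vanishes on $\mathsf d$ and on the Cartan subalgebra of $\mathfrak{sl}_M$ with $\langle\Lambda,\mathsf k\rangle=1$, and $\dot\rho$ is the Weyl vector of $\mathfrak{sl}_M$ (so $\langle\rho,\check\alpha_i\rangle=1$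 for all $i$). Let $\check\eta_i\in\mathfrak h$ ($i\in\mathbb Z/M$) be determined by $\langle\alpha_i,\check\eta_j\rangle=\delta_{ij}$, $\langle\rho,\check\eta_j\rangle=0$. Fix $N\ge1$, distinct $z_1,\dots,z_N\in\mathbb C$, levels $k_i\in\mathbb C$, $k_i\ne-M$, and weights $\lambda_i\in\mathfrak h^*$ with $\langle\lambda_i,\mathsf k\rangle=k_i$. $\mathbb M_{\bm\lambda}=\mathbb M_{\lambda_1}\otimes\cdots\otimes\mathbb M_{\lambda_N}$ is the tensor product of Verma modules over $\mathfrak g$ of highest weights $\lambda_i$, with highest weight vector $|\bm\lambda\rangle$. $A^{(i)}$ is $A$ acting in the $i$-th factor and $A(z):=\sum_i\frac{A^{(i)}}{z-z_i}$; in particular $f_n(w)=\sum_{j=1}^N\frac{f_n^{(j)}}{w-z_j}$, and $f_n(w)|\bm\lambda\rangle$ is the weight function (Schechtman–Varchenko vector) for one Bethe root $w$ of colour $n$. Twist function $\varphi(z)=\sum_i\frac{k_i}{z-z_i}$; $D_z^{(j)}:=\partial_z-\frac jM\varphi(z)$; $\mathcal P(z)=\prod_j(z-z_j)^{k_j}$. With $I^a=I_a$ a basis of $\mathfrak{sl}_M$ with $(I_a|I_b)=\delta_{ab}$, $t_{abc}:=\operatorname{tr}(I_aI_bI_c+I_bI_aI_c)$, repeated Lie algebra indices summed, $$q(z):=\tfrac13t_{abc}\sum_{j,k\ge0}\Big(I^a_{-1-k}(z)I^b_{-1-j}(z)I^c_{2+j+k}(z)+2I^a_{-1-k}(z)I^b_{1+k-j}(z)I^c_j(z)+I^a_{-j-k}(z)I^b_k(z)I^c_j(z)\Big)$$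 (acting by finite sums on each vector of $\mathbb M_{\bm\lambda}$), and $\hat Q_2^\gamma:=\int_\gamma\mathcal P(z)^{-2/M}q(z)\,dz$. A cycle of the twisted homology corresponding to $D_z^{(2)}$ is given by a closed contour $\gamma\subset\mathbb C\setminus\{z_1,\dots,z_N\}$ along which a univalued branch of $\mathcal P(z)^{2/M}$ exists, together with a choice of such a branch. The function $v_2$. Let ${}^L\widehat{\mathfrak{sl}}_M$ be the affine Kac–Moody algebra with the same relations but with roots and coroots interchanged: Chevalley generators $\check e_i,\check f_i$, Cartan subalgebra $\mathfrak h^*$, $[\check e_i,\check f_j]=\delta_{ij}\alpha_i$, $[x,\check e_i]=\langle x,\check\alpha_i\rangle\check e_i$, $[x,\check f_i]=-\langle x,\check\alpha_i\rangle\check f_i$ for $x\in\mathfrak h^*$, and the Serre relations; ${}^L\mathfrak n_+$ is generated by the $\check e_i$ (completed with respect to the principal gradation, i.e. the eigenvalues of $\operatorname{ad}\rho$); invariant bilinear form with $(\check e_i|\check f_j)=\delta_{ij}$. Put $p_{-1}=\sum_i\check f_i$, $p_{-2}=-\sum_{i\in\mathbb Z/M}[\check f_i,\check f_{i+1}]$. For $j\in E=\mathbb Z_{\ge1}\setminus M\mathbb Z_{\ge1}$, $p_j\in{}^L\mathfrak n_+$ is a nonzero element of degree $j$, with $[p_{-1},p_j]=0$ for $j\ge2$ and $[p_{-1},p_1]=-\sum_i\alpha_i$; $p_2$ is normalized by $(p_2|p_{-2})=M$. Consider the connection (Miura oper) $d+(p_{-1}+u(z))dz$ with $$u(z)=-\sum_{j=1}^N\frac{\lambda_j}{z-z_j}+\frac{\alpha_n}{z-w}=\sum_{i\in\mathbb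 Z/M}u_i(z)\alpha_i-\frac{\varphi(z)}M\rho,\qquad u_i(z)=-\sum_{j=1}^N\frac{\langle\lambda_j,\check\eta_i\rangle}{z-z_j}+\frac{\delta_{in}}{z-w}.$$ By a gauge transformation by $\exp$ of a meromorphic function valued in ${}^L\mathfrak n_+$ it can be brought to a quasi-canonical form $d+\big(p_{-1}-\frac\varphi M\rho+\sum_{j\in E}v_jp_j\big)dz$ with $v_j$ meromorphic, and $v_2(z)$ denotes the coefficient of $p_2$ in such a form. Explicitly, $v_2=\frac1M\big(-\sum_iu_i(u_{i+1}^2-u_{i-1}^2)-\tfrac12\sum_iu_i(u_{i+1}'-u_{i-1}')+D_z^{(2)}f_2\big)$ for an arbitrary meromorphic function $f_2$.
   Formalization: The eigenvalue is proved as −2M v₂(z), and −2M times the integral of v₂, instead of −M v₂(z): with the stated normalization of t_abc and of (p_2|p_{-2}) = M, the printed constant is off by a factor 2. *)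

(* Defs.v *)
From HB Require Import structures.
From mathcomp Require Import all_boot all_order all_algebra.
From mathcomp Require Import complex.
From mathcomp Require Import all_classical all_reals all_analysis.
Set Implicit Arguments.
Unset Strict Implicit.
Unset Printing Implicit Defensive.
Import Order.TTheory GRing.Theory Num.Theory.
Import numFieldNormedType.Exports.

Local Open Scope classical_set_scope.
Local Open Scope complex_scope.
Local Open Scope ring_scope.

(* Z/M is 'I_M, with ordS and ord_pred as i |-> i + 1 and i |-> i - 1.        *)
(* Matrix indices are shifted down by one from the usual 1..M, so that        *)
(* uniformly in i : 'I_M                                                      *)
(*   e_i = E_(i-1,i) (x) t^[i=0]   and   f_i = E_(i,i-1) (x) t^-[i=0].        *)

Definition cartan (M : nat) (i j : 'I_M) : int :=
  2 * (i == j)%:Z - (ordS i == j)%:Z - (ord_pred i == j)%:Z.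

Definition is0 (M : nat) (i : 'I_M) : nat := (val i == 0)%N.

(* The dual of the Cartan subalgebra; a weight is given by its values on the  *)
(* basis consisting of the simple coroots (first component) and d (second).   *)
Definition weight (F : fieldType) (M : nat) : lmodType F :=
  ('rV[F]_M * F^o)%type.

Definition on_coroot (F : fieldType) (M : nat) (l : weight F M) (i : 'I_M) : F :=
  l.1 ord0 i.

Definition on_d (F : fieldType) (M : nat) (l : weight F M) : F := l.2.

Definition level (F : fieldType) (M : nat) (l : weight F M) : F :=
  \sum_i on_coroot l i.

Definition alpha (F : fieldType) (M : nat) (j : 'I_M) : weight F M :=
  (\row_i (cartan i j)%:~R, (is0 j)%:R).

Definition rho (F : fieldType) (M : nat) : weight F M := (const_mx 1, 0).

(* Modules over g = sl_M[t,t^-1] + C k + C d.                                 *)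
(* gm_op a m is the action of a (x) t^m; it is only constrained for a in sl_M.*)
Record gmodule (F : fieldType) (M : nat) := GModule {
  gm_sort :> lmodType F;
  gm_op : 'M[F]_M -> int -> {linear gm_sort -> gm_sort};
  gm_k : {linear gm_sort -> gm_sort};
  gm_d : {linear gm_sort -> gm_sort};
  gm_op_linear : forall (c : F) (a b : 'M[F]_M) (m : int) (x : gm_sort),
    \tr a = 0 -> \tr b = 0 ->
    gm_op (c *: a + b) m x = c *: gm_op a m x + gm_op b m x;
  gm_op_comm : forall (a b : 'M[F]_M) (m n : int) (x : gm_sort),
    \tr a = 0 -> \tr b = 0 ->
    gm_op a m (gm_op b n x) - gm_op b n (gm_op a m x) =
    gm_op (a *m b - b *m a) (m + n) x
    - (n%:~R * (m + n == 0)%:R * \tr (a *m b)) *: gm_k x;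
  gm_k_op : forall (a : 'M[F]_M) (m : int) (x : gm_sort), \tr a = 0 ->
    gm_k (gm_op a m x) = gm_op a m (gm_k x);
  gm_d_k : forall x : gm_sort, gm_d (gm_k x) = gm_k (gm_d x);
  gm_d_op : forall (a : 'M[F]_M) (m : int) (x : gm_sort), \tr a = 0 ->
    gm_d (gm_op a m x) - gm_op a m (gm_d x) = m%:~R *: gm_op a m x
}.

Definition gmodule_hom (F : fieldType) (M : nat) (V W : gmodule F M)
    (f : {linear V -> W}) : Prop :=
  [/\ forall (a : 'M[F]_M) (m : int) (x : V), \tr a = 0 ->
        f (gm_op V a m x) = gm_op W a m (f x),
      forall x, f (gm_k V x) = gm_k W (f x)
    & forall x, f (gm_d V x) = gm_d W (f x)].

Definition coroot_op (F : fieldType) (M : nat) (V : gmodule F M) (i : 'I_M)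
    (x : V) : V :=
  gm_op V (delta_mx (ord_pred i) (ord_pred i) - delta_mx i i) 0 x
  + (is0 i)%:R *: gm_k V x.

Definition highest_weight_vector (F : fieldType) (M : nat) (l : weight F M)
    (V : gmodule F M) (v : V) : Prop :=
  [/\ forall i j : 'I_M, (i < j)%N -> gm_op V (delta_mx i j) 0 v = 0,
      forall (a : 'M[F]_M) (m : int), 0 < m -> \tr a = 0 -> gm_op V a m v = 0,
      forall i, coroot_op i v = on_coroot l i *: v
    & gm_d V v = on_d l *: v].

(* The Verma module of highest weight l as the induced module, i.e. the       *)
(* universal module with a highest weight vector of weight l.                 *)
Record verma (F : fieldType) (M : nat) (l : weight F M) := Verma {
  vm_module :> gmodule F M;
  vm_hw : vm_module;
  vm_hwP : highest_weight_vector l vm_hw;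
  vm_ex : forall (W : gmodule F M) (w : W), highest_weight_vector l w ->
    exists f : {linear vm_module -> W}, gmodule_hom f /\ f vm_hw = w;
  vm_uniq : forall (W : gmodule F M) (f g : {linear vm_module -> W}),
    gmodule_hom f -> gmodule_hom g -> f vm_hw = g vm_hw -> f =1 g
}.

Definition multilinear (F : fieldType) (N : nat) (V : 'I_N -> lmodType F)
    (W : lmodType F) (g : (forall i, V i) -> W) : Prop :=
  forall (x : forall i, V i) (i : 'I_N) (c : F) (y y' : V i),
    g (eqtype.dfwith x (c *: y + y')) = c *: g (eqtype.dfwith x y) + g (eqtype.dfwith x y').

(* tp_op i a m is the action of a (x) t^m in the i-th tensor factor.          *)
Record tensor_product (F : fieldType) (M N : nat) (V : 'I_N -> gmodule F M) :=
  TensorProduct {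
  tp_sort :> lmodType F;
  tp_pure : (forall i, V i) -> tp_sort;
  tp_pureP : multilinear (V := fun i => gm_sort (V i)) tp_pure;
  tp_ex : forall (W : lmodType F) (g : (forall i, V i) -> W),
    multilinear (V := fun i => gm_sort (V i)) g ->
    exists f : {linear tp_sort -> W}, forall x, f (tp_pure x) = g x;
  tp_uniq : forall (W : lmodType F) (f g : {linear tp_sort -> W}),
    (forall x, f (tp_pure x) = g (tp_pure x)) -> f =1 g;
  tp_op : 'I_N -> 'M[F]_M -> int -> {linear tp_sort -> tp_sort};
  tp_opP : forall (i : 'I_N) (a : 'M[F]_M) (m : int) (x : forall j, V j),
    \tr a = 0 ->
    tp_op i a m (tp_pure x) = tp_pure (eqtype.dfwith x (gm_op (V i) a m (x i)))
}.

Definition vac (F : fieldType) (M N : nat) (lam : 'I_N -> weight F M)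
    (V : forall i, verma (lam i)) (T : tensor_product V) : T :=
  tp_pure T (fun i => vm_hw (V i)).

Definition current (F : fieldType) (M N : nat) (V : 'I_N -> gmodule F M)
    (T : tensor_product V) (zs : 'I_N -> F) (a : 'M[F]_M) (m : int) (z : F)
    (x : T) : T :=
  \sum_i (z - zs i)^-1 *: tp_op T i a m x.

Definition bethe_vector (F : fieldType) (M N : nat) (lam : 'I_N -> weight F M)
    (V : forall i, verma (lam i)) (T : tensor_product V) (zs : 'I_N -> F)
    (n : 'I_M) (w : F) : T :=
  current zs (delta_mx n (ord_pred n)) (- (is0 n)%:Z) w (vac T).

Definition orthonormal_basis (F : fieldType) (M : nat) (A : finType)
    (I : A -> 'M[F]_M) : Prop :=
  [/\ forall a, \tr (I a) = 0,
      forall a b, \tr (I a *m I b) = (a == b)%:R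
    & forall X : 'M[F]_M, \tr X = 0 ->
        exists c : A -> F, X = \sum_a c a *: I a].

Definition tsym (F : fieldType) (M : nat) (A : finType) (I : A -> 'M[F]_M)
    (a b c : A) : F :=
  \tr (I a *m I b *m I c + I b *m I a *m I c).

Section Q.
Context (F : fieldType) (M N : nat) (V : 'I_N -> gmodule F M).
Context (T : tensor_product V) (zs : 'I_N -> F).
Context (A : finType) (I : A -> 'M[F]_M).

Definition qterm (z : F) (j k : nat) (x : T) : T :=
  let J a (m : int) (y : T) := current zs (I a) m z y in
  \sum_a \sum_b \sum_c tsym I a b c *:
    (J a (- 1 - k%:Z) (J b (- 1 - j%:Z) (J c (2 + j%:Z + k%:Z) x))
     + 2 *: J a (- 1 - k%:Z) (J b (1 + k%:Z - j%:Z) (J c j%:Z x))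
     + J a (- j%:Z - k%:Z) (J b k%:Z (J c j%:Z x))).

(* \sum_(_ \in _) is the sum of a finitely supported family. *)
Definition q (z : F) (x : T) : T :=
  3^-1 *: \sum_(jk \in [set: nat * nat]) qterm z jk.1 jk.2 x.

End Q.

Definition twist (F : fieldType) (M N : nat) (lam : 'I_N -> weight F M)
    (zs : 'I_N -> F) (z : F) : F :=
  \sum_i level (lam i) / (z - zs i).

(* Rational functions with values in a vector space V, i.e. V (x) F(z);       *)
(* the pair (p, v) in rf_num stands for p(z) v.                               *)
Record ratfun (F : fieldType) (V : lmodType F) := RatFun {
  rf_num : seq ({poly F} * V);
  rf_den : {poly F};
  rf_den_neq0 : rf_den != 0
}.

Definition rf_eval (F : fieldType) (V : lmodType F) (f : ratfun V) (z : F) : V :=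
  (rf_den f).[z]^-1 *: \sum_(pv <- rf_num f) pv.1.[z] *: pv.2.

Definition rf_deriv (F : fieldType) (V : lmodType F) (f : ratfun V) (z : F) : V :=
  ((rf_den f).[z] ^+ 2)^-1 *: \sum_(pv <- rf_num f)
    (pv.1^`().[z] * (rf_den f).[z] - pv.1.[z] * (rf_den f)^`().[z]) *: pv.2.

Definition twisted_deriv (F : fieldType) (M N : nat) (lam : 'I_N -> weight F M)
    (zs : 'I_N -> F) (j : nat) (V : lmodType F) (f : ratfun V) (z : F) : V :=
  rf_deriv f z - (j%:R / M%:R * twist lam zs z) *: rf_eval f z.

(* Over an infinite field, equality of rational functions. *)
Definition generically (F : fieldType) (P : F -> Prop) : Prop :=
  exists s : seq F, forall z, z \notin s -> P z.

Record lieAlgebra (F : fieldType) := LieAlgebra {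
  lie_sort :> lmodType F;
  br : lie_sort -> lie_sort -> lie_sort;
  br_linearl : forall (c : F) (x y z : lie_sort),
    br (c *: x + y) z = c *: br x z + br y z;
  br_linearr : forall (c : F) (x y z : lie_sort),
    br z (c *: x + y) = c *: br z x + br z y;
  br_alt : forall x : lie_sort, br x x = 0;
  br_jacobi : forall x y z : lie_sort,
    br x (br y z) + br y (br z x) + br z (br x y) = 0
}.

(* The relations of the dual affine algebra: the Cartan subalgebra is the     *)
(* space of weights, its simple coroots being the alpha_i.                    *)
Definition dual_relations (F : fieldType) (M : nat) (L : lieAlgebra F)
    (e f : 'I_M -> L) (h : {linear weight F M -> L}) : Prop :=
  (forall x y, br (h x) (h y) = 0) /\
  (forall i j, br (e i) (f j) = if i == j then h (alpha F i) else 0) /\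
  (forall x i, br (h x) (e i) = on_coroot x i *: e i) /\
  (forall x i, br (h x) (f i) = - on_coroot x i *: f i) /\
  (forall i j, i != j -> iter `|1 - cartan i j|%N (br (e i)) (e j) = 0) /\
  (forall i j, i != j -> iter `|1 - cartan i j|%N (br (f i)) (f j) = 0).

Definition lie_hom (F : fieldType) (L L' : lieAlgebra F)
    (g : {linear L -> L'}) : Prop :=
  forall x y, g (br x y) = br (g x) (g y).

(* The Lie algebra presented by the relations above. *)
Record dual_affine (F : fieldType) (M : nat) := DualAffine {
  da_lie :> lieAlgebra F;
  da_e : 'I_M -> da_lie;
  da_f : 'I_M -> da_lie;
  da_h : {linear weight F M -> da_lie};
  da_relations : dual_relations da_e da_f da_h;
  da_ex : forall (L' : lieAlgebra F) (e f : 'I_M -> L')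
      (h : {linear weight F M -> L'}), dual_relations e f h ->
    exists g : {linear da_lie -> L'},
      lie_hom g /\ (forall i, g (da_e i) = e i) /\
      (forall i, g (da_f i) = f i) /\ (forall x, g (da_h x) = h x);
  da_uniq : forall (L' : lieAlgebra F) (g g' : {linear da_lie -> L'}),
    lie_hom g -> lie_hom g' -> (forall i, g (da_e i) = g' (da_e i)) ->
    (forall i, g (da_f i) = g' (da_f i)) -> (forall x, g (da_h x) = g' (da_h x)) ->
    g =1 g'
}.

Section Oper.
Context (F : fieldType) (M : nat) (L : dual_affine F M).

Definition da_rho : L := da_h L (rho F M).

Definition in_nplus (x : L) : Prop :=
  forall S : L -> Prop,
    (forall i, S (da_e L i)) ->
    (forall (c : F) (y y' : L), S y -> S y' -> S (c *: y + y')) ->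
    (forall y y' : L, S y -> S y' -> S (br y y')) -> S x.

Definition in_nplus_deg (k : nat) (x : L) : Prop :=
  in_nplus x /\ br da_rho x = k%:R *: x.

Definition p_m1 : L := \sum_i da_f L i.

Definition p_m2 : L := - \sum_i br (da_f L i) (da_f L (ordS i)).

Definition invariant_form (B : L -> L -> F) : Prop :=
  [/\ forall (c : F) (x y z : L), B (c *: x + y) z = c * B x z + B y z,
      forall x y, B x y = B y x,
      forall x y z, B (br x y) z = B x (br y z)
    & forall i j, B (da_e L i) (da_f L j) = (i == j)%:R].

(* p j is meaningful for the positive exponents, i.e. j not divisible by M. *)
Definition principal_elements (B : L -> L -> F) (p : nat -> L) : Prop :=
  [/\ forall j, ~~ (M %| j)%N -> in_nplus_deg j (p j) /\ p j != 0,
      forall j, ~~ (M %| j)%N -> (2 <= j)%N -> br p_m1 (p j) = 0,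
      br p_m1 (p 1%N) = - da_h L (\sum_i alpha F i)
    & B (p 2%N) p_m2 = M%:R].

(* An element m of the completion of n_+ is the sequence of its homogeneous   *)
(* components, m i being of degree i (and m 0 = 0). A connection form X, of   *)
(* degrees >= -1, is the sequence whose k-th term has degree k - 1.           *)
Definition ad_seq (m X : nat -> L) (k : nat) : L :=
  \sum_(i < k.+1) br (m i) (X (k - i)%N).

Definition shift_seq (X : nat -> L) (k : nat) : L :=
  if k is k'.+1 then X k' else 0.

(* exp(m) (d + X dz) exp(-m) = d + X' dz, where, ad m raising the degree,     *)
(*   X' = \sum_r (ad m)^r X / r! - \sum_r (ad m)^r (dm/dz) / (r+1)!           *)
(* is a finite sum in each degree.                                            *)
Definition gauge (m dm X : nat -> L) (k : nat) : L :=
  \sum_(r < k.+1) (r`!)%:R^-1 *: iter r (ad_seq m) X k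
  - \sum_(r < k.+1) (r.+1`!)%:R^-1 *: iter r (ad_seq m) (shift_seq dm) k.

Definition miura_form (u : weight F M) (k : nat) : L :=
  match k with 0 => p_m1 | 1 => da_h L u | _ => 0 end.

Definition quasi_canonical_form (p : nat -> L) (phi : F) (v : nat -> F)
    (k : nat) : L :=
  match k with
  | 0 => p_m1
  | 1 => da_h L (- (phi / M%:R) *: rho F M)
  | j.+1 => if (M %| j)%N then 0 else v j *: p j
  end.

(* v2 is the coefficient of p_2 in some quasi-canonical form of d+(p_-1+u)dz. *)
Definition is_v2 (p : nat -> L) (u : F -> weight F M) (phi : F -> F)
    (v2 : ratfun F^o) : Prop :=
  exists (m : nat -> ratfun L) (v : nat -> ratfun F^o),
  [/\ generically (fun z => rf_eval (m 0%N) z = 0),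
      forall k, (0 < k)%N ->
        generically (fun z => in_nplus_deg k (rf_eval (m k) z)),
      forall k, generically (fun z =>
        gauge (fun i => rf_eval (m i) z) (fun i => rf_deriv (m i) z)
              (miura_form (u z)) k
        = quasi_canonical_form p (phi z) (fun j => rf_eval (v j) z) k)
    & v 2%N = v2].

End Oper.

Definition miura_u (F : fieldType) (M N : nat) (lam : 'I_N -> weight F M)
    (zs : 'I_N -> F) (n : 'I_M) (w z : F) : weight F M :=
  - (\sum_i (z - zs i)^-1 *: lam i) + (z - w)^-1 *: alpha F n.

Definition cexp (R : realType) (x : R[i]) : R[i] :=
  (expR (complex.Re x) * cos (complex.Im x))
  +i* (expR (complex.Re x) * sin (complex.Im x)).

Definition C1_on (R : realType) (a b : R) (f : R -> R) : Prop :=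
  [/\ {within `[a, b], continuous f},
      forall t, t \in `]a, b[ -> derivable f t 1
    & exists2 g : R -> R, {within `[a, b], continuous g}
                        & {in `]a, b[, derive1 f =1 g}].

Definition piecewise_C1 (R : realType) (f : R -> R) : Prop :=
  exists s : seq R,
    [/\ path <%R 0 s, last 0 s = 1
      & forall i, (i < size s)%N -> C1_on (nth 0 (0 :: s) i) (nth 0 s i) f].

(* A closed contour avoiding the zs i, with a univalued branch along it of    *)
(* \prod_i (z - zs i) ^ (e i), obtained by continuation along the contour of  *)
(* logarithms of the z - zs i.                                                *)
Record twisted_cycle (R : realType) (N : nat) (zs e : 'I_N -> R[i]) :=
  TwistedCycle {
  tc_path : R -> R[i];
  tc_log : 'I_N -> R -> R[i];
  tc_Re : piecewise_C1 (fun t => complex.Re (tc_path t));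
  tc_Im : piecewise_C1 (fun t => complex.Im (tc_path t));
  tc_closed : tc_path 0 = tc_path 1;
  tc_log_Re : forall i,
    {within `[0, 1], continuous (fun t => complex.Re (tc_log i t))};
  tc_log_Im : forall i,
    {within `[0, 1], continuous (fun t => complex.Im (tc_log i t))};
  tc_logP : forall i t, t \in `[0, 1] -> cexp (tc_log i t) = tc_path t - zs i;
  tc_univalued : cexp (\sum_i e i * tc_log i 0) = cexp (\sum_i e i * tc_log i 1)
}.

Definition tc_branch (R : realType) (N : nat) (zs e : 'I_N -> R[i])
    (gam : twisted_cycle zs e) (t : R) : R[i] :=
  cexp (\sum_i e i * tc_log gam i t).

Definition tc_speed (R : realType) (N : nat) (zs e : 'I_N -> R[i])
    (gam : twisted_cycle zs e) (t : R) : R[i] :=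
  derive1 (fun s => complex.Re (tc_path gam s)) t
  +i* derive1 (fun s => complex.Im (tc_path gam s)) t.

Definition cintegral01 (R : realType) (f : R -> R[i]) : R[i] :=
  (\int[lebesgue_measure]_(t in `[0, 1]) complex.Re (f t))
  +i* (\int[lebesgue_measure]_(t in `[0, 1]) complex.Im (f t)).

(* The integral over gam of g dz divided by the chosen branch. *)
Definition twisted_integral (R : realType) (N : nat) (zs e : 'I_N -> R[i])
    (gam : twisted_cycle zs e) (g : R[i] -> R[i]) : R[i] :=
  cintegral01 (fun t =>
    (tc_branch gam t)^-1 * g (tc_path gam t) * tc_speed gam t).

(* The integral of a vector-valued g is characterized by linear forms, which  *)
(* separate the points of V.                                                  *)
Definition has_twisted_integral (R : realType) (N : nat) (zs e : 'I_N -> R[i])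
    (gam : twisted_cycle zs e) (V : lmodType R[i]) (g : R[i] -> V) (x : V) :
    Prop :=
  forall l : {scalar V}, twisted_integral gam (fun z => l (g z)) = l x.

(* Main.v *)
Require Import Defs.
From HB Require Import structures.
From mathcomp Require Import all_boot all_order all_algebra.
From mathcomp Require Import complex.
From mathcomp Require Import all_classical all_reals all_analysis.
From mathcomp Require Import measurable_realfun.
From mathcomp Require Import ring lra zify.

(** On a vector with one lowering operator, only the modes of degree [-1], [0] and
    [1] of the currents contribute to [q z]. Contracting the orthonormal basis
    turns [q z] into a sum over closed paths [i, j, k] of products of three matrix
    units ([q_units]). Moving the raising units to the right ([word3_sum]) leaves
    products of Cartan currents and a few words ending with the simple raising unit.
    The Cartan currents act on the Bethe vector by explicit functions of [z]
    ([root_weight]), up to the vectors [f_k] with one lowering operator and coefficients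
    [(z - z_i)^-k].
    By the Bethe equation the coefficients of the [f_k] cancel, except in colour 0,
    where they form a twisted derivative ([q_root_vec]). What multiplies the Bethe
    vector is a cubic polynomial in these functions and their derivatives
    ([cubic_symbol]).

    On the side of the oper, only the degrees 0 and 2 of the gauge equation
    matter. The components of degree 1 and 2 of the gauge parameter are
    combinations of the [e_i] and of the brackets [[e_i, e_(i+1)]] ([nplus_deg1],
    [nplus_deg2]). The equation in degree 0 determines the coefficients [a_i] of the
    former up to a common constant, through the differences [x_i = a_(i+1) - a_i].
    Pairing the equation in degree 2 with [p_-2] removes the component of degree 3,
    because [p_-1] and [p_-2] commute, and gives [- 2 M v_2] as a cubic polynomial
    in the [x_i] and their derivatives plus the twisted derivative of the sum of the
    coefficients in degree 2 ([gauge_v2], [is_v2_expansion]).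

    The [x_i] are the unique solution of sum 0 of
    [x_(i-1) - x_i = - <u, coroot_i> - phi / M]. The functions [root_weight] shifted
    by a multiple of the Weyl vector solve the same equation ([root_weight_pred]),
    and substituting this shift in [cubic_symbol] produces [- 2 M v_2] up to a
    twisted derivative ([cubic_symbol_shift], [cubic_symbol_v2]). This proves the
    first assertion ([q_bethe_vector]).

    For the second one, a linear form gives an equation between scalar rational
    functions. The function under the twisted derivative solves a first order
    equation whose coefficients have no pole on the contour, hence has none
    there either ([rational_solution_regular]). The integral of its twisted
    derivative vanishes by the fundamental theorem of calculus on each piece of the
    contour ([twisted_integral_exact]): the primitive is the function itself divided
    by the branch, which is differentiable since a continuous logarithm of a
    differentiable function is ([cis_derive_log]), and which returns to its initial
    value along a twisted cycle. *)

Set Implicit Arguments.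
Unset Strict Implicit.
Unset Printing Implicit Defensive.
Import Order.TTheory GRing.Theory Num.Theory.
Import numFieldNormedType.Exports.
Local Open Scope complex_scope.
Local Open Scope ring_scope.

(** * Linear identities in modules *)

(** The square-zero extension of a field by a module: pairs [(a, v)] with
    [v * w = 0]. It is a commutative ring, in which the ring normalization
    procedure decides linear identities between vectors with scalar coefficients. *)
Definition sqz (F : fieldType) (V : lmodType F) : Type := (F * V)%type.

Section SquareZero.
Context (F : fieldType) (V : lmodType F).

HB.instance Definition _ := GRing.Zmodule.copy (sqz V) (F * V)%type.

Definition sqz_mul (x y : sqz V) : sqz V :=
  (x.1 * y.1, x.1 *: y.2 + y.1 *: x.2).

Fact sqz_mulA : associative sqz_mul.
Proof.
move=> [a u] [b v] [c w]; rewrite /sqz_mul /= mulrA.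
by rewrite !scalerDr !scalerA addrA (mulrC c a) (mulrC c b).
Qed.

Fact sqz_mulC : commutative sqz_mul.
Proof. by move=> [a u] [b v]; rewrite /sqz_mul /= mulrC [X in (_, X)]addrC. Qed.

Fact sqz_mul1 : left_id ((1, 0) : sqz V) sqz_mul.
Proof.
by move=> [a u]; rewrite /sqz_mul /= mul1r scale1r scaler0 addr0.
Qed.

Fact sqz_mulD : left_distributive sqz_mul +%R.
Proof.
move=> [a u] [b v] [c w]; rewrite /sqz_mul /= mulrDl scalerDl scalerDr.
by rewrite addrACA.
Qed.

Fact sqz_neq0 : ((1, 0) : sqz V) != 0.
Proof. by apply/eqP => -[/eqP]; rewrite oner_eq0. Qed.

HB.instance Definition _ := GRing.Zmodule_isComNzRing.Build (sqz V)
  sqz_mulA sqz_mulC sqz_mul1 sqz_mulD sqz_neq0.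

Definition sqz_vec (v : V) : sqz V := (0, v).
Definition sqz_scal (a : F) : sqz V := (a, 0).

Fact sqz_vec_additive : additive sqz_vec.
Proof. by move=> u v; apply/(congr1 (fun a => (a, u - v)))/esym/subr0. Qed.
HB.instance Definition _ := GRing.isZmodMorphism.Build V (sqz V) sqz_vec
  sqz_vec_additive.

Fact sqz_scal_additive : additive sqz_scal.
Proof. by move=> a b; apply/(congr1 (fun u => (a - b, u)))/esym/subr0. Qed.
Fact sqz_scal_mult : multiplicative sqz_scal.
Proof.
split=> // a b; apply: (congr1 (fun u => (a * b, u))).
by rewrite /= !scaler0 addr0.
Qed.
HB.instance Definition _ := GRing.isZmodMorphism.Build F (sqz V) sqz_scal
  sqz_scal_additive.
HB.instance Definition _ := GRing.isMonoidMorphism.Build F (sqz V) sqz_scal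
  (sqz_scal_mult.2, sqz_scal_mult.1).

Lemma sqz_vecZ a v : sqz_vec (a *: v) = sqz_scal a * sqz_vec v.
Proof.
rewrite /sqz_vec /sqz_scal /GRing.mul /= /sqz_mul /=.
by rewrite mulr0 scale0r addr0.
Qed.

Lemma sqz_vecD u v : sqz_vec (u + v) = sqz_vec u + sqz_vec v.
Proof. exact: raddfD. Qed.
Lemma sqz_vecN u : sqz_vec (- u) = - sqz_vec u.
Proof. exact: raddfN. Qed.
Lemma sqz_vec0 : sqz_vec 0 = 0.
Proof. exact: raddf0. Qed.
Lemma sqz_vecMn u n : sqz_vec (u *+ n) = sqz_vec u *+ n.
Proof. exact: raddfMn. Qed.
Definition sqz_vecE := (sqz_vecD, sqz_vecN, sqz_vec0, sqz_vecMn, sqz_vecZ).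

Lemma sqz_vec_inj : injective sqz_vec.
Proof. by move=> u v []. Qed.

End SquareZero.

(** Linear identities in a module over a field, proved in its square-zero extension. *)
Ltac lmod_ring := apply: (@sqz_vec_inj); rewrite ?sqz_vecE; ring.

(** * Rational functions with values in a vector space *)

Section Generic.
Context (F : numFieldType).
Implicit Types P Q : F -> Prop.

Lemma generically_and P Q :
  generically P -> generically Q -> generically (fun z => P z /\ Q z).
Proof.
move=> [s sP] [t tQ]; exists (s ++ t) => z.
by rewrite mem_cat negb_or => /andP[/sP ? /tQ].
Qed.

Lemma generically_mono P Q : (forall z, P z -> Q z) -> generically P -> generically Q.
Proof. by move=> PQ [s sP]; exists s => z /sP /PQ. Qed.

Lemma generically_true P : (forall z, P z) -> generically P.
Proof. by move=> hP; exists [::] => z _. Qed.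

Lemma generically_all (n : nat) (P : 'I_n -> F -> Prop) :
  (forall i, generically (P i)) -> generically (fun z => forall i, P i z).
Proof.
elim: n P => [|n IH] P hP; first by apply: generically_true => z [].
have := generically_and (hP ord0) (IH _ (fun i => hP (lift ord0 i))).
apply: generically_mono => z [P0 PS] i.
by case: (unliftP ord0 i) => [j|] ->.
Qed.

Lemma generically_neq (s : F) : generically (fun z => z != s).
Proof. by exists [:: s] => z; rewrite inE. Qed.

(** No algebraic closure is needed: the roots in [F] are removed one at a time. *)
Lemma generically_nonroot (p : {poly F}) : p != 0 -> generically (fun z => p.[z] != 0).
Proof.
have [n] := ubnP (size p); elim: n p => // n IH p lepn p0.
case: (pselect (exists x, root p x)) => [[x /factor_theorem[r pr]]|nroot].
  have r0 : r != 0 by apply: contraNneq p0 => r0; rewrite pr r0 mul0r.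
  have ltr : (size r < n)%N.
    by move: lepn; rewrite pr size_Mmonic ?monicXsubC // size_XsubC addn2 ltnS.
  apply: generically_mono (generically_and (IH _ ltr r0) (generically_neq x)).
  move=> z [rz zx]; rewrite pr hornerM mulf_neq0 // hornerXsubC subr_eq0 //.
by apply: generically_true => z; apply/negP => pz; case: nroot; exists z.
Qed.

Lemma generically_ex P : generically P -> exists z, P z.
Proof.
move=> [s sP]; suff [n ns] : exists n : nat, n%:R \notin s by exists n%:R; apply: sP.
apply: contrapT => hs.
have sub : {subset [seq (i%:R : F) | i <- iota 0 (size s).+1] <= s}.
  by move=> x /mapP[i _ ->]; apply: contrapT => ni; apply: hs; exists i; apply/negP.
have := uniq_leq_size _ sub; rewrite size_map size_iota ltnn => h; apply: notF.
by apply: h; rewrite map_inj_uniq ?iota_uniq // => i j /eqP; rewrite eqr_nat => /eqP.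
Qed.

Lemma generically_horner_eq (p r : {poly F}) :
  generically (fun z => p.[z] = r.[z]) -> p = r.
Proof.
move=> hpr; apply/eqP; rewrite -subr_eq0; apply/negPn/negP => /generically_nonroot.
move=> /(generically_and hpr) /generically_ex[z [zE]].
by rewrite hornerD hornerN zE subrr eqxx.
Qed.

End Generic.

Section RationalFunctions.
Context (F : numFieldType).

Section Numerators.
Context (V : lmodType F).
Implicit Types (s : seq ({poly F} * V)) (z : F).

(** Values and derivatives of the vector-valued polynomial [\sum_j p_j (x) v_j]
    given by the sequence of the pairs [(p_j, v_j)], and its product by a polynomial. *)
Definition lin_eval s z : V := \sum_(pv <- s) pv.1.[z] *: pv.2.
Definition lin_deriv s z : V := \sum_(pv <- s) pv.1^`().[z] *: pv.2.
Definition lin_mul (p : {poly F}) s := [seq (p * pv.1, pv.2) | pv <- s].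

Lemma lin_eval_cat s t z : lin_eval (s ++ t) z = lin_eval s z + lin_eval t z.
Proof. exact: big_cat. Qed.

Lemma lin_deriv_cat s t z : lin_deriv (s ++ t) z = lin_deriv s z + lin_deriv t z.
Proof. exact: big_cat. Qed.

Lemma lin_eval_mul p s z : lin_eval (lin_mul p s) z = p.[z] *: lin_eval s z.
Proof.
rewrite /lin_eval big_map scaler_sumr; apply: eq_bigr => pv _ /=.
by rewrite hornerM scalerA.
Qed.

Lemma lin_deriv_mul p s z :
  lin_deriv (lin_mul p s) z = p^`().[z] *: lin_eval s z + p.[z] *: lin_deriv s z.
Proof.
rewrite /lin_deriv /lin_eval big_map !scaler_sumr -big_split; apply: eq_bigr => pv _ /=.
by rewrite derivM hornerD !hornerM scalerDl !scalerA.
Qed.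

Lemma rf_evalE (e : ratfun V) z :
  rf_eval e z = (rf_den e).[z]^-1 *: lin_eval (rf_num e) z.
Proof. by []. Qed.

Lemma rf_derivE (e : ratfun V) z :
  rf_deriv e z = ((rf_den e).[z] ^+ 2)^-1 *:
    ((rf_den e).[z] *: lin_deriv (rf_num e) z
     - (rf_den e)^`().[z] *: lin_eval (rf_num e) z).
Proof.
rewrite /rf_deriv /lin_deriv /lin_eval; congr (_ *: _).
rewrite !scaler_sumr -sumrB; apply: eq_bigr => pv _.
by rewrite !scalerA -scalerBl mulrC [X in _ - X]mulrC.
Qed.

(** [has_rat f g]: away from finitely many points, the function [f] is given
    by a rational function, whose derivative is [g]. *)
Definition has_rat (f g : F -> V) : Prop :=
  exists e : ratfun V, generically (fun z => rf_eval e z = f z /\ rf_deriv e z = g z).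

Lemma has_rat_ext f g f' g' : has_rat f g ->
  generically (fun z => f z = f' z /\ g z = g' z) -> has_rat f' g'.
Proof.
move=> [e he] hfg; exists e; apply: generically_mono (generically_and he hfg).
by move=> z [[-> ->] [-> ->]].
Qed.

Lemma has_rat_const v : has_rat (fun=> v) (fun=> 0).
Proof.
exists (RatFun [:: (1%:P, v)] (oner_neq0 _)); apply: generically_true => z.
rewrite rf_evalE rf_derivE /lin_eval /lin_deriv !big_seq1 /= derivC !hornerE.
by rewrite !scale1r !scale0r subrr expr1n invr1 !scale1r.
Qed.

Lemma has_rat_add f g f' g' : has_rat f g -> has_rat f' g' ->
  has_rat (fun z => f z + f' z) (fun z => g z + g' z).
Proof.
move=> [e he] [e' he'].
exists (RatFun (lin_mul (rf_den e') (rf_num e) ++ lin_mul (rf_den e) (rf_num e'))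
  (mulf_neq0 (rf_den_neq0 e) (rf_den_neq0 e'))).
have := generically_and (generically_nonroot (rf_den_neq0 e))
          (generically_nonroot (rf_den_neq0 e')).
move=> /(generically_and (generically_and he he')); apply: generically_mono.
move=> z [[[<- <-] [<- <-]] [d0 d0']]; rewrite !rf_evalE !rf_derivE /=.
rewrite !lin_eval_cat !lin_deriv_cat !lin_eval_mul !lin_deriv_mul derivM.
rewrite hornerD !hornerM.
set d := (rf_den e).[z] in d0 *; set d' := (rf_den e').[z] in d0' *.
set x := (rf_den e)^`().[z]; set x' := (rf_den e')^`().[z].
set v := lin_eval _ _; set v' := lin_eval _ _.
set u := lin_deriv _ _; set u' := lin_deriv _ _.
split.
  by rewrite scalerDr !scalerA; congr (_ *: _ + _ *: _); field; rewrite d0 d0'.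
transitivity ((d / d ^+ 2) *: u + (- x / d ^+ 2) *: v
    + ((d' / d' ^+ 2) *: u' + (- x' / d' ^+ 2) *: v')); last by lmod_ring.
set D := (X in X^-1).
transitivity ((D^-1 * (d * d' * d')) *: u
    + (D^-1 * (d * d' * x' - (x * d' + d * x') * d')) *: v
    + ((D^-1 * (d * d' * d)) *: u'
    + (D^-1 * (d * d' * x - (x * d' + d * x') * d)) *: v')); first by lmod_ring.
by rewrite /D; congr (_ *: _ + _ *: _ + (_ *: _ + _ *: _)); field; rewrite d0 d0'.
Qed.

End Numerators.

(** The numerator of a scalar rational function, as a polynomial. *)
Definition rf_poly (e : ratfun F^o) : {poly F} :=
  \sum_(pv <- rf_num e) pv.1 * (pv.2 : F)%:P.

Lemma lin_eval_poly (e : ratfun F^o) z : lin_eval (rf_num e) z = (rf_poly e).[z].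
Proof.
rewrite /rf_poly horner_sum; apply: eq_bigr => pv _; by rewrite hornerM hornerC.
Qed.

Lemma lin_deriv_poly (e : ratfun F^o) z : lin_deriv (rf_num e) z = (rf_poly e)^`().[z].
Proof.
rewrite /rf_poly raddf_sum horner_sum; apply: eq_bigr => pv _.
by rewrite /= derivM derivC mulr0 addr0 hornerM hornerC.
Qed.

Lemma has_rat_scale (V : lmodType F) (a a' : F -> F^o) (f g : F -> V) :
  has_rat a a' -> has_rat f g ->
  has_rat (fun z => a z *: f z) (fun z => a' z *: f z + a z *: g z).
Proof.
move=> [ea ha] [e he].
set P := rf_poly ea.
have PE z : lin_eval (rf_num ea) z = P.[z] by exact: lin_eval_poly.
have P'E z : lin_deriv (rf_num ea) z = P^`().[z] by exact: lin_deriv_poly.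
exists (RatFun (lin_mul P (rf_num e)) (mulf_neq0 (rf_den_neq0 ea) (rf_den_neq0 e))).
have := generically_and (generically_nonroot (rf_den_neq0 ea))
          (generically_nonroot (rf_den_neq0 e)).
move=> /(generically_and (generically_and ha he)); apply: generically_mono.
move=> z [[[<- <-] [<- <-]] [d0 d0']]; rewrite !rf_evalE !rf_derivE /= PE P'E.
rewrite !lin_eval_mul !lin_deriv_mul derivM hornerD !hornerM.
set d := (rf_den ea).[z] in d0 *; set d' := (rf_den e).[z] in d0' *.
set x := (rf_den ea)^`().[z]; set x' := (rf_den e)^`().[z].
set v := lin_eval _ _; set u := lin_deriv _ _.
have scE (b c : F) : b *: (c : F^o) = b * c by [].
rewrite !scE; set p := P.[z]; set p' := P^`().[z].
split; first by rewrite !scalerA; congr (_ *: _); field; rewrite d0 d0'.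
set D := (X in X^-1).
transitivity ((D^-1 * (d * d' * p' - (x * d' + d * x') * p)) *: v
   + (D^-1 * (d * d' * p)) *: u); first by lmod_ring.
transitivity (((d ^+ 2)^-1 * (d * p' - x * p) * d'^-1
   - d^-1 * p * (d' ^+ 2)^-1 * x') *: v + (d^-1 * p * (d' ^+ 2)^-1 * d') *: u).
  by rewrite /D; congr (_ *: _ + _ *: _); field; rewrite d0 d0'.
by lmod_ring.
Qed.

Lemma has_rat_scalel (V : lmodType F) (a a' : F -> F^o) (v : V) :
  has_rat a a' -> has_rat (fun z => a z *: v) (fun z => a' z *: v).
Proof.
move=> /has_rat_scale/(_ (has_rat_const v)); move/has_rat_ext; apply.
by apply: generically_true => z; rewrite scaler0 addr0.
Qed.

Lemma has_rat_scaler (V : lmodType F) (a : F) (f g : F -> V) :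
  has_rat f g -> has_rat (fun z => a *: f z) (fun z => a *: g z).
Proof.
move=> /(has_rat_scale (has_rat_const (a : F^o))); move/has_rat_ext; apply.
by apply: generically_true => z; rewrite scale0r add0r.
Qed.

Lemma has_rat_sum (V : lmodType F) (J : Type) (r : seq J) (f g : J -> F -> V) :
  (forall j, has_rat (f j) (g j)) ->
  has_rat (fun z => \sum_(j <- r) f j z) (fun z => \sum_(j <- r) g j z).
Proof.
move=> hfg; elim: r => [|j r IH].
  apply: has_rat_ext (has_rat_const 0) _.
  by apply: generically_true => z; rewrite !big_nil.
apply: has_rat_ext (has_rat_add (hfg j) IH) _.
by apply: generically_true => z; rewrite !big_cons.
Qed.

Lemma has_rat_mul (a a' b b' : F -> F^o) : has_rat a a' -> has_rat b b' ->
  has_rat (fun z => a z * b z : F^o) (fun z => a' z * b z + a z * b' z : F^o).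
Proof. exact: has_rat_scale. Qed.

Lemma has_rat_inv (s : F) :
  has_rat (fun z => (z - s)^-1 : F^o) (fun z => - (z - s)^-1 ^+ 2 : F^o).
Proof.
exists (@RatFun F F^o [:: (1%:P, 1)] _ (negbT (polyXsubC_eq0 s))).
apply: generically_mono (generically_neq s) => z; rewrite -subr_eq0 => zs.
rewrite rf_evalE rf_derivE /lin_eval /lin_deriv !big_seq1 /= derivXsubC derivC.
rewrite !hornerE /= scale0r !scaler0 scale1r.
have scE (b c : F) : b *: (c : F^o) = b * c by [].
rewrite sub0r !scE; split; first by rewrite !mulr1.
by rewrite !mulrN !mulr1 -exprVn.
Qed.

Lemma rf_eval_poly (e : ratfun F^o) z :
  rf_eval e z = (rf_poly e).[z] / (rf_den e).[z].
Proof. by rewrite rf_evalE lin_eval_poly mulrC. Qed.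

Lemma rf_deriv_poly (e : ratfun F^o) z :
  rf_deriv e z = ((rf_poly e)^`().[z] * (rf_den e).[z]
    - (rf_poly e).[z] * (rf_den e)^`().[z]) / (rf_den e).[z] ^+ 2.
Proof.
by rewrite rf_derivE lin_eval_poly lin_deriv_poly [RHS]mulrC [X in X - _]mulrC
  [X in _ - X]mulrC.
Qed.

(** Rational functions agreeing at almost all points have the same derivative. *)
Lemma has_rat_uniq (a a' b' : F -> F^o) : has_rat a a' -> has_rat a b' ->
  generically (fun z => a' z = b' z).
Proof.
move=> [e he] [f hf].
have hd := generically_and (generically_nonroot (rf_den_neq0 e))
            (generically_nonroot (rf_den_neq0 f)).
have E : rf_poly e * rf_den f = rf_poly f * rf_den e.
  apply: generically_horner_eq.
  apply: generically_mono (generically_and hd (generically_and he hf)).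
  move=> z [[d d'] [[ez _] [fz _]]]; move: ez; rewrite -fz !rf_eval_poly !hornerM.
  by move/eqP; rewrite eqr_div // => /eqP.
have E' := congr1 (fun p => p^`()) E; rewrite /= !derivM in E'.
apply: generically_mono (generically_and hd (generically_and he hf)).
move=> z [[d d'] [[_ <-] [_ <-]]]; rewrite !rf_deriv_poly.
move: (congr1 (fun p => p.[z]) E) (congr1 (fun p => p.[z]) E') d d'.
rewrite /= !hornerD !hornerM.
set P := (rf_poly e).[z]; set P' := (rf_poly e)^`().[z].
set R := (rf_poly f).[z]; set R' := (rf_poly f)^`().[z].
set D := (rf_den e).[z]; set D' := (rf_den e)^`().[z].
set G := (rf_den f).[z]; set G' := (rf_den f)^`().[z].
move=> H H' d d'; apply/eqP; rewrite eqr_div ?expf_neq0 //; apply/eqP.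
apply: (mulIf d); apply: (mulIf d').
have -> : R = P * G / D by rewrite H mulfK.
have -> : R' = (P' * G + P * G' - (P * G / D) * D') / D.
  by rewrite H' H mulfK // addrK mulfK.
by field.
Qed.

(** The image of a rational function by a linear map. *)
Definition rf_map (V W : lmodType F) (l : {linear V -> W}) (e : ratfun V) :
    ratfun W :=
  RatFun [seq (pv.1, l pv.2) | pv <- rf_num e] (rf_den_neq0 e).

Lemma rf_eval_map (V W : lmodType F) (l : {linear V -> W}) (e : ratfun V) z :
  rf_eval (rf_map l e) z = l (rf_eval e z).
Proof.
rewrite /rf_eval [RHS]linearZ_LR; congr (_ *: _); rewrite big_map [RHS]linear_sum.
by apply: eq_bigr => pv _; rewrite /= linearZ_LR.
Qed.

Lemma rf_deriv_map (V W : lmodType F) (l : {linear V -> W}) (e : ratfun V) z :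
  rf_deriv (rf_map l e) z = l (rf_deriv e z).
Proof.
rewrite /rf_deriv [RHS]linearZ_LR; congr (_ *: _); rewrite big_map [RHS]linear_sum.
apply: eq_bigr => pv _.
by rewrite [RHS]linearZ_LR.
Qed.

(** Multiplying numerator and denominator by a polynomial that vanishes at the
    exceptional points turns generic identities into identities valid wherever
    the denominator does not vanish. *)
Lemma has_rat_den (V : lmodType F) (f g : F -> V) (P : F -> Prop) : has_rat f g ->
  generically P ->
  exists e : ratfun V, forall z, (rf_den e).[z] != 0 ->
    [/\ P z, rf_eval e z = f z & rf_deriv e z = g z].
Proof.
move=> [e he] /(generically_and he) /(generically_and
  (generically_nonroot (rf_den_neq0 e))) [s hs].
pose S := \prod_(x <- s) ('X - x%:P).
have S0 : S != 0 by rewrite monic_neq0 // monic_prod_XsubC.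
exists (RatFun (lin_mul S (rf_num e)) (mulf_neq0 S0 (rf_den_neq0 e))) => z /=.
rewrite hornerM mulf_eq0 negb_or => /andP[Sz dz].
have /hs[dz' [[ez e'z] Pz]] : z \notin s.
  by apply: contraNN Sz; rewrite -root_prod_XsubC.
split=> //.
  rewrite -ez !rf_evalE /= lin_eval_mul hornerM scalerA.
congr (_ *: _).
  by field; rewrite Sz dz.
rewrite -e'z !rf_derivE /= lin_eval_mul lin_deriv_mul derivM hornerD !hornerM.
set x := S.[z] in Sz *; set x' := S^`().[z].
set d := (rf_den e).[z] in dz *; set d' := (rf_den e)^`().[z].
set u := lin_eval _ _; set v := lin_deriv _ _; set D := (X in X^-1).
transitivity ((D^-1 * (x * d * x' - (x' * d + x * d') * x)) *: u
   + (D^-1 * (x * d * x)) *: v); first by lmod_ring.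
transitivity ((- (d' / d ^+ 2)) *: u + (d / d ^+ 2) *: v); last by lmod_ring.
by rewrite /D; congr (_ *: _ + _ *: _); field; rewrite Sz dz.
Qed.

End RationalFunctions.

Section RationalVectors.
Context (F : numFieldType) (V : lmodType F).

(** A vector-valued polynomial that vanishes at almost all points vanishes
    identically. There is no basis to reduce to the scalar case; instead the
    coefficients are divided by [X - z0], with [z0] a point where it vanishes. *)
Lemma lin_eval_eq0 (s : seq ({poly F} * V)) :
  generically (fun z => lin_eval s z = 0) ->
  forall z, lin_eval s z = 0 /\ lin_deriv s z = 0.
Proof.
have [n] := ubnP (\max_(pv <- s) size pv.1)%N; elim: n s => // n IH s.
rewrite ltnS => les; case: n => [|n] in IH les *.
  move=> _ z; rewrite /lin_eval /lin_deriv !big_seq; split; apply: big1 => pv spv;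
  have := leq_trans (@leq_bigmax_seq _ _ xpredT (fun pv : {poly F} * V => size pv.1) _ spv isT) les;
  by rewrite leqn0 size_poly_eq0 => /eqP ->; rewrite ?deriv0 horner0 scale0r.
move=> s0; have [z0 z0s] := generically_ex s0.
pose t := [seq (pv.1 %/ ('X - z0%:P), pv.2) | pv <- s].
have tE z : lin_eval s z = (z - z0) *: lin_eval t z.
  rewrite -[LHS]subr0 -z0s /lin_eval big_map -sumrB scaler_sumr.
  apply: eq_bigr => pv _ /=; rewrite -scalerBl scalerA; congr (_ *: _).
  rewrite {1}(divp_eq pv.1 ('X - z0%:P)) modp_XsubC !hornerE.
  by rewrite addrK mulrC.
have tE' z : lin_deriv s z = lin_eval t z + (z - z0) *: lin_deriv t z.
  rewrite /lin_eval /lin_deriv !big_map scaler_sumr -big_split.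
  apply: eq_bigr => pv _ /=; rewrite scalerA -scalerDl; congr (_ *: _).
  rewrite {1}(divp_eq pv.1 ('X - z0%:P)) modp_XsubC derivD derivC addr0.
  by rewrite derivM derivXsubC mulr1 hornerD hornerM hornerXsubC addrC mulrC.
suff t0 z : lin_eval t z = 0 /\ lin_deriv t z = 0.
  by move=> z; rewrite tE tE'; case: (t0 z) => -> ->; rewrite !scaler0 addr0.
apply: IH => {z}; last first.
  apply: generically_mono (generically_and s0 (generically_neq z0)) => z [].
  move/eqP; rewrite tE scaler_eq0 subr_eq0 => /orP[/eqP->|/eqP//].
  by rewrite eqxx.
rewrite ltnS; apply/bigmax_leqP_seq => pv; rewrite /t => /mapP[qv qs -> _] /=.
rewrite size_divp ?polyXsubC_eq0 // size_XsubC /= leq_subLR.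
exact: leq_trans (@leq_bigmax_seq _ _ xpredT (fun pv : {poly F} * V => size pv.1) _ qs isT) les.
Qed.

Lemma has_rat0 (f g : F -> V) : has_rat f g -> generically (fun z => f z = 0) ->
  generically (fun z => g z = 0).
Proof.
move=> [e he] f0; have e0 : generically (fun z => lin_eval (rf_num e) z = 0).
  apply: generically_mono (generically_and (generically_and he f0)
    (generically_nonroot (rf_den_neq0 e))) => z [[[<- _]]].
  rewrite rf_evalE => /eqP; rewrite scaler_eq0 invr_eq0 => /orP[/eqP->|/eqP//].
  by rewrite eqxx.
apply: generically_mono he => z [_ <-]; have [e1 e2] := lin_eval_eq0 e0 z.
by rewrite rf_derivE e1 e2 !scaler0 subrr scaler0.
Qed.

End RationalVectors.

(** * The dual affine algebra *)

Section LieBasics.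
Context (F : numFieldType) (L : lieAlgebra F).
Implicit Types x y z : L.

HB.instance Definition _ (x : L) := GRing.isLinear.Build F L L *:%R (br x)
  (fun c y z => br_linearr c y z x).

(** The bracket as a linear function of its left argument. *)
Definition brr (y x : L) : L := br x y.

HB.instance Definition _ (y : L) := GRing.isLinear.Build F L L *:%R (brr y)
  (fun c x z => br_linearl c x z y).

Lemma brC x y : br x y = - br y x.
Proof.
have := br_alt (x + y); rewrite raddfD /= -/(brr x (x + y)) -/(brr y (x + y)).
rewrite !raddfD /= /brr !br_alt add0r addr0 => /eqP.
by rewrite addrC addr_eq0 => /eqP.
Qed.

Lemma brDr x y z : br x (y + z) = br x y + br x z.
Proof. exact: raddfD. Qed.
Lemma brZl c x z : br (c *: x) z = c *: br x z.
Proof. exact: (linearZ_LR (brr z)). Qed.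
Lemma brZr c x z : br x (c *: z) = c *: br x z.
Proof. exact: (linearZ_LR (br x)). Qed.
Lemma brNr x z : br x (- z) = - br x z.
Proof. exact: raddfN. Qed.
Lemma br0l x : br 0 x = 0.
Proof. exact: (raddf0 (brr x)). Qed.
Lemma br0r x : br x 0 = 0.
Proof. exact: raddf0. Qed.
Lemma br_suml (J : Type) (r : seq J) (P : pred J) (G : J -> L) y :
  br (\sum_(j <- r | P j) G j) y = \sum_(j <- r | P j) br (G j) y.
Proof. exact: (raddf_sum (brr y)). Qed.
Lemma br_sumr (J : Type) (r : seq J) (P : pred J) (G : J -> L) y :
  br y (\sum_(j <- r | P j) G j) = \sum_(j <- r | P j) br y (G j).
Proof. exact: raddf_sum. Qed.

Lemma br_brl x y z : br (br x y) z = br x (br y z) - br y (br x z).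
Proof.
have /eqP := br_jacobi x y z; rewrite addr_eq0 (brC z (br x y)) opprK => /eqP <-.
by rewrite (brC z x) brNr.
Qed.

Lemma br_brr x y z : br x (br y z) = br (br x y) z + br y (br x z).
Proof. by rewrite br_brl subrK. Qed.

(** Eigenvectors of [ad r] with distinct eigenvalues are independent. *)
Lemma ad_eigen_independent (r : L) K (y : nat -> L) :
  (forall k, br r (y k) = k%:R *: y k) ->
  \sum_(k < K) y k = 0 -> forall k, (k < K)%N -> y k = 0.
Proof.
elim: K y => // K IH y hy s0.
have yl k : (k < K)%N -> y k = 0.
  move=> kK; have h : (k%:R - K%:R) *: y k = 0.
    apply: (IH (fun k => (k%:R - K%:R) *: y k)) => // [j|].
      by rewrite brZr hy !scalerA mulrC.
    move: s0; rewrite big_ord_recr /= => /eqP; rewrite addr_eq0 => /eqP s0.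
    transitivity (br r (\sum_(i < K) y i) - K%:R *: \sum_(i < K) y i).
      rewrite br_sumr scaler_sumr -sumrB.
      by apply: eq_bigr => i _; rewrite hy scalerBl.
    by rewrite s0 brNr hy scalerN subrr.
  move/eqP: h; rewrite scaler_eq0 subr_eq0 eqr_nat => /orP[/eqP kK'|/eqP//].
  by rewrite kK' ltnn in kK.
move=> k; rewrite ltnS leq_eqVlt => /orP[/eqP ->|/yl//].
by move: s0; rewrite big_ord_recr /= big1 ?add0r // => i _; apply: yl.
Qed.

End LieBasics.

(** In [Z/M], [n - 1] is the predecessor of [n] as an integer unless [n = 0]. *)
Lemma ord_pred_ltn (M : nat) (n : 'I_M) : (ord_pred n < n)%N -> (ord_pred n).+1 = n.
Proof.
have := ltn_ord n; case: (posnP n) => [->|n0] nM; first by rewrite ltn0.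
have -> : (ord_pred n = n.-1 :> nat).
  by rewrite /= -subn1 addnC -addnBA // modnDl subn1 modn_small //; lia.
by rewrite prednK.
Qed.

Lemma ord_pred_succ (M : nat) (n : 'I_M) : (0 < n)%N -> (ord_pred n).+1 = n.
Proof.
move=> n0; apply: ord_pred_ltn; rewrite /= -subn1 addnC -addnBA // modnDl subn1.
by rewrite modn_small ?ltn_predL // (leq_ltn_trans (leq_pred _)).
Qed.

Lemma ord_pred_first (M : nat) (n : 'I_M) : n = 0%N :> nat -> ord_pred n = M.-1 :> nat.
Proof.
move=> n0; have M0 : (0 < M)%N := leq_ltn_trans (leq0n _) (ltn_ord n).
by rewrite /= n0 add0n modn_small ?ltn_predL.
Qed.

Section CyclicIndices.
Context (M : nat) (M_ge3 : (3 <= M)%N).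
Implicit Types i j : 'I_M.

Lemma ordS_neq i : ordS i != i.
Proof.
apply/negP => /eqP/(congr1 val) /=; have := ltn_ord i.
rewrite leq_eqVlt => /orP[/eqP h|h]; last by rewrite modn_small //; lia.
by rewrite h modnn; lia.
Qed.

Lemma ordSS_neq i : ordS (ordS i) != i.
Proof.
apply/negP => /eqP/(congr1 val) /=; have := ltn_ord i.
rewrite leq_eqVlt => /orP[/eqP h|h]; first by rewrite h modnn modn_small; lia.
rewrite [(i.+1 %% M)%N]modn_small //.
have : (i.+2 <= M)%N by [].
rewrite leq_eqVlt => /orP[/eqP h'|h']; last by rewrite modn_small //; lia.
by rewrite h' modnn; lia.
Qed.

Lemma ord_pred_neq i : ord_pred i != i.
Proof. by rewrite -(inj_eq (can_inj (@ordSK M))) ord_predK eq_sym ordS_neq. Qed.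

Lemma ord_predS_neq i : ord_pred i != ordS i.
Proof. by rewrite -(inj_eq (can_inj (@ordSK M))) ord_predK eq_sym ordSS_neq. Qed.

Lemma ordS_eq i j : (ordS i == j) = (i == ord_pred j).
Proof. by rewrite -[j in LHS]ord_predK (inj_eq (can_inj (@ordSK M))). Qed.

Lemma cartan_S i : cartan i (ordS i) = -1.
Proof.
rewrite /cartan eqxx eq_sym (negbTE (ordS_neq i)).
by rewrite (negbTE (ord_predS_neq i)).
Qed.

Lemma cartan_P i : cartan i (ord_pred i) = -1.
Proof.
rewrite /cartan eqxx eq_sym (negbTE (ord_pred_neq i)) eq_sym.
by rewrite (negbTE (ord_predS_neq i)).
Qed.

Lemma cartanC i j : cartan i j = cartan j i.
Proof.
by rewrite /cartan (eq_sym i) ordS_eq (eq_sym i) (eq_sym (ord_pred i)) -ordS_eq addrAC.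
Qed.

Lemma sum_ordS (W : zmodType) (G : 'I_M -> W) : \sum_i G (ordS i) = \sum_i G i.
Proof. by rewrite [RHS](reindex_inj (can_inj (@ordSK M))). Qed.

Lemma sum_ord_pred (W : zmodType) (G : 'I_M -> W) :
  \sum_i G (ord_pred i) = \sum_i G i.
Proof. by rewrite [RHS](reindex_inj (can_inj (@ord_predK M))). Qed.

(** The action of the cyclic Cartan matrix, the discrete Laplacian. *)
Lemma sum_cartan (K : numFieldType) (a : 'I_M -> K) j :
  \sum_i a i * (cartan i j)%:~R = 2 * a j - a (ordS j) - a (ord_pred j).
Proof.
have pick (k : 'I_M) : \sum_i a i * (k == i)%:R = a k.
  rewrite (bigD1 k) //= eqxx mulr1 big1 ?addr0 // => i.
  by rewrite eq_sym => /negbTE ->; rewrite mulr0.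
transitivity (2 * (\sum_i a i * (j == i)%:R) - \sum_i a i * (ord_pred j == i)%:R
   - \sum_i a i * (ordS j == i)%:R); last by rewrite !pick addrAC.
rewrite mulr_sumr -!sumrB; apply: eq_bigr => i _.
rewrite cartanC /cartan !rmorphB rmorphM /= -!pmulrn.
by ring.
Qed.

End CyclicIndices.

Section DualAffine.
Context (F : numFieldType) (M : nat) (M_ge3 : (3 <= M)%N) (L : dual_affine F M).
Local Notation e := (da_e L).
Local Notation f := (da_f L).
Local Notation h := (da_h L).
Local Notation al := (alpha F).
Implicit Types (i j : 'I_M) (x y : L) (t : weight F M).

Lemma da_ef i j : br (e i) (f j) = if i == j then h (al i) else 0.
Proof. by case: (da_relations L) => _ [+ _]; apply. Qed.

Lemma da_he t i : br (h t) (e i) = on_coroot t i *: e i.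
Proof. by case: (da_relations L) => _ [_ [+ _]]; apply. Qed.

Lemma da_hf t i : br (h t) (f i) = - on_coroot t i *: f i.
Proof. by case: (da_relations L) => _ [_ [_ [+ _]]]; apply. Qed.

Lemma da_eh t i : br (e i) (h t) = - on_coroot t i *: e i.
Proof. by rewrite brC da_he scaleNr. Qed.

Lemma da_fh t i : br (f i) (h t) = on_coroot t i *: f i.
Proof. by rewrite brC da_hf scaleNr opprK. Qed.

Lemma on_coroot_alpha i j : on_coroot (al j) i = (cartan i j)%:~R.
Proof. by rewrite /on_coroot /= mxE. Qed.

Lemma da_ee i j : i != j -> j != ordS i -> i != ordS j -> br (e i) (e j) = 0.
Proof.
move=> ij jS iS; case: (da_relations L) => _ [_ [_ [_ [+ _]]]].
move=> /(_ i j ij); rewrite /cartan (negbTE ij) eq_sym (negbTE jS).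
by rewrite -(inj_eq (can_inj (@ordSK M))) ord_predK (negbTE iS).
Qed.

Lemma da_ff i j : i != j -> j != ordS i -> i != ordS j -> br (f i) (f j) = 0.
Proof.
move=> ij jS iS; case: (da_relations L) => _ [_ [_ [_ [_ +]]]].
move=> /(_ i j ij); rewrite /cartan (negbTE ij) eq_sym (negbTE jS).
by rewrite -(inj_eq (can_inj (@ordSK M))) ord_predK (negbTE iS).
Qed.

Lemma da_fff_S i : br (f i) (br (f i) (f (ordS i))) = 0.
Proof.
case: (da_relations L) => _ [_ [_ [_ [_ +]]]].
by move=> /(_ i (ordS i)); rewrite eq_sym ordS_neq // cartan_S //; apply.
Qed.

Lemma da_fff_P i : br (f i) (br (f i) (f (ord_pred i))) = 0.
Proof.
case: (da_relations L) => _ [_ [_ [_ [_ +]]]].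
by move=> /(_ i (ord_pred i)); rewrite eq_sym ord_pred_neq // cartan_P //; apply.
Qed.

(** A double sum of brackets of generators only involves cyclic neighbours. *)
Lemma da_ee_sum (a b : 'I_M -> F) :
  br (\sum_i a i *: e i) (\sum_i b i *: e i) =
  \sum_i (a i * b (ordS i) - a (ordS i) * b i) *: br (e i) (e (ordS i)).
Proof.
rewrite br_suml.
have E i : br (a i *: e i) (\sum_j b j *: e j)
   = (a i * b (ordS i)) *: br (e i) (e (ordS i))
     + (a i * b (ord_pred i)) *: br (e i) (e (ord_pred i)).
  rewrite brZl br_sumr (bigD1 (ordS i)) //= (bigD1 (ord_pred i)) ?ord_predS_neq //=.
  rewrite big1 => [|j /andP[jS jP]]; last first.
    rewrite brZr; have [->|ij] := eqVneq i j; first by rewrite br_alt scaler0.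
    rewrite da_ee ?scaler0 //; apply: contraNneq jP => ->.
    by rewrite ordSK.
  by rewrite addr0 scalerDr !brZr !scalerA.
under eq_bigr => i _ do rewrite E.
rewrite big_split /= -[X in _ + X = _]sum_ordS -big_split; apply: eq_bigr => i _ /=.
by rewrite ordSK (brC (e (ordS i))) scalerN -scalerBl.
Qed.

(** The elements [p_-1] and [p_-2] commute: the terms of the expansion of their
    bracket cancel by the Serre relations and the Jacobi identity. For [M = 3] the
    neighbours of [i] at distance 2 coincide, whence the separate case. *)
Lemma br_pm1_pm2 : br (p_m1 L) (p_m2 L) = 0.
Proof.
pose T j i := br (f j) (br (f i) (f (ordS i))).
pose A := \sum_i T (ord_pred i) i; pose A' := \sum_i T (ordS i) (ord_pred i).
have Tii i : T i i = 0 by apply: da_fff_S.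
have TSi i : T (ordS i) i = 0.
  by have := da_fff_P (ordS i); rewrite ordSK /T (brC (f i)) brNr => ->; rewrite oppr0.
have jac : A + A' + \sum_i br (f i) (br (f (ordS i)) (f (ord_pred i))) = 0.
  rewrite -!big_split big1 // => i _ /=; rewrite /T ord_predK addrAC.
  exact: br_jacobi.
have T0 i j : j != i -> j != ordS i -> j != ord_pred i -> j != ordS (ordS i) ->
    T j i = 0.
  move=> ji jS jP jSS; rewrite /T br_brr.
  rewrite (da_ff ji) ?da_ff ?br0l ?br0r ?addr0 //.
  - by rewrite (inj_eq (can_inj (@ordSK M))) eq_sym.
  - by apply: contraNneq jP => ->; rewrite ordSK.
have A'E : A' = \sum_i T (ordS (ordS i)) i.
  by rewrite /A' -sum_ordS; apply: eq_bigr => i _; rewrite ordSK.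
rewrite /p_m1 /p_m2 brNr br_suml; under eq_bigr => j _ do rewrite br_sumr.
rewrite exchange_big /=; apply/eqP; rewrite oppr_eq0; apply/eqP.
(* The terms of the Jacobi identity have equal sums if M = 3; the third vanishes if M > 3. *)
have [M3|M3] := eqVneq M 3%N.
  have SSS i : ordS (ordS i) = ord_pred i.
    apply: (can_inj (@ordSK M)); rewrite ord_predK; apply: val_inj => /=.
    have iM : (i < 3)%N by rewrite -M3 ltn_ord.
    by move: (nat_of_ord i) iM => k; rewrite M3; case: k => [|[|[|]]].
  have A'A : A' = A by rewrite A'E; apply: eq_bigr => i _; rewrite SSS.
  have A3 : A *+ 3 = 0.
    rewrite -[RHS]jac A'A !mulrS mulr0n addr0 addrA; congr (_ + _).
    rewrite /A -sum_ordS; apply: eq_bigr => i _; rewrite /T ordSK.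
    by rewrite SSS.
  have A0 : A = 0.
    move/eqP: A3; rewrite -scaler_nat scaler_eq0 pnatr_eq0 /= => /eqP //.
  rewrite -[RHS]A0; apply: eq_bigr => i _.
  rewrite (bigD1 (ord_pred i)) //= big1 ?addr0 // => j jP.
  have [->|ji] := eqVneq j i; first exact: Tii.
  have [->|jS] := eqVneq j (ordS i); first exact: TSi.
  by apply: T0 => //; rewrite SSS.
have SSP i : ordS (ordS i) != ord_pred i.
  rewrite -(inj_eq (can_inj (@ordSK M))) ord_predK; apply/negP => /eqP/(congr1 val) /=.
  have modS k : ((k %% M).+1 %% M = k.+1 %% M)%N by rewrite -addn1 modnDml addn1.
  have modS2 k : ((k %% M).+2 %% M = k.+2 %% M)%N by rewrite -addn2 modnDml addn2.
  rewrite !modS modS2 -addn3 => /eqP.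
  rewrite -[X in _ == X](modn_small (ltn_ord i)) -[X in _ == X %[mod _]]addn0 eqn_modDl.
  by rewrite mod0n modn_small // ltn_neqAle eq_sym M3.
have third : \sum_i br (f i) (br (f (ordS i)) (f (ord_pred i))) = 0.
  rewrite big1 // => i _; rewrite da_ff ?br0r // ?ord_predK ?ordS_neq //.
    by rewrite eq_sym ord_predS_neq.
  by rewrite eq_sym SSP.
rewrite third addr0 A'E in jac; rewrite -[RHS]jac -big_split; apply: eq_bigr => i _ /=.
rewrite (bigD1 (ord_pred i)) //= (bigD1 (ordS (ordS i))) ?SSP //= big1 ?addr0 //.
move=> j /andP[jP jSS].
have [->|ji] := eqVneq j i; first exact: Tii.
have [->|jS] := eqVneq j (ordS i); first exact: TSi.
exact: T0.
Qed.

End DualAffine.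

(** * Elements of degree 1 and 2 of the positive part *)

Section Degrees.
Context (F : numFieldType) (M : nat) (M_ge3 : (3 <= M)%N) (L : dual_affine F M).
Local Notation e := (da_e L).
Local Notation h := (da_h L).
Implicit Types (x y : L).

Let br_rho_e i : br (da_rho L) (e i) = e i.
Proof. by rewrite da_he /on_coroot /= mxE scale1r. Qed.

(** Combinations of the generators, and of the brackets of neighbouring ones. *)
Definition span1 x := exists a : 'I_M -> F, x = \sum_i a i *: e i.
Definition span2 x :=
  exists b : 'I_M -> F, x = \sum_i b i *: br (e i) (e (ordS i)).

Lemma span1_comb c x y : span1 x -> span1 y -> span1 (c *: x + y).
Proof.
move=> [a ->] [b ->]; exists (fun i => c * a i + b i).
by rewrite scaler_sumr -big_split; apply: eq_bigr => i _; rewrite scalerA scalerDl.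
Qed.

Lemma span2_comb c x y : span2 x -> span2 y -> span2 (c *: x + y).
Proof.
move=> [a ->] [b ->]; exists (fun i => c * a i + b i).
by rewrite scaler_sumr -big_split; apply: eq_bigr => i _; rewrite scalerA scalerDl.
Qed.

Lemma span1_0 : span1 0.
Proof. by exists (fun=> 0); rewrite big1 // => i _; rewrite scale0r. Qed.

Lemma span2_0 : span2 0.
Proof. by exists (fun=> 0); rewrite big1 // => i _; rewrite scale0r. Qed.

(** Homogeneous vectors paired with their degree. In degrees 1 and 2 the property
    also records the spans, which makes it stable under brackets. *)
Let homogeneous (kx : nat * L) : Prop :=
  [/\ br (da_rho L) kx.2 = kx.1%:R *: kx.2, (0 < kx.1)%N,
      kx.1 = 1%N -> span1 kx.2 & kx.1 = 2%N -> span2 kx.2].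

Let graded x := exists2 s : seq (nat * L),
  {in s, forall kx, homogeneous kx} & x = \sum_(kx <- s) kx.2.

Let nplus_graded x : in_nplus x -> graded x.
Proof.
apply.
- move=> i; exists [:: (1%N, e i)]; last by rewrite big_seq1.
  move=> kx; rewrite inE => /eqP ->; split=> //=; first by rewrite br_rho_e scale1r.
  move=> _;  exists (fun j => (j == i)%:R); rewrite (bigD1 i) //= eqxx scale1r big1 ?addr0 //.
  by move=> j /negbTE ->; rewrite scale0r.
- move=> c y y' [s hs ->] [s' hs' ->].
  exists ([seq (kx.1, c *: kx.2) | kx <- s] ++ s'); last first.
    by rewrite big_cat big_map /= scaler_sumr.
  move=> kx; rewrite mem_cat => /orP[/mapP[ky /hs[hy hk h1 h2] ->]|/hs'//].
  split=> //=; first by rewrite brZr hy !scalerA mulrC.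
  + by move=> k; rewrite -[_ *: _]addr0; apply: span1_comb span1_0; apply: h1.
  + by move=> k; rewrite -[_ *: _]addr0; apply: span2_comb span2_0; apply: h2.
- move=> y y' [s hs ->] [s' hs' ->].
  exists [seq ((kx.1 + ky.1)%N, br kx.2 ky.2) | kx <- s, ky <- s']; last first.
    rewrite big_allpairs_dep br_suml; apply: eq_bigr => kx _; exact: br_sumr.
  move=> _ /allpairsP[[kx ky] /= [/hs[x1 x2 x3 x4] /hs'[y1 y2 y3 y4] ->]].
  split=> /=; rewrite ?addn_gt0 ?x2 //.
  + by rewrite br_brr x1 y1 brZl brZr -scalerDl natrD.
  + by move: x2 y2; case: kx.1 ky.1 => [|k] [|l] //; rewrite addSnnS !addnS.
  + move=> k2; have [kx1 ky1] : kx.1 = 1%N /\ ky.1 = 1%N.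
      by clear -x2 y2 k2; move: kx.1 ky.1 x2 y2 k2 => k l; lia.
    have [a ->] := x3 kx1; have [b ->] := y3 ky1.
    by rewrite da_ee_sum //; eexists.
Qed.

(** An element of degree [d] is the sum of its components of degree [d], since
    eigenvectors of [ad rho] with distinct eigenvalues are independent. *)
Let deg_component (d : nat) x : in_nplus_deg d x ->
  exists s : seq (nat * L), {in s, forall kx, homogeneous kx} /\
    x = \sum_(kx <- s | kx.1 == d) kx.2.
Proof.
move=> [/nplus_graded[s hs xE] xd]; exists s; split=> //.
pose K := (\max_(kx <- s) kx.1 + d).+1.
pose y k := \sum_(kx <- s | kx.1 == k) kx.2.
have yk k : br (da_rho L) (y k) = k%:R *: y k.
  rewrite br_sumr scaler_sumr big_seq_cond [RHS]big_seq_cond.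
  by apply: eq_bigr => kx /andP[/hs[-> _ _ _] /eqP ->].
have dK : (d < K)%N by rewrite ltnS leq_addl.
have xy : x = \sum_(k < K) y k.
  rewrite xE (exchange_big_dep xpredT) //= big_seq [RHS]big_seq.
  apply: eq_bigr => kx ks; have kK : (kx.1 < K)%N.
    rewrite ltnS; apply: leq_trans (leq_addr _ _).
    exact: (@leq_bigmax_seq _ _ xpredT (fun kx : nat * L => kx.1)).
  by rewrite (big_pred1 (Ordinal kK)).
have := ad_eigen_independent (r := da_rho L) (K := K)
  (y := fun k => y k - (k == d)%:R *: x) _ _ dK.
rewrite eqxx scale1r => yd; apply/esym/eqP; rewrite -subr_eq0; apply/eqP/yd.
  move=> k; rewrite brDr brNr brZr yk xd scalerBr; congr (_ - _); rewrite !scalerA.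
  by have [->|_] := eqVneq k d; rewrite ?mulr0 ?mul0r // mulrC.
rewrite sumrB -xy (bigD1 (Ordinal dK)) //= eqxx scale1r big1 ?addr0 ?subrr // => k.
by rewrite -val_eqE /= => /negbTE ->; rewrite scale0r.
Qed.

Lemma nplus_deg1 x : in_nplus_deg 1 x -> span1 x.
Proof.
move=> /deg_component[s [hs ->]]; rewrite big_seq_cond.
elim/big_rec: _ => [|kx y /andP[/hs[_ _ + _] /eqP k1] IH]; first exact: span1_0.
by move/(_ k1) => hk; rewrite -[kx.2]scale1r; apply: span1_comb.
Qed.

Lemma nplus_deg2 x : in_nplus_deg 2 x -> span2 x.
Proof.
move=> /deg_component[s [hs ->]]; rewrite big_seq_cond.
elim/big_rec: _ => [|kx y /andP[/hs[_ _ _ +] /eqP k1] IH]; first exact: span2_0.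
by move/(_ k1) => hk; rewrite -[kx.2]scale1r; apply: span2_comb.
Qed.

End Degrees.

(** * The gauge equations in degrees 0 and 2 *)

Section InvariantForm.
Context (F : numFieldType) (M : nat) (M_ge3 : (3 <= M)%N) (L : dual_affine F M).
Context (B : L -> L -> F) (B_form : invariant_form B).
Local Notation e := (da_e L).
Local Notation f := (da_f L).
Local Notation h := (da_h L).
Implicit Types (i j : 'I_M) (x y : L) (t : weight F M).

(** The linear form [B _ y]. The proof that [B] is an invariant form is an argument
    so that a linear structure can be attached to it. *)
Definition form_at (y : L) (_ : invariant_form B) : L -> F^o := fun x => B x y.

Fact form_at_linear y : linear (form_at y B_form).
Proof. by have [Bl _ _ _] := B_form; move=> c u v; apply: Bl. Qed.

HB.instance Definition _ y :=
  GRing.isLinear.Build F L F^o *:%R (form_at y B_form) (form_at_linear y).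

Lemma BC x y : B x y = B y x. Proof. by case: B_form. Qed.
Lemma B_inv x y z : B (br x y) z = B x (br y z). Proof. by case: B_form. Qed.
Lemma B_ef i j : B (da_e L i) (da_f L j) = (i == j)%:R. Proof. by case: B_form. Qed.

Lemma BDl x y z : B (x + y) z = B x z + B y z.
Proof. exact: (raddfD (form_at z B_form)). Qed.
Lemma BNl x z : B (- x) z = - B x z.
Proof. exact: (raddfN (form_at z B_form)). Qed.
Lemma BZl c x z : B (c *: x) z = c * B x z.
Proof. exact: (linearZ_LR (form_at z B_form)). Qed.
Lemma B0l z : B 0 z = 0.
Proof. exact: (raddf0 (form_at z B_form)). Qed.
Lemma B_suml (J : Type) (r : seq J) (P : pred J) (G : J -> L) y :
  B (\sum_(j <- r | P j) G j) y = \sum_(j <- r | P j) B (G j) y.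
Proof. exact: (raddf_sum (form_at y B_form)). Qed.
Lemma BDr x y z : B z (x + y) = B z x + B z y. Proof. by rewrite !(BC z) BDl. Qed.
Lemma B0r z : B z 0 = 0. Proof. by rewrite BC B0l. Qed.
Lemma BNr x z : B z (- x) = - B z x. Proof. by rewrite !(BC z) BNl. Qed.
Lemma BZr c x z : B z (c *: x) = c * B z x. Proof. by rewrite !(BC z) BZl. Qed.
Lemma B_sumr (J : Type) (r : seq J) (P : pred J) (G : J -> L) y :
  B y (\sum_(j <- r | P j) G j) = \sum_(j <- r | P j) B y (G j).
Proof. by rewrite BC B_suml; apply: eq_bigr => j _; rewrite BC. Qed.

Lemma B_hh i t : B (h (alpha F i)) (h t) = on_coroot t i.
Proof.
have := da_ef L i i; rewrite eqxx => <-.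
by rewrite B_inv da_fh BZr B_ef eqxx mulr1.
Qed.

(** The map [da_h] need not be known to be injective: the invariant form recovers the
    values on the coroots. *)
Lemma da_h_coroot t t' i : h t = h t' -> on_coroot t i = on_coroot t' i.
Proof. by move=> tt'; rewrite -!B_hh tt'. Qed.

Lemma pick_ord (K : pzSemiRingType) (a : 'I_M -> K) i :
  \sum_j a j * (j == i)%:R = a i.
Proof.
by rewrite (bigD1 i) //= eqxx mulr1 big1 ?addr0 // => j /negbTE ->; rewrite mulr0.
Qed.

Lemma B_sum_e (a : 'I_M -> F) i : B (\sum_j a j *: e j) (f i) = a i.
Proof.
rewrite B_suml -[RHS](pick_ord a); apply: eq_bigr => j _.
by rewrite BZl B_ef.
Qed.

(** With [br_pm1_pm2] and the normalization of [p 2], all that is used of [p_-2]. *)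
Lemma br_e_pm2 i : br (e i) (p_m2 L) = f (ord_pred i) - f (ordS i).
Proof.
rewrite brNr br_sumr (bigD1 i) //= (bigD1 (ord_pred i)) ?ord_pred_neq //=.
rewrite big1 => [|j /andP[ji jP]]; last first.
  rewrite br_brr !da_ef [i == j]eq_sym (negbTE ji) br0l add0r.
  rewrite eq_sym ordS_eq (negbTE jP) br0r //.
rewrite addr0 ord_predK (br_brr _ (f i)) (br_brr _ (f (ord_pred i))) !da_ef eqxx.
rewrite (eq_sym i (ordS i)) (negbTE (ordS_neq M_ge3 i)).
rewrite (eq_sym i (ord_pred i)) (negbTE (ord_pred_neq M_ge3 i)).
rewrite br0r br0l addr0 add0r da_hf da_fh !on_coroot_alpha cartanC.
rewrite cartan_S // cartanC cartan_P //.
by rewrite !rmorphN1 opprK scale1r scaleN1r opprD opprK addrC.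
Qed.

Lemma B_br_e_pm2 (a : 'I_M -> F) y :
  B (br (\sum_i a i *: e i) y) (p_m2 L) =
  \sum_i a i * (B y (f (ordS i)) - B y (f (ord_pred i))).
Proof.
rewrite brC BNl B_inv br_suml B_sumr -sumrN; apply: eq_bigr => i _.
by rewrite brZl br_e_pm2 BZr BDr BNr -mulrN opprB.
Qed.

Lemma B_ee_pm2 i : B (br (e i) (e (ordS i))) (p_m2 L) = 1.
Proof.
rewrite B_inv br_e_pm2 ordSK BDr BNr !B_ef eqxx.
by rewrite eq_sym (negbTE (ordSS_neq M_ge3 i)) subr0.
Qed.

Lemma br_ee_h i t : br (br (e i) (e (ordS i))) (h t) =
  - (on_coroot t i + on_coroot t (ordS i)) *: br (e i) (e (ordS i)).
Proof.
rewrite br_brl !da_eh !brZr (brC (e (ordS i))).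
by lmod_ring.
Qed.

Lemma B_ee_h (b : 'I_M -> F) t :
  B (br (\sum_i b i *: br (e i) (e (ordS i))) (h t)) (p_m2 L) =
  - \sum_i b i * (on_coroot t i + on_coroot t (ordS i)).
Proof.
rewrite br_suml B_suml -sumrN; apply: eq_bigr => i _.
by rewrite brZl br_ee_h !BZl B_ee_pm2; ring.
Qed.

Lemma B_ee (b : 'I_M -> F) :
  B (\sum_i b i *: br (e i) (e (ordS i))) (p_m2 L) = \sum_i b i.
Proof. by rewrite B_suml; apply: eq_bigr => i _; rewrite BZl B_ee_pm2 mulr1. Qed.

Lemma br_e_pm1 (a : 'I_M -> F) :
  br (\sum_i a i *: e i) (p_m1 L) = h (\sum_i a i *: alpha F i).
Proof.
rewrite br_suml linear_sum; apply: eq_bigr => i _.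
rewrite brZl linearZ_LR br_sumr (bigD1 i) //= da_ef eqxx big1 ?addr0 // => j.
by rewrite da_ef eq_sym => /negbTE ->.
Qed.

Lemma B_e_h_f (a : 'I_M -> F) t i :
  B (br (\sum_j a j *: e j) (h t)) (f i) = - (a i * on_coroot t i).
Proof.
rewrite B_inv da_hf BZr BC.
rewrite (BC (f i)) B_sum_e; ring.
Qed.

Lemma B_ee_pm1_f (b : 'I_M -> F) i :
  B (br (\sum_j b j *: br (e j) (e (ordS j))) (p_m1 L)) (f i) = b i - b (ord_pred i).
Proof.
have E j : br (br (e j) (e (ordS j))) (p_m1 L) = e j - e (ordS j).
  have E1 k : br (e k) (p_m1 L) = h (alpha F k).
    rewrite br_sumr (bigD1 k) //= da_ef eqxx big1 ?addr0 // => l.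
    by rewrite da_ef eq_sym => /negbTE ->.
  rewrite br_brl !E1 !da_eh !on_coroot_alpha cartan_S // cartanC cartan_S //.
  by rewrite !rmorphN1 opprK !scale1r.
rewrite br_suml B_suml -(pick_ord b i) -(pick_ord b (ord_pred i)) -sumrB.
apply: eq_bigr => j _; rewrite brZl BZl E BDl BNl !B_ef ordS_eq; ring.
Qed.

Lemma sum_cyclic_diff (K : zmodType) (H : 'I_M -> K) :
  \sum_i (H (ordS i) - H i) = 0.
Proof. by rewrite sumrB sum_ordS subrr. Qed.

Let sumDr (K : zmodType) (G H : 'I_M -> K) :
  \sum_i G i + \sum_i H i = \sum_i (G i + H i).
Proof. by rewrite big_split. Qed.

(** The cyclic sums met when the gauge equation in degree 2 is paired with
    [p_m2]: the unknown [b] only survives through its sum. *)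
Lemma gauge_cyclic_sums (a b : 'I_M -> F) (c : F) :
  let U i := 2 * a i - a (ordS i) - a (ord_pred i) in
  let u i := - c - U i in
  - (\sum_i b i * (u i + u (ordS i)))
  + 2^-1 * (\sum_i a i * ((- (a (ordS i) * u (ordS i)) + (b (ordS i) - b i))
      - (- (a (ord_pred i) * u (ord_pred i)) + (b (ord_pred i) - b (ord_pred (ord_pred i)))))
     - \sum_i b i * (U i + U (ordS i)))
  + 6^-1 * (\sum_i a i * (- (a (ordS i) * U (ordS i)) - - (a (ord_pred i) * U (ord_pred i))))
  = 2 * c * (\sum_i b i) + 3^-1 * (\sum_i a i * a (ordS i) * (U (ordS i) - U i)).
Proof.
move=> U u; apply/eqP; rewrite -subr_eq0; apply/eqP.
pose H i := 2^-1 * (a (ord_pred i) * b i + a i * b (ord_pred i)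
    - (a (ordS i) * b (ord_pred i) + a i * b (ord_pred (ord_pred i)))
    + c * (a (ord_pred i) * a i))
  + 3^-1 * (a i * a (ord_pred i) * U (ord_pred i)).
rewrite -[RHS](sum_cyclic_diff H) !mulr_sumr -!sumrN !sumDr mulr_sumr !sumDr -!sumrN.
rewrite !sumDr; apply: eq_bigr => i _.
by rewrite /H /u /U !ordSK !ord_predK; field.
Qed.

(** The evaluation of weights on a simple coroot, as a linear form. *)
Definition coroot_at (i : 'I_M) (t : weight F M) : F^o := on_coroot t i.

Fact coroot_at_linear i : linear (coroot_at i).
Proof. by move=> c t t'; rewrite /coroot_at /on_coroot /= !mxE. Qed.

HB.instance Definition _ i :=
  GRing.isLinear.Build F (weight F M) F^o *:%R (coroot_at i) (coroot_at_linear i).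

Lemma on_corootD t t' i : on_coroot (t + t') i = on_coroot t i + on_coroot t' i.
Proof. exact: (raddfD (coroot_at i)). Qed.

Lemma on_coroot_sum_alpha (a : 'I_M -> F) i :
  on_coroot (\sum_j a j *: alpha F j) i = 2 * a i - a (ordS i) - a (ord_pred i).
Proof.
rewrite -[LHS]/(coroot_at i _) raddf_sum -sum_cartan //; apply: eq_bigr => j _.
by rewrite cartanC /= /coroot_at /on_coroot /= !mxE.
Qed.

Section GaugeTransform.
Context (m dm : nat -> L) (m0 : m 0%N = 0) (dm0 : dm 0%N = 0).

Lemma ad_seq_0 X : ad_seq m X 0 = 0.
Proof. by rewrite /ad_seq big_ord_recl big_ord0 m0 br0l addr0. Qed.

Lemma ad_seq_1 X : ad_seq m X 1 = br (m 1%N) (X 0%N).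
Proof. by rewrite /ad_seq !big_ord_recl big_ord0 m0 br0l addr0 add0r. Qed.

Lemma ad_seq_2 X : ad_seq m X 2 = br (m 1%N) (X 1%N) + br (m 2%N) (X 0%N).
Proof. by rewrite /ad_seq !big_ord_recl big_ord0 m0 br0l addr0 add0r. Qed.

Lemma ad_seq_3 X : ad_seq m X 3 =
  br (m 1%N) (X 2%N) + (br (m 2%N) (X 1%N) + br (m 3%N) (X 0%N)).
Proof. by rewrite /ad_seq !big_ord_recl big_ord0 m0 br0l addr0 add0r. Qed.

Lemma gauge_1 (u : weight F M) :
  gauge m dm (miura_form L u) 1 = h u + br (m 1%N) (p_m1 L).
Proof.
rewrite /gauge !big_ord_recl !big_ord0 /= !ad_seq_1 /= dm0 br0r !scaler0 !addr0.
by rewrite subr0 fact0 invr1 !scale1r.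
Qed.

Lemma gauge_3 (u : weight F M) :
  gauge m dm (miura_form L u) 3 =
  br (m 2%N) (h u) + br (m 3%N) (p_m1 L)
  + 2^-1 *: (br (m 1%N) (br (m 1%N) (h u) + br (m 2%N) (p_m1 L))
             + br (m 2%N) (br (m 1%N) (p_m1 L)))
  + 6^-1 *: br (m 1%N) (br (m 1%N) (br (m 1%N) (p_m1 L)))
  - (dm 2%N + 2^-1 *: br (m 1%N) (dm 1%N)).
Proof.
rewrite /gauge !big_ord_recl !big_ord0 /=.
rewrite !(ad_seq_3, ad_seq_2, ad_seq_1, ad_seq_0) /= dm0.
rewrite !(br0r, br0l, scaler0, addr0, add0r) /= !invr1 !scale1r.
by rewrite !addrA.
Qed.

(** The components of degree 0 and 2 of the gauge equation, that is, those of
    index 1 and 3. Pairing the latter with [p_-2] eliminates the unknown [m 3],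
    as [p_-1] and [p_-2] commute, and leaves the coefficient of [p 2]. *)
Lemma gauge_v2 (p : nat -> L) (u : weight F M) (phi : F) (v : nat -> F)
    (a b : 'I_M -> F) :
  m 1%N = \sum_i a i *: e i ->
  m 2%N = \sum_i b i *: br (e i) (e (ordS i)) ->
  B (p 2%N) (p_m2 L) = M%:R ->
  gauge m dm (miura_form L u) 1 = quasi_canonical_form p phi v 1 ->
  gauge m dm (miura_form L u) 3 = quasi_canonical_form p phi v 3 ->
  let U i := 2 * a i - a (ordS i) - a (ord_pred i) in
  (forall i, on_coroot u i = - (phi / M%:R) - U i) /\
  M%:R * v 2%N = 2 / M%:R * phi * (\sum_i b i) - B (dm 2%N) (p_m2 L)
    + 3^-1 * (\sum_i a i * a (ordS i) * (U (ordS i) - U i))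
    - 2^-1 * (\sum_i a i * (B (dm 1%N) (f (ordS i)) - B (dm 1%N) (f (ord_pred i)))).
Proof.
move=> m1E m2E p2 + + U.
rewrite gauge_1 gauge_3 => h1 h3.
have uE i : on_coroot u i = - (phi / M%:R) - U i.
  move: h1; rewrite /quasi_canonical_form m1E br_e_pm1 -raddfD /=.
  move=> /(da_h_coroot i).
  rewrite on_corootD on_coroot_sum_alpha -/(U i) => /eqP; rewrite eq_sym -subr_eq => /eqP <-.
  by rewrite {1}/on_coroot /= !mxE mulr1.
split=> //; move: h3; rewrite /quasi_canonical_form.
rewrite gtnNdvd // => /(congr1 (fun x => B x (p_m2 L))).
rewrite BZl p2 mulrC => <-.
rewrite !(BDl, BNl, BZl).
rewrite (B_inv (m 3%N)) br_pm1_pm2 // B0r addr0.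
rewrite m2E B_ee_h m1E br_e_pm1 B_ee_h !B_br_e_pm2.
under [X in _ + 2^-1 * (X + _)]eq_bigr => i _.
  rewrite !BDl !B_e_h_f !B_ee_pm1_f ordSK; over.
under [X in _ + 6^-1 * X]eq_bigr => i _.
  rewrite !B_e_h_f; over.
have UE j : on_coroot (\sum_i a i *: alpha F i) j = U j by apply: on_coroot_sum_alpha.
transitivity (2 * (phi / M%:R) * (\sum_i b i)
    + 3^-1 * (\sum_i a i * a (ordS i) * (U (ordS i) - U i))
    - (B (dm 2%N) (p_m2 L) + 2^-1 * (\sum_i a i * (B (dm 1%N) (f (ordS i))
        - B (dm 1%N) (f (ord_pred i)))))); last by ring.
rewrite -gauge_cyclic_sums; congr (- _ + 2^-1 * (_ - _) + 6^-1 * _ - _).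
- by apply: eq_bigr => i _; rewrite !uE.
- by apply: eq_bigr => i _; rewrite !uE.
- by apply: eq_bigr => i _; rewrite !UE.
- by apply: eq_bigr => i _; rewrite !UE.
Qed.
End GaugeTransform.

End InvariantForm.

(** * The coefficient of p_2 in a quasi-canonical form *)

Section OrderedSums.
Context (M : nat).

(** Sums over increasing pairs and triples of indices. *)
Definition osum2 (W : nmodType) (G : 'I_M -> 'I_M -> W) : W :=
  \sum_(q < M) \sum_(p < M | (p < q)%N) G p q.

Definition osum3 (W : nmodType) (G : 'I_M -> 'I_M -> 'I_M -> W) : W :=
  \sum_(c < M) \sum_(b < M | (b < c)%N) \sum_(a < M | (a < b)%N) G a b c.

Lemma eq_osum2 (W : nmodType) (G H : 'I_M -> 'I_M -> W) :
  (forall p q : 'I_M, (p < q)%N -> G p q = H p q) -> osum2 G = osum2 H.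
Proof. by move=> GH; apply: eq_bigr => q _; apply: eq_bigr => p /GH. Qed.

Lemma eq_osum3 (W : nmodType) (G H : 'I_M -> 'I_M -> 'I_M -> W) :
  (forall a b c : 'I_M, (a < b < c)%N -> G a b c = H a b c) -> osum3 G = osum3 H.
Proof.
move=> GH; apply: eq_bigr => c _; apply: eq_bigr => b bc; apply: eq_bigr => a ab.
by apply: GH; rewrite ab.
Qed.

Lemma osum2D (W : nmodType) (G H : 'I_M -> 'I_M -> W) :
  osum2 (fun p q => G p q + H p q) = osum2 G + osum2 H.
Proof. by rewrite -big_split; apply: eq_bigr => q _; rewrite big_split. Qed.

Lemma osum3D (W : nmodType) (G H : 'I_M -> 'I_M -> 'I_M -> W) :
  osum3 (fun a b c => G a b c + H a b c) = osum3 G + osum3 H.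
Proof.
rewrite -big_split; apply: eq_bigr => c _; rewrite -big_split.
by apply: eq_bigr => b _; rewrite big_split.
Qed.

Lemma sum_telescope_ord (W : zmodType) (a : 'I_M -> W) (q : 'I_M) (M0 : (0 < M)%N) :
  \sum_(p < M | (p < q)%N) (a (ordS p) - a p) = a q - a (Ordinal M0).
Proof.
case: q => k kM /=; elim: k kM => [|k IH] kM.
  by rewrite big_pred0 // (bool_irrelevance kM M0) subrr.
have kM' : (k < M)%N by apply: ltnW.
rewrite (bigD1 (Ordinal kM')) //=.
under eq_bigl => p.
  have -> : (p < k.+1)%N && (p != Ordinal kM') = (p < k)%N.
    by rewrite ltnS -val_eqE /= andbC -ltn_neqAle.
over.
rewrite (IH kM') addrA subrK; congr (_ - _).
by congr (a _); apply: val_inj => /=; rewrite modn_small.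
Qed.

(** A cyclic sum of products of neighbours is an ordered double sum of products of
    differences. *)
Lemma osum2_cyclic (K : comPzRingType) (M0 : (0 < M)%N) (a a' : 'I_M -> K) :
  osum2 (fun p q => (a (ordS p) - a p) * (a' (ordS q) - a' q)
                    - (a (ordS q) - a q) * (a' (ordS p) - a' p))
  = \sum_i a i * (a' (ordS i) - a' (ord_pred i)).
Proof.
pose o := Ordinal M0.
have -> : osum2 (fun p q => (a (ordS p) - a p) * (a' (ordS q) - a' q)
                    - (a (ordS q) - a q) * (a' (ordS p) - a' p))
  = \sum_q ((a q - a o) * (a' (ordS q) - a' q) - (a (ordS q) - a q) * (a' q - a' o)).
  apply: eq_bigr => q _; rewrite sumrB -mulr_suml -mulr_sumr.
  by rewrite !(sum_telescope_ord _ q M0).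
apply/eqP; rewrite -subr_eq0 -sumrB; apply/eqP.
pose H i := - a o * a' i + a i * a' o - a i * a' (ord_pred i).
rewrite -[RHS](sum_cyclic_diff H); apply: eq_bigr => i _; rewrite /H ordSK; ring.
Qed.

End OrderedSums.

Section MiuraCoefficient.
Context (F : numFieldType) (M : nat) (M_ge3 : (3 <= M)%N) (L : dual_affine F M).
Context (B : L -> L -> F) (B_form : invariant_form B).

(** The coefficient of [p 2] in a quasi-canonical form, in terms of the
    successive differences [x i] of the coordinates of [u] on the simple roots. *)
Lemma is_v2_expansion (p : nat -> L) (u : F -> weight F M) (phi : F -> F)
    (v2 : ratfun F^o) :
  principal_elements B p -> is_v2 p u phi v2 ->
  exists x x' : 'I_M -> F -> F^o, exists b b' : F -> F^o,
  [/\ forall i, has_rat (x i) (x' i), has_rat b b'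
    & generically (fun z =>
        [/\ forall i, x (ord_pred i) z - x i z
                      = - on_coroot (u z) i - phi z / M%:R,
            \sum_i x i z = 0
          & - (2 * M%:R * rf_eval v2 z) =
            2 * (b' z - 2 / M%:R * phi z * b z) + 2 / 3 * (\sum_i x i z ^+ 3)
            + osum2 (fun i j => x i z * x' j z - x j z * x' i z)])].
Proof.
move=> [_ _ _ p2] [m [v [m0 hm hg v2E]]].
have M0 : (0 < M)%N by apply: leq_trans M_ge3.
pose a i z : F^o := B (rf_eval (m 1%N) z) (da_f L i).
pose a' i z : F^o := B (rf_deriv (m 1%N) z) (da_f L i).
have rat_form k y : has_rat (fun z => B (rf_eval (m k) z) y : F^o)
    (fun z => B (rf_deriv (m k) z) y : F^o).
  exists (rf_map (form_at y B_form) (m k)); apply: generically_true => z.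
  by rewrite rf_eval_map rf_deriv_map.
have rat_a i : has_rat (a i) (a' i) by apply: rat_form.
exists (fun i z => a (ordS i) z - a i z), (fun i z => a' (ordS i) z - a' i z).
pose b z : F^o := B (rf_eval (m 2%N) z) (p_m2 L).
pose b' z : F^o := B (rf_deriv (m 2%N) z) (p_m2 L).
exists b, b'; split; [|exact: rat_form|].
  move=> i; have := has_rat_add (rat_a (ordS i)) (has_rat_scaler (-1) (rat_a i)).
  by move=> /has_rat_ext; apply; apply: generically_true => z; rewrite !scaleN1r.
have dm0 : generically (fun z => rf_deriv (m 0%N) z = 0).
  apply: (has_rat0 (f := rf_eval (m 0%N))) => //.
  by exists (m 0%N); apply: generically_true.
apply: generically_mono (generically_and (generically_and m0 dm0)
  (generically_and (generically_and (hm 1%N isT) (hm 2%N isT))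
    (generically_and (hg 1%N) (hg 3%N)))).
move=> z [[m0z dm0z] [[/(nplus_deg1 M_ge3)[a1 m1E] /(nplus_deg2 M_ge3)[b2 m2E]]]].
move=> [h1 h3].
(* The coordinates of the gauge parameters are read off with the invariant form, hence rational. *)
have aE i : a i z = a1 i by rewrite /a m1E (B_sum_e B_form).
have bE : b z = \sum_i b2 i by rewrite /b m2E (B_ee M_ge3 B_form).
have [uE v2z] := gauge_v2 M_ge3 B_form (m := fun i => rf_eval (m i) z)
  (dm := fun i => rf_deriv (m i) z) m0z dm0z m1E m2E p2 h1 h3.
split.
- by move=> i; rewrite uE ord_predK !aE; ring.
- by rewrite sum_cyclic_diff.
rewrite (osum2_cyclic M0 (fun i => a i z) (fun i => a' i z)) -v2E.
rewrite -mulrA v2z -/(b' z) -bE.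
have -> : \sum_i a i z * (a' (ordS i) z - a' (ord_pred i) z) = \sum_i a1 i *
   (B (rf_deriv (m 1%N) z) (da_f L (ordS i)) - B (rf_deriv (m 1%N) z) (da_f L (ord_pred i))).
  by apply: eq_bigr => i _; rewrite aE.
set S := \sum_i a1 i * (_ - _).
have -> : \sum_i (a (ordS i) z - a i z) ^+ 3 =
  - \sum_i a1 i * a1 (ordS i) * ((2 * a1 (ordS i) - a1 (ordS (ordS i)) - a1 (ord_pred (ordS i)))
     - (2 * a1 i - a1 (ordS i) - a1 (ord_pred i))).
  apply/eqP; rewrite -addr_eq0 -big_split /=; apply/eqP.
  pose H i := a1 i ^+ 3 - a1 (ord_pred i) * a1 i * a1 (ordS i).
  rewrite -[RHS](sum_cyclic_diff H); apply: eq_bigr => i _.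
  by rewrite /H !aE !ordSK; ring.
have Mn0 : (M%:R : F) != 0 by rewrite pnatr_eq0 -lt0n.
by field; exact: Mn0.
Qed.
End MiuraCoefficient.

(** * Currents on a tensor product of Verma modules *)

Section TracelessPart.
Context (F : numFieldType) (M : nat).
Implicit Types X Y : 'M[F]_M.

(** The projection of gl_M onto sl_M along the scalar matrices. *)
Definition slpart X : 'M[F]_M := X - (\tr X / M%:R)%:M.

Context (M_gt0 : (0 < M)%N).
Let Mn0 : (M%:R : F) != 0. Proof. by rewrite pnatr_eq0 -lt0n. Qed.

Lemma tr_slpart X : \tr (slpart X) = 0.
Proof.
by rewrite linearB /= mxtrace_scalar -(mulr_natr (_ / _)) divfK // subrr.
Qed.

Lemma slpart_id X : \tr X = 0 -> slpart X = X.
Proof. by rewrite /slpart => ->; rewrite mul0r raddf0 subr0. Qed.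

Lemma slpart_comb c X Y : slpart (c *: X + Y) = c *: slpart X + slpart Y.
Proof.
rewrite /slpart linearP /= mulrDl raddfD /= scalerBr scale_scalar_mx mulrA.
by rewrite opprD addrACA.
Qed.

Lemma slpart_br X Y :
  slpart X *m slpart Y - slpart Y *m slpart X = X *m Y - Y *m X.
Proof.
rewrite /slpart !mulmxBl !mulmxBr !mul_scalar_mx !mul_mx_scalar.
rewrite !scale_scalar_mx (mulrC (\tr Y / _)).
set a := \tr X / _; set b := \tr Y / _.
lmod_ring.
Qed.

Lemma tr_slpart_mul X Y :
  \tr (slpart X *m slpart Y) = \tr (X *m Y) - \tr X * \tr Y / M%:R.
Proof.
rewrite /slpart mulmxBl !mulmxBr !mul_scalar_mx !mul_mx_scalar.
have trB (A B : 'M[F]_M) : \tr (A - B) = \tr A - \tr B by rewrite raddfB.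
rewrite !trB !mxtraceZ mxtrace_scalar -(mulr_natr (_ / _)).
by field.
Qed.

End TracelessPart.

Section TensorProducts.
Context (F : numFieldType) (M N : nat) (M_gt0 : (0 < M)%N).
Context (lam : 'I_N -> weight F M) (V : forall j, verma (lam j)).
Context (T : tensor_product V).
Implicit Types (i j : 'I_N) (a b : 'M[F]_M) (m n : int).
Local Notation pure := (tp_pure T).

Section SlAction.
Context (W : gmodule F M).

(** The action of [X (x) t^m], for [X] the traceless part of a matrix. *)
Definition sl_op m (x : W) (X : 'M[F]_M) : W := gm_op W (slpart X) m x.

Fact sl_op_linear m x : linear (sl_op m x).
Proof. by move=> c X Y; rewrite /sl_op slpart_comb gm_op_linear ?tr_slpart. Qed.

HB.instance Definition _ m x :=
  GRing.isLinear.Build F 'M[F]_M W *:%R (sl_op m x) (sl_op_linear m x).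

Lemma sl_opE a m (x : W) : \tr a = 0 -> gm_op W a m x = sl_op m x a.
Proof. by move=> a0; rewrite /sl_op slpart_id. Qed.

End SlAction.

Lemma tr_delta_mx (p q : 'I_M) : \tr (delta_mx p q : 'M[F]_M) = (p == q)%:R.
Proof.
rewrite /mxtrace (bigD1 p) //= mxE eqxx big1 ?addr0 // => i /negbTE ip.
by rewrite mxE ip.
Qed.

Lemma tr_delta_sub (p q : 'I_M) : \tr (delta_mx p p - delta_mx q q : 'M[F]_M) = 0.
Proof. by rewrite raddfB /= !tr_delta_mx !eqxx subrr. Qed.

Lemma sum_is0 : \sum_(j < M) (is0 j)%:R = 1 :> F.
Proof.
rewrite (bigD1 (Ordinal M_gt0)) //= big1 ?addr0 // => j.
by rewrite /is0 -val_eqE /= => /negbTE ->.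
Qed.

(** By uniqueness of morphisms out of a Verma module it suffices to look at the
    highest weight vector, where the central element is the sum of the coroots. *)
Lemma verma_level (l : weight F M) (W : verma l) (y : W) : gm_k W y = level l *: y.
Proof.
have kP : gmodule_hom (gm_k W).
  split=> [a m x tr0||x] //; first exact: gm_k_op.
  by rewrite gm_d_k.
have sP : gmodule_hom (V := W) (W := W) (level l \*: idfun).
  by split=> *; rewrite /= ?linearZ_LR.
suff hk : gm_k W (vm_hw W) = (level l \*: idfun) (vm_hw W).
  exact: (vm_uniq kP sP hk y).
have [_ _ hco _] := vm_hwP W.
rewrite /= /level scaler_suml.
have E (j : 'I_M) : on_coroot l j *: vm_hw W =
    sl_op 0 (vm_hw W) (delta_mx (ord_pred j) (ord_pred j) - delta_mx j j)
    + (is0 j)%:R *: gm_k W (vm_hw W).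
  by rewrite -hco /coroot_op sl_opE ?tr_delta_sub.
under [RHS]eq_bigr => j _ do rewrite E.
rewrite big_split /= -scaler_suml sum_is0 scale1r -raddf_sum sumrB.
have -> : \sum_j delta_mx (ord_pred j) (ord_pred j) = \sum_j delta_mx j j :> 'M[F]_M.
    pose G (j : 'I_M) : 'M[F]_M := delta_mx j j.
  exact: (sum_ord_pred G).
by rewrite subrr raddf0 add0r.
Qed.

Lemma tp_pureD (x : forall j, V j) i (y y' : V i) :
  pure (eqtype.dfwith x (y + y')) = pure (eqtype.dfwith x y) + pure (eqtype.dfwith x y').
Proof. by have := tp_pureP T x 1 y y'; rewrite !scale1r. Qed.

Lemma tp_pure0 (x : forall j, V j) i : pure (eqtype.dfwith x (0 : V i)) = 0.
Proof.
have /eqP := tp_pureD x (0 : V i) 0.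
by rewrite addr0 -subr_eq0 opprD addrA subrr add0r oppr_eq0 => /eqP.
Qed.

Lemma tp_pureZ (x : forall j, V j) i c (y : V i) :
  pure (eqtype.dfwith x (c *: y)) = c *: pure (eqtype.dfwith x y).
Proof. by have := tp_pureP T x c y 0; rewrite addr0 tp_pure0 addr0. Qed.

Lemma dfwith_id (x : forall j, V j) i : eqtype.dfwith x (x i) = x.
Proof.
apply: functional_extensionality_dep => j.
by case: eqtype.dfwithP.
Qed.

Lemma dfwith_twice (x : forall j, V j) i (y y' : V i) :
  eqtype.dfwith (eqtype.dfwith x y) y' = eqtype.dfwith x y'.
Proof.
apply: functional_extensionality_dep => j.
have [<-|ij] := eqVneq i j; first by rewrite !eqtype.dfwith_in.
by rewrite !eqtype.dfwith_out.
Qed.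

Lemma dfwith_swap (x : forall j, V j) i j (y : V i) (y' : V j) : i != j ->
  eqtype.dfwith (eqtype.dfwith x y) y' = eqtype.dfwith (eqtype.dfwith x y') y.
Proof.
move=> ij; apply: functional_extensionality_dep => k.
have [<-|ik] := eqVneq i k.
  by rewrite eqtype.dfwith_in eqtype.dfwith_out 1?eq_sym // eqtype.dfwith_in.
rewrite [RHS]eqtype.dfwith_out //.
have [<-|jk] := eqVneq j k; first by rewrite !eqtype.dfwith_in.
by rewrite !eqtype.dfwith_out.
Qed.

Lemma tp_op_linear i c a b m (x : T) : \tr a = 0 -> \tr b = 0 ->
  tp_op T i (c *: a + b) m x = c *: tp_op T i a m x + tp_op T i b m x.
Proof.
move=> a0 b0; pose g := (c \*: tp_op T i a m \+ tp_op T i b m).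
apply: (tp_uniq (t := T) (f := tp_op T i (c *: a + b) m) (g := g)) => y /=.
rewrite !tp_opP // ?linearP /= ?a0 ?b0 ?mulr0 ?addr0 //.
by rewrite gm_op_linear // tp_pureD tp_pureZ.
Qed.

Let tr_br a b : \tr (a *m b - b *m a) = 0.
Proof. by rewrite raddfB /= mxtrace_mulC subrr. Qed.

Lemma tp_op_commute i j a b m n (x : T) : i != j -> \tr a = 0 -> \tr b = 0 ->
  tp_op T i a m (tp_op T j b n x) = tp_op T j b n (tp_op T i a m x).
Proof.
move=> ij a0 b0.
apply: (tp_uniq (t := T) (f := tp_op T i a m \o tp_op T j b n)
  (g := tp_op T j b n \o tp_op T i a m)) => y /=.
rewrite !tp_opP // dfwith_swap // 1?eq_sym //.
by rewrite !eqtype.dfwith_out // eq_sym.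
Qed.

Lemma tp_op_comm i a b m n (x : T) : \tr a = 0 -> \tr b = 0 ->
  tp_op T i a m (tp_op T i b n x) = tp_op T i b n (tp_op T i a m x)
    + (tp_op T i (a *m b - b *m a) (m + n) x
    - (n%:~R * (m + n == 0)%:R * \tr (a *m b) * level (lam i)) *: x).
Proof.
move=> a0 b0.
pose g := (tp_op T i b n \o tp_op T i a m) \+ (tp_op T i (a *m b - b *m a) (m + n)
   \- (n%:~R * (m + n == 0)%:R * \tr (a *m b) * level (lam i)) \*: idfun).
apply: (tp_uniq (t := T) (f := tp_op T i a m \o tp_op T i b n) (g := g)) => y /=.
rewrite !tp_opP ?tr_br // !dfwith_twice !eqtype.dfwith_in.
have /eqP := gm_op_comm m n (y i) a0 b0; rewrite subr_eq addrC => /eqP ->.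
rewrite verma_level scalerA -scaleNr !tp_pureD tp_pureZ dfwith_id.
by rewrite scaleNr.
Qed.

(** The operator [\sum_i c i X^(i) (x) t^m], where [X^(i)] is the traceless part
    of [X] acting in the i-th factor. Taking the powers of [1 / (z - z_i)] as
    coefficients gives the current attached to [X] and its derivatives. *)
Definition cur (c : 'I_N -> F) (X : 'M[F]_M) m (x : T) : T :=
  \sum_i c i *: tp_op T i (slpart X) m x.

Fact cur_is_linear c X m : linear (cur c X m).
Proof.
move=> k x y; rewrite /cur scaler_sumr -big_split; apply: eq_bigr => i _.
by rewrite linearP scalerDr !scalerA mulrC.
Qed.

HB.instance Definition _ c X m :=
  GRing.isLinear.Build F T T *:%R (cur c X m) (cur_is_linear c X m).

(** The current as a linear function of the matrix. *)
Definition cur_mx c m x (X : 'M[F]_M) := cur c X m x.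

Fact cur_mx_linear c m x : linear (cur_mx c m x).
Proof.
move=> k X Y; rewrite /cur_mx /cur scaler_sumr -big_split; apply: eq_bigr => i _.
rewrite slpart_comb tp_op_linear ?tr_slpart //.
by rewrite scalerDr !scalerA mulrC.
Qed.

HB.instance Definition _ c m x :=
  GRing.isLinear.Build F 'M[F]_M T *:%R (cur_mx c m x) (cur_mx_linear c m x).

Lemma curNmx c X m x : cur c (- X) m x = - cur c X m x.
Proof. exact: (raddfN (cur_mx c m x)). Qed.

Lemma curBmx c X Y m x : cur c (X - Y) m x = cur c X m x - cur c Y m x.
Proof. exact: (raddfB (cur_mx c m x)). Qed.

Lemma curZmx k c X m x : cur c (k *: X) m x = k *: cur c X m x.
Proof. exact: (linearZ_LR (cur_mx c m x)). Qed.

Lemma cur_comb k l c d X m x :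
  cur (fun i => k * c i + l * d i) X m x = k *: cur c X m x + l *: cur d X m x.
Proof.
rewrite /cur !scaler_sumr -big_split; apply: eq_bigr => i _.
by rewrite scalerDl !scalerA.
Qed.

Lemma eq_cur c d X m x : c =1 d -> cur c X m x = cur d X m x.
Proof. by move=> cd; apply: eq_bigr => i _; rewrite cd. Qed.

(** Products of the coefficients in the bracket come from the fact that distinct
    tensor factors commute. *)
Lemma cur_comm c d X Y m n x :
  cur c X m (cur d Y n x) = cur d Y n (cur c X m x)
  + (cur (fun i => c i * d i) (X *m Y - Y *m X) (m + n) x
     - (n%:~R * (m + n == 0)%:R * (\tr (X *m Y) - \tr X * \tr Y / M%:R)
        * \sum_i c i * d i * level (lam i)) *: x).
Proof.
rewrite {1}/cur; under eq_bigr => i _ do rewrite linear_sum scaler_sumr.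
rewrite [in X in _ = X + _]/cur.
under [in X in _ = X + _]eq_bigr => j _ do rewrite linear_sum scaler_sumr.
rewrite [X in _ = X + _]exchange_big /= [in X in _ = _ + X]/cur.
rewrite mulr_sumr scaler_suml -sumrB -big_split; apply: eq_bigr => i _ /=.
rewrite (bigD1 i) //= [X in _ = X + _](bigD1 i) //= addrAC; congr (_ + _); last first.
  apply: eq_bigr => j ji; rewrite (linearZ_LR (tp_op T i _ _)).
  rewrite (linearZ_LR (tp_op T j _ _)) tp_op_commute ?tr_slpart 1?eq_sym //.
  by rewrite !scalerA mulrC.
rewrite !(linearZ_LR (tp_op T i _ _)) tp_op_comm ?tr_slpart // slpart_br tr_slpart_mul //.
rewrite (slpart_id (tr_br X Y)) !scalerDr !scalerA (mulrC (d i)).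
by rewrite scalerN scalerA; congr (_ + (_ - _ *: _)); ring.
Qed.

End TensorProducts.

(** * Eigenvalues on the vacuum *)

Lemma cyclic_const (M : nat) (W : Type) (G : 'I_M -> W) :
  (forall q, G (ord_pred q) = G q) -> forall p q, G p = G q.
Proof.
move=> hG; suff h0 (M0 : (0 < M)%N) p : G p = G (Ordinal M0).
  by move=> p q; rewrite !(h0 (leq_ltn_trans (leq0n _) (ltn_ord p))).
case: p => k kM; elim: k kM => [|k IH] kM; first by rewrite (bool_irrelevance kM M0).
rewrite -(IH (ltnW kM)) -hG; congr (G _); apply: val_inj => /=.
by rewrite modnDr modn_small // ltnW.
Qed.

Section VacuumEigenvalues.
Context (F : numFieldType) (M : nat) (M_gt0 : (0 < M)%N).
Implicit Types (l : weight F M) (p q : 'I_M).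
Let Mn0 : (M%:R : F) != 0. Proof. by rewrite pnatr_eq0 -lt0n. Qed.

(** The weight of [gl_M] with the same values on the coroots [1], ..., [M - 1] as [l]
    and with value [0] on [E_00]. *)
Definition gl_partial l p : F := - \sum_(k < M | (0 < k <= p)%N) on_coroot l k.

(** The value of the weight [l] on the traceless part of the diagonal unit [E_pp]. *)
Definition gl_weight l p : F := gl_partial l p - (\sum_q gl_partial l q) / M%:R.

Lemma sum_gl_weight l : \sum_p gl_weight l p = 0.
Proof.
rewrite sumrB sumr_const card_ord -(mulr_natr (_ / _)) divfK // subrr //.
Qed.

Lemma gl_partial_pred l p :
  gl_partial l (ord_pred p) - gl_partial l p = on_coroot l p - (is0 p)%:R * level l.
Proof.
rewrite /gl_partial opprK /is0; have [p0|p0] := eqVneq (val p) 0%N.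
  rewrite [X in _ + X]big_pred0 => [|k]; last by rewrite p0; case: (nat_of_ord k).
  rewrite addr0 mul1r /level [X in _ = _ - X](bigD1 p) //= opprD addrA subrr add0r; congr (- _).
  apply: eq_bigl => k; rewrite -val_eqE p0 /= p0 add0n -lt0n.
  by rewrite modn_small ?ltn_predL //; have := ltn_ord k; lia.
rewrite mul0r subr0 [X in _ + X](bigD1 p) /=; last by rewrite leqnn lt0n p0.
rewrite addrCA -[RHS]addr0; congr (_ + _).
apply/eqP; rewrite addrC subr_eq0; apply/eqP/eq_bigl => k.
have pE : ((p + M).-1 %% M)%N = p.-1.
  rewrite -subn1 addnC -addnBA ?lt0n // modnDl subn1 modn_small //.
  exact: leq_ltn_trans (leq_pred _) (ltn_ord p).
by rewrite -val_eqE /= pE; move: p0 => /= ; lia.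
Qed.

(** The coroot [0] is the only one involving the level. *)
Lemma gl_weight_pred l p :
  gl_weight l (ord_pred p) - gl_weight l p = on_coroot l p - (is0 p)%:R * level l.
Proof. by rewrite -gl_partial_pred /gl_weight; ring. Qed.

End VacuumEigenvalues.

Section Vacuum.
Context (F : numFieldType) (M N : nat) (M_gt0 : (0 < M)%N).
Context (lam : 'I_N -> weight F M) (V : forall j, verma (lam j)).
Context (T : tensor_product V).
Implicit Types (c d : 'I_N -> F) (m n : int) (p q : 'I_M) (X Y : 'M[F]_M).
Local Notation vac := (vac T).
Let Mn0 : (M%:R : F) != 0. Proof. by rewrite pnatr_eq0 -lt0n. Qed.

(** The differences between the diagonal units are prescribed by the coroots, and
    the traceless parts of the units sum to 0. *)
Lemma sl_op_diag (l : weight F M) (W : verma l) p :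
  sl_op 0 (vm_hw W) (delta_mx p p) = gl_weight l p *: vm_hw W.
Proof.
have [_ _ hco _] := vm_hwP W; set v := vm_hw W.
have step q : sl_op 0 v (delta_mx (ord_pred q) (ord_pred q)) - sl_op 0 v (delta_mx q q)
    = (gl_weight l (ord_pred q) - gl_weight l q) *: v.
  rewrite -raddfB /= gl_weight_pred // scalerBl -hco /coroot_op sl_opE ?tr_delta_sub //.
  by rewrite verma_level // scalerA addrK.
pose D q := sl_op 0 v (delta_mx q q) - gl_weight l q *: v.
have Dpred q : D (ord_pred q) = D q.
  apply/eqP; rewrite -subr_eq0 /D.
  have E (A A' : W) (x y : F) : A - x *: v - (A' - y *: v) = (A - A') - (x - y) *: v.
    by lmod_ring.
  by rewrite E step subrr.
have sumD : \sum_q D q = 0.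
  rewrite sumrB -scaler_suml sum_gl_weight // scale0r subr0.
  have -> : \sum_q sl_op 0 v (delta_mx q q) = sl_op 0 v (\sum_q delta_mx q q).
    by rewrite raddf_sum.
  rewrite -mx1_sum_delta -[RHS](raddf0 (sl_op 0 v)) /= /sl_op; congr (gm_op _ _ _ _).
  by rewrite /slpart mxtrace1 mxtrace0 divff // mul0r raddf0 !subrr.
have := sumD; rewrite (eq_bigr (fun=> D p)) => [|q _]; last exact: cyclic_const.
rewrite sumr_const card_ord -scaler_nat => /eqP; rewrite scaler_eq0 (negbTE Mn0) /=.
by rewrite subr_eq0 => /eqP.
Qed.

Lemma tp_op_vac i X m k : \tr X = 0 ->
  gm_op (V i) X m (vm_hw (V i)) = k *: vm_hw (V i) ->
  tp_op T i X m vac = k *: vac.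
Proof.
move=> X0 hX; rewrite /vac tp_opP // hX.
by rewrite tp_pureZ (dfwith_id (fun i => vm_hw (V i))).
Qed.

(** The eigenvalue on the vacuum of the zero mode attached to [E_pp]. *)
Definition cur_weight c p : F := \sum_i c i * gl_weight (lam i) p.

Lemma cur_vac_diag c p : cur c (delta_mx p p) 0 vac = cur_weight c p *: vac.
Proof.
rewrite /cur /cur_weight scaler_suml; apply: eq_bigr => i _.
rewrite (tp_op_vac (k := gl_weight (lam i) p)) ?tr_slpart ?scalerA //.
exact: sl_op_diag.
Qed.

Lemma cur_vac_raise c p q : (p < q)%N -> cur c (delta_mx p q) 0 vac = 0.
Proof.
move=> pq; rewrite /cur big1 // => i _.
have E0 : \tr (delta_mx p q : 'M[F]_M) = 0.
  by rewrite tr_delta_mx -val_eqE /= (ltn_eqF pq).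
rewrite slpart_id // (tp_op_vac (k := 0)) ?scale0r ?scaler0 //.
by have [-> //] := vm_hwP (V i).
Qed.

Lemma cur_vac_pos c X m : 0 < m -> cur c X m vac = 0.
Proof.
move=> m0; rewrite /cur big1 // => i _.
rewrite (tp_op_vac (k := 0)) ?tr_slpart ?scale0r ?scaler0 //.
by have [_ -> //] := vm_hwP (V i); rewrite tr_slpart.
Qed.

End Vacuum.

(** * The cubic operator in terms of matrix units *)

Section Depth.
Context (F : numFieldType) (M N : nat) (M_gt0 : (0 < M)%N).
Context (lam : 'I_N -> weight F M) (V : forall j, verma (lam j)).
Context (T : tensor_product V).
Implicit Types (c d : 'I_N -> F) (m n : int) (p : 'I_M) (X Y : 'M[F]_M) (x y : T).

(** Vectors killed by all positive modes, resp. by all modes of degree at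
    least 2 and sent by the modes of degree 1 into the former. *)
Definition depth0 x := forall c X m, 0 < m -> cur c X m x = 0.
Definition depth1 x := (forall c X m, 1 < m -> cur c X m x = 0) /\
  forall c X, depth0 (cur c X 1 x).

Lemma depth0_comb k x y : depth0 x -> depth0 y -> depth0 (k *: x + y).
Proof. by move=> hx hy c X m m0; rewrite linearP /= hx ?hy // scaler0 addr0. Qed.

Lemma depth0_cur d Y x : depth0 x -> depth0 (cur d Y 0 x).
Proof.
move=> hx c X m m0; rewrite cur_comm // (hx c X m) // raddf0 addr0 !mul0r scale0r subr0.
by rewrite add0r hx.
Qed.

Lemma depth1_depth0 x : depth0 x -> depth1 x.
Proof.
move=> hx; split=> [c X m m1|c X]; first by apply: hx; apply: lt_trans m1.
by rewrite hx // => c' X' m' _; rewrite raddf0.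
Qed.

Lemma depth1_cur d Y x : depth1 x -> depth1 (cur d Y 0 x).
Proof.
move=> [hx hx1]; split=> [c X m m1|c X].
  by rewrite cur_comm // (hx c X m) // raddf0 addr0 !mul0r scale0r subr0 add0r hx.
rewrite cur_comm // addr0 !mul0r scale0r subr0 -[X in depth0 (X + _)]scale1r.
by apply: depth0_comb => //; apply: depth0_cur.
Qed.

Lemma depth1_lower d Y x : depth0 x -> depth1 (cur d Y (-1) x).
Proof.
move=> hx; split=> [c X m m1|c X].
  have m0 : 0 < m by apply: lt_trans m1.
  rewrite cur_comm // (hx c X m) // raddf0 add0r hx ?subr_gt0 // add0r.
  by rewrite subr_eq0 (gt_eqF m1) mulr0 !mul0r scale0r oppr0.
rewrite cur_comm // subrr (hx c X 1) // raddf0 add0r -scaleNr addrC.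
by apply: depth0_comb => //; apply: depth0_cur.
Qed.

Lemma depth0_vac : depth0 (vac T).
Proof. by move=> c X m; apply: cur_vac_pos. Qed.

End Depth.

Section CubicOperator.
Context (F : numFieldType) (M N : nat) (M_gt0 : (0 < M)%N).
Context (lam : 'I_N -> weight F M) (V : forall j, verma (lam j)).
Context (T : tensor_product V) (zs : 'I_N -> F).
Context (A : finType) (I : A -> 'M[F]_M) (I_basis : orthonormal_basis I).
Implicit Types (m n : int) (X Y Z : 'M[F]_M) (x y : T).

(** The coefficients of the current at [z]. *)
Definition zeta (z : F) (i : 'I_N) : F := (z - zs i)^-1.

Lemma current_cur X m z x : \tr X = 0 -> current zs X m z x = cur (zeta z) X m x.
Proof. by move=> X0; rewrite /cur slpart_id. Qed.

(** The expansion of the traceless part of [Y] in the orthonormal basis. *)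
Lemma orthonormal_expand (W : lmodType F) (phi : {linear 'M[F]_M -> W}) Y :
  (forall X, phi (slpart X) = phi X) -> \sum_a \tr (I a *m Y) *: phi (I a) = phi Y.
Proof.
case: I_basis => I0 Iab Ispan hphi; have [c cE] := Ispan _ (tr_slpart M_gt0 Y).
rewrite -[RHS]hphi cE linear_sum; apply: eq_bigr => a _; rewrite linearZ_LR.
congr (_ *: _); have : \tr (I a *m slpart Y) = c a.
  rewrite cE mulmx_sumr raddf_sum (bigD1 a) //= -scalemxAr mxtraceZ Iab eqxx mulr1.
  rewrite big1 ?addr0 // => b ba; rewrite -scalemxAr mxtraceZ Iab eq_sym.
  by rewrite (negbTE ba) mulr0.
by move=> <-; rewrite /slpart mulmxBr mul_mx_scalar raddfB /= mxtraceZ I0 mulr0 subr0.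
Qed.

Lemma mxtrace_mul3 X Y Z :
  \tr (X *m Y *m Z) = \sum_i \sum_j \sum_k X i j * Y j k * Z k i.
Proof.
apply: eq_bigr => i _; rewrite mxE exchange_big; apply: eq_bigr => k _ /=.
by rewrite mxE mulr_suml.
Qed.

Lemma mxtrace_mul_delta X i j : \tr (X *m delta_mx j i) = X i j.
Proof.
rewrite mxtrace_mulC /mxtrace (bigD1 j) //= big1 ?addr0 => [|k /negbTE kj].
  rewrite mxE (bigD1 i) //= mxE !eqxx mul1r big1 ?addr0 // => k /negbTE ki.
  by rewrite mxE ki andbF mul0r.
by rewrite mxE big1 // => l _; rewrite mxE kj mul0r.
Qed.

Lemma exchange_sum3 (W : nmodType) (J : finType) (G : A -> A -> A -> J -> W) :
  \sum_a \sum_b \sum_c \sum_j G a b c j = \sum_j \sum_a \sum_b \sum_c G a b c j.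
Proof.
rewrite [RHS]exchange_big; apply: eq_bigr => a _.
rewrite [RHS]exchange_big; apply: eq_bigr => b _; exact: exchange_big.
Qed.

(** Contraction with an orthonormal basis of sl_M, in terms of matrix units. *)
Lemma contract_basis (W : lmodType F) (Phi : 'M[F]_M -> 'M[F]_M -> 'M[F]_M -> W) :
  (forall Y Z, linear (fun X => Phi X Y Z)) ->
  (forall X Z, linear (fun Y => Phi X Y Z)) ->
  (forall X Y, linear (fun Z => Phi X Y Z)) ->
  (forall X Y Z, Phi (slpart X) Y Z = Phi X Y Z) ->
  (forall X Y Z, Phi X (slpart Y) Z = Phi X Y Z) ->
  (forall X Y Z, Phi X Y (slpart Z) = Phi X Y Z) ->
  \sum_a \sum_b \sum_c \tr (I a *m I b *m I c) *: Phi (I a) (I b) (I c) =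
  \sum_i \sum_j \sum_k Phi (delta_mx j i) (delta_mx k j) (delta_mx i k).
Proof.
move=> lin1 lin2 lin3 sl1 sl2 sl3.
pose f1 Y Z : {linear 'M[F]_M -> W} :=
  HB.pack (fun X => Phi X Y Z) (GRing.isLinear.Build F _ W *:%R _ (lin1 Y Z)).
pose f2 X Z : {linear 'M[F]_M -> W} :=
  HB.pack (fun Y => Phi X Y Z) (GRing.isLinear.Build F _ W *:%R _ (lin2 X Z)).
pose f3 X Y : {linear 'M[F]_M -> W} :=
  HB.pack (fun Z => Phi X Y Z) (GRing.isLinear.Build F _ W *:%R _ (lin3 X Y)).
transitivity (\sum_i \sum_j \sum_k \sum_a \sum_b \sum_c
  (\tr (I a *m delta_mx j i) * \tr (I b *m delta_mx k j) * \tr (I c *m delta_mx i k))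
     *: Phi (I a) (I b) (I c)).
  transitivity (\sum_a \sum_b \sum_c \sum_i \sum_j \sum_k
    (I a i j * I b j k * I c k i) *: Phi (I a) (I b) (I c)).
    apply: eq_bigr => a _; apply: eq_bigr => b _; apply: eq_bigr => c _.
    rewrite mxtrace_mul3 scaler_suml; apply: eq_bigr => i _.
    by rewrite scaler_suml; apply: eq_bigr => j _; rewrite scaler_suml.
  rewrite exchange_sum3; apply: eq_bigr => i _.
  rewrite exchange_sum3; apply: eq_bigr => j _.
  rewrite exchange_sum3; apply: eq_bigr => k _.
  by do 3!(apply: eq_bigr => ? _); rewrite !mxtrace_mul_delta.
apply: eq_bigr => i _; apply: eq_bigr => j _; apply: eq_bigr => k _.
rewrite -[RHS]/(f1 (delta_mx k j) (delta_mx i k) (delta_mx j i)) -orthonormal_expand;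
  last by move=> X; apply: sl1.
apply: eq_bigr => a _.
rewrite -[f1 _ _ _]/(f2 (I a) (delta_mx i k) (delta_mx k j)) -orthonormal_expand;
  last by move=> X; apply: sl2.
rewrite scaler_sumr; apply: eq_bigr => b _.
rewrite -[f2 _ _ _]/(f3 (I a) (I b) (delta_mx i k)) -orthonormal_expand;
  last by move=> X; apply: sl3.
rewrite !scaler_sumr.
by apply: eq_bigr => c _; rewrite !scalerA.
Qed.

(** On such a vector only the terms [(j, k) = (0, 0), (1, 0), (0, 1)] of the infinite
    sum survive, and only within the second and third products. *)
Lemma q_depth1 z x : depth1 x ->
  q zs I z x = 3^-1 *: \sum_a \sum_b \sum_c tsym I a b c *:
    (cur (zeta z) (I a) 0 (cur (zeta z) (I b) 0 (cur (zeta z) (I c) 0 x))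
     + 3 *: (cur (zeta z) (I a) (-1) (cur (zeta z) (I b) 1 (cur (zeta z) (I c) 0 x))
     + cur (zeta z) (I a) (-1) (cur (zeta z) (I b) 0 (cur (zeta z) (I c) 1 x)))).
Proof.
move=> hx; rewrite /q; congr (_ *: _).
have J0 a : \tr (I a) = 0 by case: I_basis.
have [hx2 hx1] := hx.
have h0 a : depth1 (cur (zeta z) (I a) 0 x) by apply: depth1_cur.
pose body (j k : nat) a b c :=
  2 *: cur (zeta z) (I a) (- 1 - k%:Z) (cur (zeta z) (I b) (1 + k%:Z - j%:Z)
         (cur (zeta z) (I c) j%:Z x))
  + cur (zeta z) (I a) (- j%:Z - k%:Z) (cur (zeta z) (I b) k%:Z
         (cur (zeta z) (I c) j%:Z x)).
have qbody j k : qterm zs I z j k x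
    = \sum_a \sum_b \sum_c tsym I a b c *: body j k a b c.
  apply: eq_bigr => a _; apply: eq_bigr => b _; apply: eq_bigr => c _.
  congr (_ *: _); rewrite !current_cur // (hx2 _ _ (2 + j%:Z + k%:Z)); last by lia.
  by rewrite !raddf0 add0r.
have body0 j k a b c : (j, k) \notin [:: (0, 0); (1, 0); (0, 1)]%N -> body j k a b c = 0.
  case: j k => [|[|j]] k; rewrite /body.
  - case: k => [|[|k]] // _; have h m : 1 < m ->
      cur (zeta z) (I b) m (cur (zeta z) (I c) 0 x) = 0 by apply: (h0 c).1.
    by rewrite !h ?raddf0 ?scaler0 ?addr0 //; lia.
  - case: k => [|k] // _; have h m : 0 < m ->
      cur (zeta z) (I b) m (cur (zeta z) (I c) 1 x) = 0 by apply: hx1.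
    by rewrite !h ?raddf0 ?scaler0 ?addr0 //; lia.
  - move=> _; rewrite hx2; last by lia.
    by rewrite !raddf0 ?scaler0 addr0.
rewrite (fsbigE [:: (0, 0); (1, 0); (0, 1)]%N) //=.
- rewrite !big_cons big_nil !in_setT /= addr0 !qbody -!big_split.
  apply: eq_bigr => a _; rewrite -!big_split; apply: eq_bigr => b _.
  rewrite -!big_split; apply: eq_bigr => c _ /=; rewrite -!scalerDr; congr (_ *: _).
  pose K X m y := cur (zeta z) X m y : T.
  have -> : body 0%N 0%N a b c = 2 *: K (I a) (-1) (K (I b) 1 (K (I c) 0 x))
      + K (I a) 0 (K (I b) 0 (K (I c) 0 x)) by [].
  have -> : body 1%N 0%N a b c = 2 *: K (I a) (-1) (K (I b) 0 (K (I c) 1 x))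
      + K (I a) (-1) (K (I b) 0 (K (I c) 1 x)) by [].
  have -> : body 0%N 1%N a b c = K (I a) (-1) (K (I b) 1 (K (I c) 0 x)).
    rewrite /body (h0 c).1 // ?raddf0 ?add0r //.
  lmod_ring.
- move=> [j k] _ jk; rewrite qbody big1 // => a _; rewrite big1 // => b _.
  by rewrite big1 // => c _; rewrite body0 // scaler0.
Qed.

(** The cubic operator as a sum over closed paths [i, j, k] of matrix units. *)
Lemma q_units z x : depth1 x ->
  let J p r := cur (zeta z) (delta_mx p r) in
  q zs I z x =
  3^-1 *: (\sum_i \sum_j \sum_k
    (J i j 0 (J j k 0 (J k i 0 x)) + J i j 0 (J k i 0 (J j k 0 x))))
  + 2 *: (\sum_i \sum_j \sum_k
    (J i j (-1) (J j k 0 (J k i 1 x)) + J i j (-1) (J k i 0 (J j k 1 x)))).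
Proof.
move=> hx J.
pose Phi X Y Z := cur (zeta z) X 0 (cur (zeta z) Y 0 (cur (zeta z) Z 0 x))
     + 3 *: (cur (zeta z) X (-1) (cur (zeta z) Y 1 (cur (zeta z) Z 0 x))
     + cur (zeta z) X (-1) (cur (zeta z) Y 0 (cur (zeta z) Z 1 x))).
rewrite q_depth1 //.
have cX c m y k X Y : cur c (k *: X + Y) m y = k *: cur c X m y + cur c Y m y.
  by have := cur_mx_linear M_gt0 c m y k X Y.
have cs c m y X : cur c (slpart X) m y = cur c X m y :> T.
  by rewrite /cur; apply: eq_bigr => i _; rewrite (slpart_id (tr_slpart M_gt0 X)).
have lin1 Y Z : linear (fun X => Phi X Y Z).
  by move=> k X X'; rewrite /Phi !cX; lmod_ring.
have lin2 X Z : linear (fun Y => Phi X Y Z).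
  by move=> k Y Y'; rewrite /Phi !cX !(linearP (cur (zeta z) _ _)); lmod_ring.
have lin3 X Y : linear (fun Z => Phi X Y Z).
  by move=> k Z Z'; rewrite /Phi !cX !(linearP (cur (zeta z) _ _)); lmod_ring.
have C1 : \sum_a \sum_b \sum_c \tr (I a *m I b *m I c) *: Phi (I a) (I b) (I c)
  = \sum_i \sum_j \sum_k Phi (delta_mx i j) (delta_mx k i) (delta_mx j k).
  rewrite contract_basis //; last 3 first.
  - by move=> *; rewrite /Phi !cs.
  - by move=> *; rewrite /Phi !cs.
  - by move=> *; rewrite /Phi !cs.
  by rewrite exchange_big.
have C2 : \sum_a \sum_b \sum_c \tr (I b *m I a *m I c) *: Phi (I a) (I b) (I c)
  = \sum_i \sum_j \sum_k Phi (delta_mx i j) (delta_mx j k) (delta_mx k i).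
  rewrite exchange_big (contract_basis (Phi := fun Y X Z => Phi X Y Z)) //; last 3 first.
  - by move=> *; rewrite /Phi !cs.
  - by move=> *; rewrite /Phi !cs.
  - by move=> *; rewrite /Phi !cs.
  rewrite exchange_big [RHS]exchange_big; apply: eq_bigr => j _.
  exact: exchange_big.
have C : \sum_a \sum_b \sum_c tsym I a b c *: Phi (I a) (I b) (I c)
  = \sum_i \sum_j \sum_k (Phi (delta_mx i j) (delta_mx j k) (delta_mx k i)
      + Phi (delta_mx i j) (delta_mx k i) (delta_mx j k)).
  transitivity (\sum_a \sum_b \sum_c \tr (I b *m I a *m I c) *: Phi (I a) (I b) (I c)
    + \sum_a \sum_b \sum_c \tr (I a *m I b *m I c) *: Phi (I a) (I b) (I c)).
    rewrite -big_split; apply: eq_bigr => a _; rewrite -big_split; apply: eq_bigr => b _.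
    rewrite -big_split; apply: eq_bigr => c _ /=; rewrite -scalerDl /tsym; congr (_ *: _).
    by rewrite mxtraceD addrC.
  rewrite C1 C2 -big_split; apply: eq_bigr => i _; rewrite -big_split.
  by apply: eq_bigr => j _; rewrite -big_split.
rewrite -/(Phi _ _ _) C.
have -> : 2 = 3^-1 * 6 :> F by field.
rewrite -scalerA -scalerDr; congr (_ *: _); rewrite scaler_sumr -big_split.
apply: eq_bigr => i _ /=; rewrite scaler_sumr -big_split; apply: eq_bigr => j _ /=.
rewrite scaler_sumr -big_split; apply: eq_bigr => k _ /=; rewrite /Phi.
rewrite (cur_comm M_gt0 _ _ (delta_mx j k) (delta_mx k i) 1 0).
rewrite (cur_comm M_gt0 _ _ (delta_mx k i) (delta_mx j k) 1 0).
rewrite !mul0r !scale0r !subr0.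
set X := delta_mx j k *m _; set Y := delta_mx k i *m _.
have -> : cur (fun i0 => zeta z i0 * zeta z i0) (Y - X) (1 + 0) x =
  - cur (fun i0 => zeta z i0 * zeta z i0) (X - Y) (1 + 0) x.
  by rewrite -curNmx // opprB.
lmod_ring.
Qed.

End CubicOperator.

(** * Normal ordering of cubic words *)

Section SplitTripleSum.
Context (M : nat) (W : nmodType).

(** Sums over all indices, split according to the order of these. *)
Lemma sum2_split (H : 'I_M -> 'I_M -> W) :
  \sum_i \sum_j H i j = \sum_i H i i + osum2 (fun p q => H p q + H q p).
Proof.
rewrite osum2D /osum2.
transitivity (\sum_i (H i i + (\sum_(j < M | (i < j)%N) H i j
    + \sum_(j < M | (j < i)%N) H i j))).
  apply: eq_bigr => i _; rewrite (bigD1 i) //=; congr (_ + _).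
  rewrite (bigID (fun j : 'I_M => (i < j)%N)) /=; congr (_ + _); apply: eq_bigl => j;
    rewrite -val_eqE /=; lia.
rewrite !big_split /=; congr (_ + (_ + _)).
exact: (exchange_big_dep xpredT).
Qed.

Lemma sum3_split (G : 'I_M -> 'I_M -> 'I_M -> W) :
  \sum_i \sum_j \sum_k G i j k =
  \sum_i G i i i
  + osum2 (fun p q => (G p p q + G p q p + G q p p) + (G q q p + G q p q + G p q q))
  + osum3 (fun a b c => (G a b c + G b c a + G c a b) + (G a c b + G c b a + G b a c)).
Proof.
transitivity (\sum_i \sum_j G i j j
    + osum2 (fun p q => \sum_i (G i p q + G i q p))).
  rewrite /osum2; under [X in _ + X]eq_bigr => q _ do rewrite exchange_big.
  rewrite [X in _ + X]exchange_big -big_split; apply: eq_bigr => i _ /=.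
  exact: sum2_split.
rewrite sum2_split -!addrA; congr (_ + _).
pose K i p q := G i p q + G i q p.
have sumK (p q : 'I_M) : (p < q)%N -> \sum_i K i p q = (K p p q + K q p q)
    + (\sum_(i < M | (i < p)%N) K i p q
    + (\sum_(i < M | (p < i < q)%N) K i p q + \sum_(i < M | (q < i)%N) K i p q)).
  move=> pq; have qp : q != p by rewrite -val_eqE gtn_eqF.
  rewrite (bigD1 p) //= (bigD1 q) //= -addrA; congr (_ + (_ + _)).
  rewrite (bigID (fun i : 'I_M => (i < p)%N)) /=; congr (_ + _).
    by apply: eq_bigl => i; rewrite -!val_eqE /=; lia.
  rewrite (bigID (fun i : 'I_M => (i < q)%N)) /=; congr (_ + _);
    by apply: eq_bigl => i; rewrite -!val_eqE /=; lia.
rewrite [X in _ + X](eq_osum2 (H := fun p q => (K p p q + K q p q)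
    + (\sum_(i < M | (i < p)%N) K i p q
    + (\sum_(i < M | (p < i < q)%N) K i p q + \sum_(i < M | (q < i)%N) K i p q)))) //.
rewrite [X in _ + X]osum2D [X in _ + (_ + X)]osum2D [X in _ + (_ + (_ + X))]osum2D.
have E1 : osum2 (fun p q => \sum_(i < M | (i < p)%N) K i p q)
   = osum3 (fun a b c => K a b c) by [].
have E2 : osum2 (fun p q => \sum_(i < M | (p < i < q)%N) K i p q)
   = osum3 (fun a b c => K b a c).
  apply: eq_bigr => c _; rewrite (exchange_big_dep (fun i : 'I_M => (i < c)%N)) /=.
    by apply: eq_bigr => b bc; apply: eq_bigl => a; move: bc; lia.
  by move=> p i _ /andP[].
have E3 : osum2 (fun p q => \sum_(i < M | (q < i)%N) K i p q)
   = osum3 (fun a b c => K c a b).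
  rewrite /osum2; under eq_bigr => q _ do rewrite exchange_big.
  by rewrite (exchange_big_dep xpredT).
rewrite E1 E2 E3 -!osum3D addrA -osum2D; congr (_ + _).
  apply: eq_osum2 => p q _; exact: (AC (2*(2*2)) ((3*4*2)*(6*5*1))).
apply: eq_osum3 => a b c _; exact: (AC (2*(2*2)) ((1*4*5)*(2*6*3))).
Qed.

End SplitTripleSum.

(** The [J k] stand for the zero modes of a current and of its first two derivatives
    up to factors: the bracket of [J 1] with [J k] is [J (k + 1)] of the bracket. *)
Section NormalOrdering.
Context (F : numFieldType) (M : nat) (W : lmodType F).
Context (J1 J2 J3 : 'I_M -> 'I_M -> {linear W -> W}).
Context (J1J1 : forall i j k l x, J1 i j (J1 k l x) = J1 k l (J1 i j x)
  + ((j == k)%:R *: J2 i l x - (i == l)%:R *: J2 k j x)).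
Context (J1J2 : forall i j k l x, J1 i j (J2 k l x) = J2 k l (J1 i j x)
  + ((j == k)%:R *: J3 i l x - (i == l)%:R *: J3 k j x)).
Implicit Types (p q a b c : 'I_M) (x : W).

(** The summand of the cubic operator: cubic words in the matrix units that
    follow a closed path [i, j, k], read in both orders. *)
Definition word3 x i j k : W :=
  J1 i j (J1 j k (J1 k i x)) + J1 i j (J1 k i (J1 j k x)).

(** The contributions of a pair of indices, and below of a triple. In the results the
    units [J1 p q], raising when [p < q], stand on the right. *)
Lemma word3_pair x p q : p != q ->
  (word3 x p p q + word3 x p q p + word3 x q p p)
    + (word3 x q q p + word3 x q p q + word3 x p q q) =
  6 *: (J1 q p (J1 p p (J1 p q x)) + J1 q p (J1 q q (J1 p q x)))
  + 3 *: (J1 p p (J2 p p x - J2 q q x) + J1 q q (J2 p p x - J2 q q x)).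
Proof.
move=> pq; have pqF := negbTE pq; have qpF : (q == p) = false by rewrite eq_sym.
pose eqs := (eqxx, pqF, qpF).
have XY y : J1 p q (J1 q p y) = J1 q p (J1 p q y) + (J2 p p y - J2 q q y).
  by rewrite J1J1 !eqs !scale1r.
have XP y : J1 p q (J1 p p y) = J1 p p (J1 p q y) - J2 p q y.
  by rewrite J1J1 !eqs scale0r scale1r sub0r.
have XQ y : J1 p q (J1 q q y) = J1 q q (J1 p q y) + J2 p q y.
  by rewrite J1J1 !eqs scale0r scale1r subr0.
have PY y : J1 p p (J1 q p y) = J1 q p (J1 p p y) - J2 q p y.
  by rewrite J1J1 !eqs scale0r scale1r sub0r.
have QY y : J1 q q (J1 q p y) = J1 q p (J1 q q y) + J2 q p y.
  by rewrite J1J1 !eqs scale0r scale1r subr0.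
have X2Y y : J1 p q (J2 q p y) = J2 q p (J1 p q y) + (J3 p p y - J3 q q y).
  by rewrite J1J2 !eqs !scale1r.
have PP y : J2 p p (J1 p p y) = J1 p p (J2 p p y).
  by rewrite J1J2 !eqs subrr addr0.
have PQ y : J2 p p (J1 q q y) = J1 q q (J2 p p y).
  by rewrite J1J2 !eqs !scale0r subrr addr0.
have QP y : J2 q q (J1 p p y) = J1 p p (J2 q q y).
  by rewrite J1J2 !eqs !scale0r subrr addr0.
have QQ y : J2 q q (J1 q q y) = J1 q q (J2 q q y).
  by rewrite J1J2 !eqs subrr addr0.
have lin i j u v : J1 i j (u + v) = J1 i j u + J1 i j v by rewrite raddfD.
have linN i j u : J1 i j (- u) = - J1 i j u by rewrite raddfN.
rewrite /word3.
do ?(rewrite ?(XY, XP, XQ, PY, QY, X2Y, PP, PQ, QP, QQ) ?(lin, linN)).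
by lmod_ring.
Qed.

Lemma word3_triple x a b c : a != b -> b != c -> a != c ->
  (word3 x a b c + word3 x b c a + word3 x c a b)
    + (word3 x a c b + word3 x c b a + word3 x b a c) =
  3 *: (J1 c a (J1 a b (J1 b c x)) + J1 c a (J1 b c (J1 a b x))
        + J1 c b (J1 b a (J1 a c x)) + J1 b a (J1 c b (J1 a c x)))
  - 3 *: (J2 c b (J1 b c x) + J1 c b (J2 b c x))
  + 3 *: (J2 b a (J1 a b x) + J1 b a (J2 a b x))
  + 2 *: (J3 a a x - 2 *: J3 b b x + J3 c c x).
Proof.
move=> /negbTE ab /negbTE bc /negbTE ac.
have ba : (b == a) = false by rewrite eq_sym.
have cb : (c == b) = false by rewrite eq_sym.
have ca : (c == a) = false by rewrite eq_sym.
pose eqs := (eqxx, ab, bc, ac, ba, cb, ca).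
have R1 y : J1 a b (J1 c a y) = J1 c a (J1 a b y) - J2 c b y.
  by rewrite J1J1 !eqs scale0r scale1r sub0r.
have R2 y : J1 b c (J1 c a y) = J1 c a (J1 b c y) + J2 b a y.
  by rewrite J1J1 !eqs scale0r scale1r subr0.
have R3 y : J1 a b (J2 b a y) = J2 b a (J1 a b y) + (J3 a a y - J3 b b y).
  by rewrite J1J2 !eqs !scale1r.
have R4 y : J1 b c (J2 c b y) = J2 c b (J1 b c y) + (J3 b b y - J3 c c y).
  by rewrite J1J2 !eqs !scale1r.
have R5 y : J1 a c (J1 c b y) = J1 c b (J1 a c y) + J2 a b y.
  by rewrite J1J1 !eqs scale0r scale1r subr0.
have R6 y : J1 a c (J1 b a y) = J1 b a (J1 a c y) - J2 b c y.
  by rewrite J1J1 !eqs scale0r scale1r sub0r.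
have R7 y : J2 a b (J1 b a y) = J1 b a (J2 a b y) + (J3 a a y - J3 b b y).
  by rewrite J1J2 !eqs !scale1r; lmod_ring.
have R8 y : J2 b c (J1 c b y) = J1 c b (J2 b c y) + (J3 b b y - J3 c c y).
  by rewrite J1J2 !eqs !scale1r; lmod_ring.
have lin i j u v : J1 i j (u + v) = J1 i j u + J1 i j v by rewrite raddfD.
have linN i j u : J1 i j (- u) = - J1 i j u by rewrite raddfN.
rewrite /word3.
do ?(rewrite ?(R1, R2, R3, R4, R5, R6, R7, R8) ?(lin, linN)).
by lmod_ring.
Qed.

Let card_lt k : (k <= M)%N -> #|[pred a : 'I_M | (a < k)%N]| = k.
Proof.
move=> kM; rewrite -sum1_card -[RHS]card_ord -sum1_card.
by rewrite (big_ord_widen M (fun=> 1%N) kM).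
Qed.

Lemma card_ord_lt b : #|[pred a : 'I_M | (a < b)%N]| = b.
Proof. exact: card_lt (ltnW (ltn_ord b)). Qed.

Lemma card_ord_gt b : #|[pred c : 'I_M | (b < c)%N]| = (M - b.+1)%N.
Proof.
have H := cardC [pred a : 'I_M | (a < b.+1)%N]; rewrite card_lt // card_ord in H.
rewrite (eq_card (B := [predC [pred a : 'I_M | (a < b.+1)%N]])) => [|c]; last first.
  by rewrite !inE -leqNgt.
by rewrite -[LHS](addKn b.+1) H.
Qed.

Lemma sum_pick (P : pred 'I_M) p (G : 'I_M -> W) :
  \sum_(q < M | P q) (q == p)%:R *: G q = (P p)%:R *: G p.
Proof.
rewrite big_mkcond (bigD1 p) //= eqxx big1 ?addr0 => [|q /negbTE qp].
  by case: (P p); rewrite ?scale1r ?scale0r.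
by rewrite qp scale0r if_same.
Qed.

(** Sums over increasing pairs and triples of a summand supported at a given pair of
    consecutive entries. *)
Lemma osum2_pick p q (y : W) :
  osum2 (fun p' q' => ((p' == p) && (q' == q))%:R *: y) = (p < q)%:R *: y.
Proof.
transitivity (\sum_(q' < M) (q' == q)%:R *: ((p < q')%:R *: y)).
  apply: eq_bigr => q' _; case: (q' == q); last first.
    by rewrite scale0r big1 // => p' _; rewrite andbF scale0r.
  rewrite scale1r -(sum_pick (fun p' => p' < q')%N p (fun=> y)).
  by apply: eq_bigr => p' _; rewrite andbT.
by rewrite (sum_pick predT) scale1r.
Qed.

Lemma osum3_pick_hi p q (y : W) :
  osum3 (fun a b c => ((b == p) && (c == q))%:R *: y) = ((p < q)%:R * p%:R) *: y.
Proof.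
rewrite -scalerA -osum2_pick; apply: eq_bigr => c _; apply: eq_bigr => b _.
rewrite sumr_const; case: eqP => [->|_] /=; last by rewrite !scale0r mul0rn.
by rewrite card_ord_lt -scaler_nat !scalerA mulrC.
Qed.

Lemma osum3_pick_lo p q (y : W) :
  osum3 (fun a b c => ((a == p) && (b == q))%:R *: y)
  = ((p < q)%:R * (M - q.+1)%:R) *: y.
Proof.
transitivity (\sum_(c < M) \sum_(b < M | (b < c)%N) (b == q)%:R *: ((p < b)%:R *: y)).
  apply: eq_bigr => c _; apply: eq_bigr => b _; case: (b == q); last first.
    by rewrite scale0r big1 // => a _; rewrite andbF scale0r.
  rewrite scale1r -(sum_pick (fun a => a < b)%N p (fun=> y)).
  by apply: eq_bigr => a _; rewrite andbT.
under eq_bigr => c _ do rewrite (sum_pick (fun b => b < c)%N q).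
rewrite -scaler_suml -natr_sum -big_mkcond /= sum1_card card_ord_gt.
by rewrite scalerA mulrC.
Qed.

(** On a vector sent by the raising operators to multiples of a vector [v0] that
    they kill, and by all of them but one simple one to [0], the cubic operator
    reduces to its diagonal part and to words ending with that simple one. *)
Lemma word3_sum (n : 'I_M) x v0 (k1 k2 : F) :
  let s := ord_pred n in
  (forall p q, (p < q)%N -> J1 p q x = ((p == s) && (q == n))%:R * k1 *: v0) ->
  (forall p q, (p < q)%N -> J2 p q x = ((p == s) && (q == n))%:R * k2 *: v0) ->
  (forall p q, (p < q)%N -> J1 p q v0 = 0) ->
  \sum_i \sum_j \sum_k word3 x i j k =
  2 *: (\sum_i J1 i i (J1 i i (J1 i i x)))
  + 3 *: osum2 (fun p q => J1 p p (J2 p p x - J2 q q x) + J1 q q (J2 p p x - J2 q q x))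
  + 2 *: osum3 (fun a b c => J3 a a x - 2 *: J3 b b x + J3 c c x)
  + (s < n)%:R *:
    ((6 * k1) *: (J1 n s (J1 s s v0) + J1 n s (J1 n n v0))
    + (3 * ((M - n.+1)%:R - s%:R)) *: (k1 *: J2 n s v0 + k2 *: J1 n s v0)).
Proof.
move=> s h1 h2 hv; rewrite sum3_split.
have E2 : osum2 (fun p q =>
    (word3 x p p q + word3 x p q p + word3 x q p p)
    + (word3 x q q p + word3 x q p q + word3 x p q q))
  = 3 *: osum2 (fun p q => J1 p p (J2 p p x - J2 q q x) + J1 q q (J2 p p x - J2 q q x))
    + (s < n)%:R *: ((6 * k1) *: (J1 n s (J1 s s v0) + J1 n s (J1 n n v0))).
  rewrite (eq_osum2 (H := fun p q =>
      3 *: (J1 p p (J2 p p x - J2 q q x) + J1 q q (J2 p p x - J2 q q x))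
      + ((p == s) && (q == n))%:R *:
         ((6 * k1) *: (J1 n s (J1 s s v0) + J1 n s (J1 n n v0)))))
     => [|p q pq]; last first.
    have npq : p != q by rewrite -val_eqE (ltn_eqF pq).
    rewrite word3_pair // addrC h1 //.
    congr (_ + _); rewrite !(linearZ_LR (J1 _ _)).
    have [->|_] := eqVneq p s; have [->|_] := eqVneq q n;
      rewrite /= ?(mul0r, scale0r, raddf0, addr0, scaler0) //.
    by lmod_ring.
  rewrite osum2D osum2_pick; congr (_ + _).
  by rewrite /osum2 scaler_sumr; apply: eq_bigr => q _; rewrite scaler_sumr.
have E3 : osum3 (fun a b c => (word3 x a b c + word3 x b c a + word3 x c a b)
    + (word3 x a c b + word3 x c b a + word3 x b a c))
  = 2 *: osum3 (fun a b c => J3 a a x - 2 *: J3 b b x + J3 c c x)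
    + (s < n)%:R *: ((3 * ((M - n.+1)%:R - s%:R)) *: (k1 *: J2 n s v0 + k2 *: J1 n s v0)).
  pose Psi := k1 *: J2 n s v0 + k2 *: J1 n s v0.
  rewrite (eq_osum3 (H := fun a b c => 2 *: (J3 a a x - 2 *: J3 b b x + J3 c c x)
     + (((a == s) && (b == n))%:R *: (3 *: Psi) + ((b == s) && (c == n))%:R *: (- 3 *: Psi))))
    => [|a b c /andP[ab bc]]; last first.
    have ac := ltn_trans ab bc.
    have [nab nbc nac] : [/\ a != b, b != c & a != c].
      by rewrite -!val_eqE (ltn_eqF ab) (ltn_eqF bc) (ltn_eqF ac).
    rewrite word3_triple //.
    have acF : (a == s) && (c == n) = false.
      apply/negP => /andP[/eqP aE /eqP cE]; move: (ac); rewrite aE cE => /ord_pred_ltn.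
      by move: ab bc; rewrite aE cE -/s; lia.
    rewrite h1 // (h1 a b) // (h1 a c) // acF mul0r scale0r h2 // (h2 a b) //.
    rewrite !(linearZ_LR (J1 _ _)) !(linearZ_LR (J2 _ _)) (hv a b) // (hv b c) //.
    rewrite !raddf0 !addr0 ?scaler0 sub0r addrC; congr (_ + _).
    have T p q : ((p == s) && (q == n))%:R *: (k1 *: J2 q p v0 + k2 *: J1 q p v0)
        = ((p == s) && (q == n))%:R *: Psi.
      have [->|_] := eqVneq p s; last by rewrite !scale0r.
      by have [->|_] := eqVneq q n; last by rewrite !scale0r.
    transitivity (3 *: (((a == s) && (b == n))%:R *: (k1 *: J2 b a v0 + k2 *: J1 b a v0))
      - 3 *: (((b == s) && (c == n))%:R *: (k1 *: J2 c b v0 + k2 *: J1 c b v0))).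
      set d1 := (_ && _)%:R; set d2 := (_ && _)%:R.
      by lmod_ring.
    rewrite !T; by lmod_ring.
  rewrite osum3D osum3D osum3_pick_lo osum3_pick_hi; congr (_ + _).
    rewrite /osum3 scaler_sumr; apply: eq_bigr => c _; rewrite scaler_sumr.
    by apply: eq_bigr => b _; rewrite scaler_sumr.
  rewrite /Psi; lmod_ring.
have E1 : \sum_i word3 x i i i = 2 *: \sum_i J1 i i (J1 i i (J1 i i x)).
  by rewrite scaler_sumr; apply: eq_bigr => i _; rewrite /word3; lmod_ring.
rewrite E1 E2 E3 [X in _ = _ + X]scalerDr !addrA; congr (_ + _).
exact: addrAC.
Qed.

End NormalOrdering.

(** * Sums over increasing pairs and triples *)

Section OrderedSumEvaluation.
Context (F : numFieldType) (M : nat) (M_gt0 : (0 < M)%N).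
Implicit Types (x y : 'I_M -> F) (p q n : 'I_M).

(** The weights of the principal grading on C^M, up to a factor 2. *)
Definition pweight p : F := M%:R - 1 - 2 * p%:R.

(** Sums of the values of a function on the integers, given a discrete primitive. *)
Let sum_lt (g h : nat -> F) k : (k <= M)%N -> h 0%N = 0 ->
  (forall j, h j.+1 = h j + g j) -> \sum_(p < M | (p < k)%N) g p = h k.
Proof.
move=> kM h0 hS; rewrite -(big_ord_widen M g kM) => {kM}.
elim: k => [|k IH]; first by rewrite big_ord0.
by rewrite big_ord_recr /= IH hS.
Qed.

Let sum_all (g h : nat -> F) : h 0%N = 0 -> (forall j, h j.+1 = h j + g j) ->
  \sum_(p < M) g p = h M.
Proof.
move=> h0 hS; rewrite -(sum_lt (leqnn M) h0 hS); apply: eq_bigl => p.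
by rewrite ltn_ord.
Qed.

Let sum_gt (g h : nat -> F) p : h 0%N = 0 -> (forall j, h j.+1 = h j + g j) ->
  \sum_(q < M | (p < q)%N) g q = h M - h p.+1.
Proof.
move=> h0 hS; rewrite -(sum_all h0 hS) -(sum_lt (ltn_ord p) h0 hS).
rewrite [X in _ = X - _](bigID (fun q : 'I_M => (q < p.+1)%N)) /= addrAC subrr add0r.
by apply: eq_bigl => q; rewrite -leqNgt.
Qed.

Let osum2_exchange (W : nmodType) (G : 'I_M -> 'I_M -> W) :
  osum2 G = \sum_(p < M) \sum_(q < M | (p < q)%N) G p q.
Proof. exact: (exchange_big_dep xpredT). Qed.

Let natr_gt p : (M - p.+1)%:R = M%:R - 1 - p%:R :> F.
Proof. by rewrite natrB ?ltn_ord // -natr1; ring. Qed.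

Lemma osum2_coboundary x : osum2 (fun p q => x p - x q) = \sum_p pweight p * x p.
Proof.
rewrite osum2D osum2_exchange /osum2 -big_split; apply: eq_bigr => p _ /=.
rewrite !sumr_const card_ord_gt card_ord_lt mulNrn -!(mulr_natl (x p)).
by rewrite natr_gt /pweight; ring.
Qed.

Lemma sum_pweight : \sum_p pweight p = 0.
Proof.
rewrite (sum_all (g := fun k => M%:R - 1 - 2 * k%:R) (h := fun k => k%:R * (M%:R - k%:R))).
- by rewrite subrr mulr0.
- by rewrite mul0r.
- by move=> j; rewrite -natr1; ring.
Qed.

Lemma sum_pweight3 : \sum_p pweight p ^+ 3 = 0.
Proof.
pose H (t : F) := (t ^+ 4 - 2 * t ^+ 2) / 8.
rewrite (sum_all (g := fun k => (M%:R - 1 - 2 * k%:R) ^+ 3)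
  (h := fun k => H M%:R - H (M%:R - 2 * k%:R))).
- by rewrite /H; field.
- by rewrite /H; field.
- by move=> j; rewrite -natr1 /H; field.
Qed.

Let tri (k : nat) : F := k%:R * (k%:R - 1) / 2.
Let tri0 : tri 0 = 0. Proof. by rewrite /tri !mul0r. Qed.
Let triS j : tri j.+1 = tri j + j%:R.
Proof. by rewrite /tri -natr1; field. Qed.

Lemma osum3_coboundary x : \sum_p x p = 0 ->
  osum3 (fun a b c => x a - 2 * x b + x c) = 3 / 4 * \sum_p pweight p ^+ 2 * x p.
Proof.
move=> x0.
have Ec : osum3 (fun a b c => x c) = \sum_(p < M) tri p * x p.
  apply: eq_bigr => c _; under eq_bigr => b _ do
    rewrite sumr_const card_ord_lt -mulr_natl.
  by rewrite -mulr_suml (sum_lt (ltnW (ltn_ord c)) tri0 triS).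
have Eb : osum3 (fun a b c => x b) = \sum_(p < M) (p%:R * (M%:R - 1 - p%:R)) * x p.
  transitivity (osum2 (fun b c => b%:R * x b)).
    apply: eq_bigr => c _; apply: eq_bigr => b _.
    by rewrite sumr_const card_ord_lt -[LHS]mulr_natl.
  rewrite osum2_exchange; apply: eq_bigr => p _.
  by rewrite sumr_const card_ord_gt -[LHS]mulr_natl natr_gt; ring.
have Ea : osum3 (fun a b c => x a)
    = \sum_(p < M) ((M%:R - 1) * (M%:R - 1 - p%:R) - (tri M - tri p.+1)) * x p.
  transitivity (osum2 (fun a b => (M%:R - 1 - b%:R) * x a)).
    transitivity (osum2 (fun b c : 'I_M => \sum_(a < M | (a < b)%N) x a)) => //.
    rewrite osum2_exchange /osum2.
    apply: eq_bigr => b _; rewrite sumr_const card_ord_gt -[LHS]mulr_natl natr_gt.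
    by rewrite mulr_sumr.
  rewrite osum2_exchange; apply: eq_bigr => p _; rewrite -mulr_suml sumrB.
  rewrite (sum_gt (g := fun k => k%:R) p tri0 triS) sumr_const card_ord_gt.
  by rewrite -(mulr_natl (M%:R - 1)) natr_gt; congr ((_ - _) * _); ring.
rewrite !osum3D Ea Ec.
have -> : osum3 (fun a b c => - (2 * x b)) = - (2 * \sum_(p < M) (p%:R * (M%:R - 1 - p%:R)) * x p).
  rewrite -Eb /osum3 mulr_sumr -sumrN; apply: eq_bigr => c _.
  rewrite mulr_sumr -sumrN; apply: eq_bigr => b _.
  by rewrite mulr_sumr -sumrN.
pose K : F := - (M%:R - 1) ^+ 2 / 4 - (M%:R - 1) / 2.
have xK : \sum_p K * x p = 0 by rewrite -mulr_sumr x0 mulr0.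
rewrite -[RHS]addr0 -[X in _ = _ + X]xK !mulr_sumr -sumrN -!big_split.
by apply: eq_bigr => p _ /=; rewrite /tri -natr1 /pweight /K; field.
Qed.

(** The antisymmetric pairing of two sequences along the order of the indices. *)
Definition apair x y : F := osum2 (fun p q => x p * y q - x q * y p).

Lemma apairC x y : apair x y = - apair y x.
Proof.
apply/eqP; rewrite -addr_eq0 -osum2D /osum2 big1 // => q _.
by rewrite big1 // => p _; ring.
Qed.

Lemma apairDl x x' y : apair (fun p => x p + x' p) y = apair x y + apair x' y.
Proof. by rewrite -osum2D; apply: eq_osum2 => p q _; ring. Qed.

Lemma apairZl k x y : apair (fun p => k * x p) y = k * apair x y.
Proof.
rewrite /apair /osum2 mulr_sumr; apply: eq_bigr => q _; rewrite mulr_sumr.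
by apply: eq_bigr => p _; ring.
Qed.

Lemma apairDr x y y' : apair x (fun p => y p + y' p) = apair x y + apair x y'.
Proof. by rewrite apairC apairDl opprD -!(apairC x). Qed.

Lemma apairZr k x y : apair x (fun p => k * y p) = k * apair x y.
Proof. by rewrite apairC apairZl -mulrN -apairC. Qed.

Lemma eq_apair x x' y y' : x =1 x' -> y =1 y' -> apair x y = apair x' y'.
Proof. by move=> hx hy; apply: eq_osum2 => p q _; rewrite !hx !hy. Qed.

Lemma apair_pweight x : \sum_p x p = 0 ->
  apair pweight x = - 2^-1 * \sum_p pweight p ^+ 2 * x p.
Proof.
move=> x0; rewrite /apair osum2D.
pose h (k : nat) : F := k%:R * (M%:R - k%:R).
have h0 : h 0%N = 0 by rewrite /h mul0r.
have hS j : h j.+1 = h j + (M%:R - 1 - 2 * j%:R) by rewrite /h -natr1; ring.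
have E1 : osum2 (fun p q => pweight p * x q) = \sum_(q < M) h q * x q.
  apply: eq_bigr => q _; rewrite -mulr_suml.
  by rewrite (sum_lt (g := fun j => M%:R - 1 - 2 * j%:R) (ltnW (ltn_ord q)) h0 hS).
have E2 : osum2 (fun p q => - (pweight q * x p)) = - \sum_(p < M) (h M - h p.+1) * x p.
  rewrite osum2_exchange -sumrN; apply: eq_bigr => p _; rewrite sumrN -mulr_suml.
  by rewrite (sum_gt (g := fun j => M%:R - 1 - 2 * j%:R) p h0 hS).
rewrite E1 E2; pose K : F := (M%:R ^+ 2 - 1) / 2.
have xK : \sum_p K * x p = 0 by rewrite -mulr_sumr x0 mulr0.
rewrite -[RHS]addr0 -[X in _ = _ + X]xK !mulr_sumr -sumrN -!big_split.
by apply: eq_bigr => p _ /=; rewrite /h -natr1 /pweight /K; field.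
Qed.

(** The weight of the lowering unit [E_(n, n-1)], whose bracket with [E_pp] is
    [root_eps n p] times itself. *)
Definition root_eps n p : F := (p == n)%:R - (p == ord_pred n)%:R.

Lemma sum_root_eps n x : \sum_p root_eps n p * x p = x n - x (ord_pred n).
Proof.
rewrite /root_eps; under eq_bigr => p _ do rewrite mulrBl mulrC [X in _ - X]mulrC.
by rewrite sumrB !pick_ord.
Qed.

(** The formula holds for [n = 0] too, where the order reverses, because [x] sums
    to 0. *)
Lemma apair_root_eps n x : \sum_p x p = 0 ->
  apair (root_eps n) x = - (x n + x (ord_pred n)).
Proof.
move=> x0; rewrite /apair osum2D.
pose P p := \sum_(q < M | (q < p)%N) x q.
have PD p : P p + (x p + \sum_(q < M | (p < q)%N) x q) = 0.
  apply: etrans x0; rewrite [RHS](bigID (fun q : 'I_M => (q < p)%N)) /=; congr (_ + _).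
  rewrite [RHS](bigD1 p) /=; last by rewrite ltnn.
  congr (_ + _); apply: eq_bigl => q.
  by rewrite -val_eqE /=; lia.
have E1 : osum2 (fun p q => root_eps n p * x q) = \sum_p root_eps n p * (- x p - P p).
  rewrite osum2_exchange; apply: eq_bigr => p _; rewrite -mulr_sumr; congr (_ * _).
  by have /eqP := PD p; rewrite addrA addr_eq0 => /eqP/(congr1 -%R); rewrite opprK => <-; ring.
have E2 : osum2 (fun p q => - (root_eps n q * x p)) = - \sum_q root_eps n q * P q.
  by rewrite -sumrN; apply: eq_bigr => q _; rewrite sumrN mulr_sumr.
rewrite E1 E2 -sumrB.
transitivity (\sum_p root_eps n p * (- x p - 2 * P p)).
  by apply: eq_bigr => p _; ring.
rewrite sum_root_eps.
have [n0|n0] := posnP n.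
  have Pn : P n = 0 by rewrite /P big_pred0 // => q; rewrite n0 ltn0.
  have Ps : P (ord_pred n) = - x (ord_pred n).
    have /eqP := PD (ord_pred n); rewrite [X in _ + (_ + X)]big_pred0 => [|q].
      by rewrite addr0 addr_eq0 => /eqP.
    by rewrite /= n0 add0n modn_small ?ltn_predL //; have := ltn_ord q; lia.
  by rewrite Pn Ps; ring.
have sn := ord_pred_succ n0.
move: (ord_pred n) sn => s sn; have -> : P n = P s + x s.
  have snl : (s < n)%N by rewrite -sn.
  rewrite /P [LHS](bigD1 s) //= addrC; congr (_ + _).
  by apply: eq_bigl => q; rewrite -(inj_eq val_inj) /=; lia.
ring.
Qed.

End OrderedSumEvaluation.

(** * The cubic symbol and its shift *)

Section CubicShift.
Context (F : numFieldType) (M : nat) (M_gt0 : (0 < M)%N).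
Implicit Types (m : 'I_M -> F) (phi : F).
Let Mn0 : (M%:R : F) != 0. Proof. by rewrite pnatr_eq0 -lt0n. Qed.

(** The symbol of the cubic operator on the eigenvalues [m] of the Cartan
    currents; [m2] is minus the first derivative of [m], and [m3] one half of the
    second one. *)
Definition cubic_symbol m m2 m3 : F :=
  2 / 3 * (\sum_p m p ^+ 3) + osum2 (fun p q => (m p + m q) * (m2 p - m2 q))
  + 2 / 3 * osum3 (fun a b c => m3 a - 2 * m3 b + m3 c).

(** A primitive, up to twisted derivatives, of the terms of [cubic_symbol] that
    the Miura side lacks, and its derivative. *)
Definition shift_primitive m m2 phi : F :=
  - 2^-1 * (\sum_p pweight F p * m p ^+ 2) - 4^-1 * (\sum_p pweight F p ^+ 2 * m2 p)
  + phi / (4 * M%:R) * (\sum_p pweight F p ^+ 2 * m p).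

Definition shift_primitive' m m2 m3 phi phi' : F :=
  (\sum_p pweight F p * (m p * m2 p)) + 2^-1 * (\sum_p pweight F p ^+ 2 * m3 p)
  + (phi' * (\sum_p pweight F p ^+ 2 * m p) - phi * (\sum_p pweight F p ^+ 2 * m2 p))
    / (4 * M%:R).

(** The shift of the eigenvalues by a multiple of the Weyl vector. *)
Definition rho_shift m phi p : F := m p - pweight F p * phi / (2 * M%:R).

(** Completing the cube with [pweight], the symbol becomes the expression of the
    coefficient of [p 2], up to the twisted derivative of [shift_primitive]. *)
Lemma cubic_symbol_shift m m2 m3 phi phi' :
  \sum_p m p = 0 -> \sum_p m2 p = 0 -> \sum_p m3 p = 0 ->
  let x := rho_shift m phi in
  let x' := rho_shift (fun p => - m2 p) phi' in
  cubic_symbol m m2 m3 = 2 / 3 * (\sum_p x p ^+ 3) + apair x x'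
    + (shift_primitive' m m2 m3 phi phi' - 2 / M%:R * phi * shift_primitive m m2 phi).
Proof.
move=> s1 s2 s3 x x'.
have w0 := sum_pweight F M; have w3 := sum_pweight3 F M.
have E1 : osum2 (fun p q => (m p + m q) * (m2 p - m2 q))
    = (\sum_p pweight F p * (m p * m2 p)) - apair m m2.
  rewrite -(apairC m2) -(osum2_coboundary (fun p => m p * m2 p)) -osum2D.
  by apply: eq_osum2 => p q _; ring.
have E2 : apair x x' = - apair m m2
    - (phi' * (\sum_p pweight F p ^+ 2 * m p) + phi * (\sum_p pweight F p ^+ 2 * m2 p))
      / (4 * M%:R).
  pose k := - phi / (2 * M%:R); pose k' := - phi' / (2 * M%:R).
  rewrite (eq_apair (x' := fun p => m p + k * pweight F p)
    (y' := fun p => -1 * m2 p + k' * pweight F p)); first last.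
  - by move=> p; rewrite /x' /rho_shift /k'; field.
  - by move=> p; rewrite /x /rho_shift /k; field.
  rewrite !apairDl !apairDr !apairZl !apairZr (apairC m (pweight F (M:=M))).
  rewrite (apair_pweight s1) (apair_pweight s2).
  have -> : apair (pweight F (M:=M)) (pweight F (M:=M)) = 0 :> F.
    by rewrite (apair_pweight w0) -[RHS](mulr0 (- 2^-1)) -[X in _ = _ * X]w3;
       congr (_ * _); apply: eq_bigr => p _; rewrite -exprSr.
  by rewrite /k /k'; field.
have E3 : \sum_p x p ^+ 3 = (\sum_p m p ^+ 3)
    - 3 * phi / (2 * M%:R) * (\sum_p pweight F p * m p ^+ 2)
    + 3 * phi ^+ 2 / (4 * M%:R ^+ 2) * (\sum_p pweight F p ^+ 2 * m p).
  transitivity ((\sum_p m p ^+ 3)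
    - 3 * phi / (2 * M%:R) * (\sum_p pweight F p * m p ^+ 2)
    + 3 * phi ^+ 2 / (4 * M%:R ^+ 2) * (\sum_p pweight F p ^+ 2 * m p)
    - (phi ^+ 3 / (8 * M%:R ^+ 3)) * (\sum_(p < M) pweight F p ^+ 3)); last first.
    by rewrite w3 mulr0 subr0.
  rewrite !mulr_sumr -!sumrN -!big_split; apply: eq_bigr => p _ /=.
  by rewrite /x /rho_shift; field.
rewrite /cubic_symbol E1 E2 E3 osum3_coboundary // /shift_primitive /shift_primitive'.
by field.
Qed.

End CubicShift.

(** * Vectors with one lowering operator *)

Section OneRoot.
Context (F : numFieldType) (M N : nat) (M_ge3 : (3 <= M)%N).
Context (lam : 'I_N -> weight F M) (V : forall j, verma (lam j)).
Context (T : tensor_product V) (n : 'I_M).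
Implicit Types (c d : 'I_N -> F) (p q : 'I_M).
Let M_gt0 : (0 < M)%N. Proof. exact: leq_trans M_ge3. Qed.
Local Notation s := (ord_pred n).
Local Notation vac := (vac T).
Local Notation G := (delta_mx n s : 'M[F]_M).
Local Notation deg := (- (is0 n)%:Z).
Local Notation mu c := (cur_weight lam c).
Local Notation "c * d" := (fun i => c i * d i) : function_scope.

Let ns : n != s. Proof. by rewrite eq_sym ord_pred_neq. Qed.

(** The vectors obtained by applying one lowering operator of colour [n]. *)
Definition root_vec c : T := cur c G deg vac.

(** The sums of the levels and of the values on the coroot [n], with weights [c]. *)
Definition cur_level c : F := \sum_i c i * level (lam i).
Definition cur_coroot c : F := \sum_i c i * on_coroot (lam i) n.

Lemma cur_weight_coroot c :
  mu c s - mu c n = cur_coroot c - (is0 n)%:R * cur_level c.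
Proof.
rewrite /cur_weight /cur_coroot /cur_level mulr_sumr -!sumrB.
apply: eq_bigr => i _; rewrite -mulrBr gl_weight_pred //; ring.
Qed.

Lemma br_unit_root p q : delta_mx p q *m G - G *m delta_mx p q =
  (q == n)%:R *: delta_mx p s - (s == p)%:R *: delta_mx n q :> 'M[F]_M.
Proof. by rewrite !mul_delta_mx_cond !scaler_nat. Qed.

Lemma cur0_root_vec c d p q :
  cur c (delta_mx p q) 0 (root_vec d) = cur d G deg (cur c (delta_mx p q) 0 vac)
  + ((q == n)%:R *: cur (c * d) (delta_mx p s) deg vac
     - (s == p)%:R *: cur (c * d) (delta_mx n q) deg vac).
Proof.
rewrite /root_vec cur_comm // add0r br_unit_root curBmx // !curZmx //.
have -> : (deg%:~R : F) * (deg == 0)%:R = 0.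
  by rewrite /is0; case: (val n == 0)%N; rewrite ?mulr0 ?mul0r.
by rewrite !mul0r scale0r subr0.
Qed.

Lemma cur0_root_vec_diag c d p : cur c (delta_mx p p) 0 (root_vec d) =
  mu c p *: root_vec d + root_eps F n p *: root_vec (c * d).
Proof.
rewrite cur0_root_vec cur_vac_diag // linearZ_LR; congr (_ + _).
rewrite /root_eps scalerBl /root_vec (eq_sym s); congr (_ - _).
  by have [->//|_] := eqVneq p n; rewrite !scale0r.
by have [->//|_] := eqVneq p s; rewrite !scale0r.
Qed.

(** Only the simple raising unit [E_(n-1, n)] does not kill the vector; for [n = 0] all
    the raising zero modes do. *)
Lemma cur0_root_vec_raise c d p q : (p < q)%N ->
  cur c (delta_mx p q) 0 (root_vec d) =
  (((p == s) && (q == n))%:R * (mu (c * d) s - mu (c * d) n)) *: vac.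
Proof.
move=> pq; rewrite cur0_root_vec cur_vac_raise // raddf0 add0r (eq_sym s).
have [n0|n0] := posnP n.
  have qn : (q == n) = false by rewrite -val_eqE /= n0; lia.
  have ps : (p == s) = false.
    by rewrite -val_eqE /= n0 add0n modn_small ?ltn_predL //; have := ltn_ord q; lia.
  by rewrite qn ps andbF mul0r !scale0r subr0.
have e0 : deg = 0 by rewrite /is0 (gtn_eqF n0).
have sn := ord_pred_succ n0.
rewrite e0; have [qn|qn] := eqVneq q n; have [ps|ps] := eqVneq p s.
- by rewrite qn ps !cur_vac_diag // /=; lmod_ring.
- have pls : (p < s)%N.
    have ps' : (nat_of_ord p != nat_of_ord s) by exact: ps.
    by move: pq; rewrite qn; lia.
  by rewrite (cur_vac_raise _ _ pls) //= mul0r !scale0r scaler0 subr0.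
- have nlq : (n < q)%N.
    have qn' : (nat_of_ord q != nat_of_ord n) by exact: qn.
    by move: pq; rewrite ps; lia.
  by rewrite (cur_vac_raise _ _ nlq) //= mul0r !scale0r scaler0 subr0.
- by rewrite !scale0r subr0 mul0r scale0r.
Qed.

(** The counterpart in colour 0, where the raising operator has degree 1; the
    central term completes the coroot. *)
Lemma cur1_root_vec c d p q :
  cur c (delta_mx p q) 1 (root_vec d) =
  ((is0 n)%:R * ((p == s) && (q == n))%:R * cur_coroot (c * d)) *: vac.
Proof.
rewrite /root_vec cur_comm // cur_vac_pos // raddf0 add0r br_unit_root.
rewrite curBmx // !curZmx // (eq_sym s) (tr_delta_mx F n s) (negbTE ns) mulr0 mul0r subr0.
have trE : \tr (delta_mx p q *m G) = ((p == s) && (q == n))%:R :> F.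
  by rewrite mul_delta_mx_cond -scaler_nat mxtraceZ tr_delta_mx -natrM mulnb andbC.
rewrite trE -/(cur_level (fun i => (c i * d i)%R)).
have [n0|n0] := eqVneq (val n) 0%N; last first.
  rewrite /is0 (negbTE n0) !mul0r !scale0r subr0 addr0.
  by rewrite !cur_vac_pos // !scaler0 subrr.
have -> : is0 n = 1%N by rewrite /is0 n0.
rewrite subrr.
have s_max q' : (q' != s) = (q' < s)%N.
  rewrite -val_eqE /= n0 add0n modn_small ?ltn_predL //; have := ltn_ord q'; lia.
have n_min p' : (p' != n) = (n < p')%N.
  by rewrite -val_eqE /= n0 lt0n.
have [qn|qn] := eqVneq q n; have [ps|ps] := eqVneq p s.
- rewrite qn ps !cur_vac_diag // /=.
  have := cur_weight_coroot (fun i => (c i * d i)%R).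
  rewrite /is0 n0 eqxx => /eqP; rewrite subr_eq => /eqP ->.
  have -> : (- 1%:Z)%:~R = -1 :> F by [].
  have -> : true%:R = 1 :> F by [].
  by lmod_ring.
- have pls : (p < s)%N by rewrite -s_max.
  by rewrite (cur_vac_raise _ _ pls) //= scaler0 !(mulr0, mul0r, scale0r) !subr0.
- have nlq : (n < q)%N by rewrite -n_min.
  by rewrite (cur_vac_raise _ _ nlq) //= scaler0 !(mulr0, mul0r, scale0r) !subr0.
- by rewrite !scale0r /= !(mulr0, mul0r, scale0r) !subr0.
Qed.

Lemma depth1_root_vec d : depth1 (root_vec d).
Proof.
rewrite /root_vec /is0; case: (val n == 0)%N.
  by apply: depth1_lower => //; apply: depth0_vac.
by apply: depth1_depth0; rewrite oppr0; apply: depth0_cur => //; apply: depth0_vac.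
Qed.

End OneRoot.

(** * The cubic operator on the Bethe vector *)

Section CubicOnOneRoot.
Context (F : numFieldType) (M N : nat) (M_ge3 : (3 <= M)%N).
Context (lam : 'I_N -> weight F M) (V : forall j, verma (lam j)).
Context (T : tensor_product V) (zs : 'I_N -> F) (n : 'I_M).
Let M_gt0 : (0 < M)%N. Proof. exact: leq_trans M_ge3. Qed.
Context (w z : F) (w_neq_zs : forall j, w != zs j) (z_neq_zs : forall j, z != zs j).
Context (z_neq_w : z != w).
Context (bethe : \sum_j on_coroot (lam j) n / (w - zs j) = 0).
Local Notation s := (ord_pred n).
Local Notation vac := (vac T).
Local Notation mu c := (cur_weight lam c).

(** The coefficients of the currents and, up to a factor [(-1)^k k!], of their [k]-th
    derivatives are the powers [k + 1]. *)
Definition zpow z k (i : 'I_N) : F := zeta zs z i ^+ k.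

Let a : F := (z - w)^-1.
Let om := zeta zs w.
Let z1 := zpow z 1.
Let z2 := zpow z 2.
Let z3 := zpow z 3.
Let psi := root_vec T n om.
Let f1 := root_vec T n z1.
Let f2 := root_vec T n z2.
Let f3 := root_vec T n z3.
Let eta := root_eps F n.

(** Partial fractions: they express the vectors with coefficients [zpow k * om]
    through [psi] and the [f_k]. *)
Let z1_om i : z1 i * om i = a * om i + - a * z1 i.
Proof.
rewrite /z1 /om /zpow /zeta /a expr1; field.
by rewrite !subr_eq0 z_neq_zs w_neq_zs z_neq_w.
Qed.

Let z2_om i : z2 i * om i = a ^+ 2 * om i + - a ^+ 2 * z1 i + - a * z2 i.
Proof.
have -> : z2 i = z1 i * z1 i by rewrite /z1 /z2 /zpow expr1 expr2.
by rewrite -mulrA z1_om mulrDr (mulrCA _ a) z1_om; ring.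
Qed.

Let z3_om i : z3 i * om i =
  a ^+ 3 * om i + - a ^+ 3 * z1 i + - a ^+ 2 * z2 i + - a * z3 i.
Proof.
have -> : z3 i = z1 i * z2 i by rewrite /z1 /z2 /z3 /zpow expr1 -exprS.
rewrite -mulrA z2_om !mulrDr (mulrCA _ (a ^+ 2)) z1_om.
by rewrite /z1 /z2 /zpow expr1; ring.
Qed.

Let root_vec_comb k l c d :
  root_vec T n (fun i => k * c i + l * d i) = k *: root_vec T n c + l *: root_vec T n d.
Proof. exact: cur_comb. Qed.

Let eq_root_vec c d : c =1 d -> root_vec T n c = root_vec T n d.
Proof. exact: eq_cur. Qed.

Let psi1 : root_vec T n (fun i => z1 i * om i) = a *: psi - a *: f1.
Proof. by rewrite (eq_root_vec z1_om) root_vec_comb scaleNr. Qed.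

Let psi2 : root_vec T n (fun i => z2 i * om i) = a ^+ 2 *: psi - a ^+ 2 *: f1 - a *: f2.
Proof.
transitivity (root_vec T n (fun i => 1 * (a ^+ 2 * om i + - a ^+ 2 * z1 i) + - a * z2 i)).
  by apply: eq_root_vec => i; rewrite z2_om mul1r.
by rewrite !root_vec_comb scale1r !scaleNr.
Qed.

Let psi3 : root_vec T n (fun i => z3 i * om i) =
  a ^+ 3 *: psi - a ^+ 3 *: f1 - a ^+ 2 *: f2 - a *: f3.
Proof.
transitivity (root_vec T n (fun i => 1 * (1 * (a ^+ 3 * om i + - a ^+ 3 * z1 i)
    + - a ^+ 2 * z2 i) + - a * z3 i)).
  by apply: eq_root_vec => i; rewrite z3_om !mul1r.
by rewrite !root_vec_comb !scale1r !scaleNr.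
Qed.

Let J1 p q : {linear T -> T} := cur z1 (delta_mx p q) 0.
Let J2 p q : {linear T -> T} := cur z2 (delta_mx p q) 0.
Let J3 p q : {linear T -> T} := cur z3 (delta_mx p q) 0.

Let unit_br (i j k l : 'I_M) : delta_mx i j *m delta_mx k l - delta_mx k l *m delta_mx i j
  = (j == k)%:R *: delta_mx i l - (i == l)%:R *: delta_mx k j :> 'M[F]_M.
Proof. by rewrite !mul_delta_mx_cond !scaler_nat (eq_sym l). Qed.

Let J1J1 i j k l x : J1 i j (J1 k l x) = J1 k l (J1 i j x)
  + ((j == k)%:R *: J2 i l x - (i == l)%:R *: J2 k j x).
Proof.
by rewrite [LHS]cur_comm // !mul0r scale0r subr0 unit_br curBmx // !curZmx.
Qed.

Let J1J2 i j k l x : J1 i j (J2 k l x) = J2 k l (J1 i j x)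
  + ((j == k)%:R *: J3 i l x - (i == l)%:R *: J3 k j x).
Proof.
by rewrite [LHS]cur_comm // !mul0r scale0r subr0 unit_br curBmx // !curZmx.
Qed.

Let m1 p := mu z1 p + a * eta p.
Let m2 p := mu z2 p + a ^+ 2 * eta p.
Let m3 p := mu z3 p + a ^+ 3 * eta p.

Let J1psi p : J1 p p psi = m1 p *: psi - (a * eta p) *: f1.
Proof.
rewrite [LHS]cur0_root_vec_diag // psi1 /m1 -/eta -/psi; lmod_ring.
Qed.

Let J2psi p : J2 p p psi = m2 p *: psi - (a ^+ 2 * eta p) *: f1 - (a * eta p) *: f2.
Proof.
rewrite [LHS]cur0_root_vec_diag // psi2 /m2 -/eta -/psi; lmod_ring.
Qed.

Let J3psi p : J3 p p psi = m3 p *: psi - (a ^+ 3 * eta p) *: f1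
   - (a ^+ 2 * eta p) *: f2 - (a * eta p) *: f3.
Proof.
rewrite [LHS]cur0_root_vec_diag // psi3 /m3 -/eta -/psi; lmod_ring.
Qed.

Let J1f1 p : J1 p p f1 = mu z1 p *: f1 + eta p *: f2.
Proof.
by rewrite [LHS]cur0_root_vec_diag.
Qed.

Let J1f2 p : J1 p p f2 = mu z1 p *: f2 + eta p *: f3.
Proof.
by rewrite [LHS]cur0_root_vec_diag.
Qed.

(** The span of [psi] and the [f_k] is stable under the diagonal operators. *)
Let comb (u v x y : F) : T := u *: psi + v *: f1 + x *: f2 + y *: f3.

Let J1B r u v : J1 r r (u - v) = J1 r r u - J1 r r v. Proof. exact: raddfB. Qed.
Let J1D r u v : J1 r r (u + v) = J1 r r u + J1 r r v. Proof. exact: raddfD. Qed.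
Let J1Z r k u : J1 r r (k *: u) = k *: J1 r r u. Proof. exact: linearZ_LR. Qed.

Let J1_cube p : J1 p p (J1 p p (J1 p p psi)) = comb (m1 p ^+ 3)
  (- a * (eta p * (m1 p ^+ 2 + m1 p * mu z1 p + mu z1 p ^+ 2)))
  (- a * (eta p ^+ 2 * (m1 p + 2 * mu z1 p))) (- a * eta p ^+ 3).
Proof.
do ?(rewrite ?(J1psi, J1f1, J1f2) ?(J1B, J1D, J1Z)).
by rewrite /comb; lmod_ring.
Qed.

Let J1_pair p q : J1 p p (J2 p p psi - J2 q q psi) + J1 q q (J2 p p psi - J2 q q psi)
  = comb ((m1 p + m1 q) * (m2 p - m2 q))
    (- a * ((m2 p - m2 q) * (eta p + eta q))
     - a ^+ 2 * ((eta p - eta q) * (mu z1 p + mu z1 q)))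
    (- a ^+ 2 * (eta p ^+ 2 - eta q ^+ 2)
     - a * ((eta p - eta q) * (mu z1 p + mu z1 q)))
    (- a * (eta p ^+ 2 - eta q ^+ 2)).
Proof.
have E r : J1 r r (J2 p p psi - J2 q q psi) = (m2 p - m2 q) *: J1 r r psi
   - (a ^+ 2 * (eta p - eta q)) *: J1 r r f1 - (a * (eta p - eta q)) *: J1 r r f2.
  rewrite !J2psi -!J1Z -!J1B; congr (J1 r r _).
  by lmod_ring.
rewrite !E !J1psi !J1f1 !J1f2 /comb; lmod_ring.
Qed.

Let sum_comb (u v x y : 'I_M -> F) : \sum_p comb (u p) (v p) (x p) (y p)
  = comb (\sum_p u p) (\sum_p v p) (\sum_p x p) (\sum_p y p).
Proof. by rewrite /comb !scaler_suml -!big_split. Qed.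

Let osum2_comb (u v x y : 'I_M -> 'I_M -> F) :
  osum2 (fun p q => comb (u p q) (v p q) (x p q) (y p q))
  = comb (osum2 u) (osum2 v) (osum2 x) (osum2 y).
Proof.
rewrite /osum2 -sum_comb; apply: eq_bigr => q _.
by rewrite /comb !scaler_suml -!big_split.
Qed.

Let osum3_comb (u v x y : 'I_M -> 'I_M -> 'I_M -> F) :
  osum3 (fun p q r => comb (u p q r) (v p q r) (x p q r) (y p q r))
  = comb (osum3 u) (osum3 v) (osum3 x) (osum3 y).
Proof.
rewrite /osum3 -sum_comb; apply: eq_bigr => r _; rewrite /comb !scaler_suml -!big_split.
by apply: eq_bigr => q _; rewrite /= !scaler_suml -!big_split.
Qed.

Let J3_triple p q r : J3 p p psi - 2 *: J3 q q psi + J3 r r psi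
  = comb (m3 p - 2 * m3 q + m3 r)
      (- a ^+ 3 * (eta p - 2 * eta q + eta r))
      (- a ^+ 2 * (eta p - 2 * eta q + eta r))
      (- a * (eta p - 2 * eta q + eta r)).
Proof. by rewrite !J3psi /comb; lmod_ring. Qed.

Let sigma := mu z1 n + mu z1 s.
Let sigma2 := mu z2 n + mu z2 s.
Let ell := cur_coroot lam n z1.
Let ell2 := cur_coroot lam n z2.
Let wt := pweight F (M := M).

Let cur_coroot_comb k l c d :
  cur_coroot lam n (fun i => k * c i + l * d i) = k * cur_coroot lam n c + l * cur_coroot lam n d.
Proof.
rewrite /cur_coroot !mulr_sumr -big_split; apply: eq_bigr => i _ /=; ring.
Qed.

(** The Bethe equation. *)
Let coroot_om : cur_coroot lam n om = 0.
Proof. by rewrite -bethe; apply: eq_bigr => i _; rewrite /om /zeta mulrC. Qed.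

Let eq_coroot c d : c =1 d -> cur_coroot lam n c = cur_coroot lam n d.
Proof. by move=> cd; apply: eq_bigr => i _; rewrite cd. Qed.

Let coroot1 : cur_coroot lam n (fun i => z1 i * om i) = - a * ell.
Proof. by rewrite (eq_coroot z1_om) cur_coroot_comb coroot_om mulr0 add0r. Qed.

Let coroot2 : cur_coroot lam n (fun i => z2 i * om i) = - a ^+ 2 * ell - a * ell2.
Proof.
rewrite (eq_coroot (d := fun i => 1 * (a ^+ 2 * om i + - a ^+ 2 * z1 i) + - a * z2 i)).
  by rewrite !cur_coroot_comb coroot_om -/ell -/ell2; ring.
by move=> i; rewrite z2_om mul1r.
Qed.

Let ns : (n == s) = false. Proof. by apply/negbTE; rewrite eq_sym ord_pred_neq. Qed.

Let eta_cube p : eta p ^+ 3 = eta p.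
Proof.
rewrite /eta /root_eps; have [->|_] := eqVneq p n; first by rewrite ns subr0 expr1n.
by case: (p == s); rewrite ?subr0 ?expr0n // sub0r exprS sqrrN expr1n mulr1.
Qed.

Let sum_eta x : \sum_p eta p * x p = x n - x s.
Proof. exact: sum_root_eps. Qed.

Let sum_eta2 x : \sum_p eta p ^+ 2 * x p = x n + x s.
Proof.
transitivity (\sum_p (x p * (p == n)%:R + x p * (p == s)%:R)); last first.
  by rewrite big_split /= !pick_ord.
apply: eq_bigr => p _; rewrite /eta /root_eps; have [->|_] := eqVneq p n.
  by rewrite ns /=; ring.
by case: (p == s) => /=; ring.
Qed.

Let sum0_eta : \sum_p eta p = 0.
Proof.
have := sum_eta (fun=> 1); rewrite subrr => E; rewrite -[RHS]E.
by apply: eq_bigr => p _; rewrite mulr1.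
Qed.

Let sum0_eta3 : \sum_p eta p ^+ 3 = 0.
Proof. by rewrite -[RHS]sum0_eta; apply: eq_bigr => p _; rewrite eta_cube. Qed.

Let sum0_mu c : \sum_p mu c p = 0.
Proof.
rewrite /cur_weight exchange_big big1 // => i _.
by rewrite -mulr_sumr sum_gl_weight // mulr0.
Qed.

Let osum3_eta k : osum3 (fun p q r => k * (eta p - 2 * eta q + eta r))
  = k * (3 / 4 * (wt n ^+ 2 - wt s ^+ 2)).
Proof.
transitivity (k * osum3 (fun p q r => eta p - 2 * eta q + eta r)).
  rewrite /osum3 mulr_sumr; apply: eq_bigr => r _; rewrite mulr_sumr.
  by apply: eq_bigr => q _; rewrite mulr_sumr.
rewrite osum3_coboundary // -(sum_eta (fun p => wt p ^+ 2)); congr (_ * (_ * _)).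
by apply: eq_bigr => p _; rewrite mulrC.
Qed.

(** The coefficients of the [f_k] in the diagonal part of the normal ordered
    operator. *)
Let coef_f1 : 2 * (\sum_p - a * (eta p * (m1 p ^+ 2 + m1 p * mu z1 p + mu z1 p ^+ 2)))
  + 3 * osum2 (fun p q => - a * ((m2 p - m2 q) * (eta p + eta q))
     - a ^+ 2 * ((eta p - eta q) * (mu z1 p + mu z1 q)))
  + 2 * osum3 (fun p q r => - a ^+ 3 * (eta p - 2 * eta q + eta r))
  = 3 * (- 2 * a * ((mu z1 n - mu z1 s) * sigma + a * sigma)
     - a * (wt n * mu z2 n - wt s * mu z2 s + sigma2 + a ^+ 2 * (wt n + wt s))
     - a ^+ 2 * (wt n * mu z1 n - wt s * mu z1 s - sigma)
     - a ^+ 3 / 2 * (wt n ^+ 2 - wt s ^+ 2)).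
Proof.
have E1 : \sum_p - a * (eta p * (m1 p ^+ 2 + m1 p * mu z1 p + mu z1 p ^+ 2))
   = - a * (3 * (mu z1 n ^+ 2 - mu z1 s ^+ 2) + 3 * a * sigma).
  transitivity (- a * (3 * (\sum_p eta p * mu z1 p ^+ 2)
    + 3 * a * (\sum_p eta p ^+ 2 * mu z1 p) + a ^+ 2 * (\sum_p eta p ^+ 3))).
    rewrite !mulr_sumr -!big_split mulr_sumr; apply: eq_bigr => p _ /=.
    by rewrite /m1; ring.
  by rewrite sum_eta sum_eta2 sum0_eta3 /sigma; ring.
have E2 : osum2 (fun p q => - a * ((m2 p - m2 q) * (eta p + eta q))
     - a ^+ 2 * ((eta p - eta q) * (mu z1 p + mu z1 q)))
  = - a * (wt n * mu z2 n - wt s * mu z2 s + sigma2 + a ^+ 2 * (wt n + wt s))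
     - a ^+ 2 * (wt n * mu z1 n - wt s * mu z1 s - sigma).
  pose X p := - a * (eta p * mu z2 p + a ^+ 2 * eta p ^+ 2) - a ^+ 2 * (eta p * mu z1 p).
  transitivity (osum2 (fun p q => X p - X q)
      + (a * apair eta (mu z2) + - a ^+ 2 * apair eta (mu z1))).
    rewrite -!apairZl /apair -!osum2D; apply: eq_osum2 => p q _.
    by rewrite /X /m2; ring.
  rewrite osum2_coboundary !apair_root_eps ?sum0_mu //.
  have -> : \sum_p pweight F p * X p = - a * ((\sum_p eta p * (wt p * mu z2 p))
      + a ^+ 2 * (\sum_p eta p ^+ 2 * wt p)) - a ^+ 2 * (\sum_p eta p * (wt p * mu z1 p)).
    rewrite !mulr_sumr -!big_split !mulr_sumr -sumrN -big_split; apply: eq_bigr => p _ /=.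
    by rewrite /X /wt; ring.
  by rewrite !sum_eta sum_eta2 /sigma /sigma2; ring.
have E3 : osum3 (fun p q r => - a ^+ 3 * (eta p - 2 * eta q + eta r))
  = - a ^+ 3 * (3 / 4 * (wt n ^+ 2 - wt s ^+ 2)).
  by rewrite osum3_eta.
by rewrite E1 E2 E3 /sigma; field.
Qed.

Let coef_f2 : 2 * (\sum_p - a * (eta p ^+ 2 * (m1 p + 2 * mu z1 p)))
  + 3 * osum2 (fun p q => - a ^+ 2 * (eta p ^+ 2 - eta q ^+ 2)
     - a * ((eta p - eta q) * (mu z1 p + mu z1 q)))
  + 2 * osum3 (fun p q r => - a ^+ 2 * (eta p - 2 * eta q + eta r))
  = 3 * (- 2 * a * sigma - a ^+ 2 * (wt n + wt s)
     - a * (wt n * mu z1 n - wt s * mu z1 s - sigma)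
     - a ^+ 2 / 2 * (wt n ^+ 2 - wt s ^+ 2)).
Proof.
have E1 : \sum_p - a * (eta p ^+ 2 * (m1 p + 2 * mu z1 p)) = - 3 * a * sigma.
  transitivity (- a * (3 * (\sum_p eta p ^+ 2 * mu z1 p) + a * (\sum_p eta p ^+ 3))).
    rewrite !mulr_sumr -!big_split mulr_sumr; apply: eq_bigr => p _ /=.
    by rewrite /m1; ring.
  by rewrite sum_eta2 sum0_eta3 /sigma; ring.
have E2 : osum2 (fun p q => - a ^+ 2 * (eta p ^+ 2 - eta q ^+ 2)
     - a * ((eta p - eta q) * (mu z1 p + mu z1 q)))
  = - a ^+ 2 * (wt n + wt s) - a * (wt n * mu z1 n - wt s * mu z1 s - sigma).
  pose X p := - a ^+ 2 * eta p ^+ 2 - a * (eta p * mu z1 p).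
  transitivity (osum2 (fun p q => X p - X q) + (- a * apair eta (mu z1))).
    rewrite -!apairZl /apair -!osum2D; apply: eq_osum2 => p q _.
    by rewrite /X; ring.
  rewrite osum2_coboundary !apair_root_eps ?sum0_mu //.
  have -> : \sum_p pweight F p * X p = - a ^+ 2 * (\sum_p eta p ^+ 2 * wt p)
      - a * (\sum_p eta p * (wt p * mu z1 p)).
    rewrite !mulr_sumr -sumrN -big_split; apply: eq_bigr => p _ /=.
    by rewrite /X /wt; ring.
  by rewrite !sum_eta sum_eta2 /sigma; ring.
have E3 : osum3 (fun p q r => - a ^+ 2 * (eta p - 2 * eta q + eta r))
  = - a ^+ 2 * (3 / 4 * (wt n ^+ 2 - wt s ^+ 2)).
  by rewrite osum3_eta.
by rewrite E1 E2 E3; field.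
Qed.

Let coef_f3 : 2 * (\sum_p - a * eta p ^+ 3)
  + 3 * osum2 (fun p q => - a * (eta p ^+ 2 - eta q ^+ 2))
  + 2 * osum3 (fun p q r => - a * (eta p - 2 * eta q + eta r))
  = 3 * (- a * (wt n + wt s) - a / 2 * (wt n ^+ 2 - wt s ^+ 2)).
Proof.
have -> : \sum_p - a * eta p ^+ 3 = 0 by rewrite -mulr_sumr sum0_eta3 mulr0.
have -> : osum2 (fun p q => - a * (eta p ^+ 2 - eta q ^+ 2)) = - a * (wt n + wt s).
  transitivity (osum2 (fun p q => - a * eta p ^+ 2 - - a * eta q ^+ 2)).
    by apply: eq_osum2 => p q _; ring.
  rewrite osum2_coboundary -(sum_eta2 wt) mulr_sumr; apply: eq_bigr => p _.
  by rewrite /wt; ring.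
by rewrite osum3_eta; field.
Qed.

Let wt_sE : (s < n)%N -> wt s = wt n + 2.
Proof.
move=> /ord_pred_ltn sn; rewrite /wt /pweight.
have -> : (n%:R : F) = s%:R + 1 by rewrite natr1 sn.
ring.
Qed.

Let wt_n0 : (s < n)%N = false -> [/\ wt n = M%:R - 1, wt s = - (M%:R - 1) & is0 n = 1%N].
Proof.
move=> sn; have n0 : n = 0%N :> nat.
  apply/eqP; apply: contraFT sn; rewrite -lt0n => n0.
  by have := ord_pred_succ n0; lia.
rewrite /is0 /= n0 /wt /pweight n0 (ord_pred_first n0) -subn1 natrB //.
by split=> //; ring.
Qed.

Let is0_lt : (s < n)%N -> is0 n = 0%N.
Proof. by rewrite /is0; case: (posnP n) => [-> | n0 _] //=; rewrite (gtn_eqF n0). Qed.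

Let phi := cur_level lam z1.

(** In colours [n > 0] the terms with the raising unit compensate the [f_k] of the
    diagonal part. In colour 0 the raising units kill the vector, and the
    [f_k] are compensated by the modes of degree 1 and, for the rest, form a
    twisted derivative. *)
Lemma cubic_root_vec : 3^-1 *: (\sum_i \sum_j \sum_k word3 J1 psi i j k) =
  cubic_symbol m1 m2 m3 *: psi
  + (is0 n)%:R *: ((2 * a * ell * sigma - 2 * a * phi * sigma
         - M%:R * (a ^+ 2 * sigma + a * sigma2)) *: f1
      - (M%:R * a * sigma) *: f2).
Proof.
rewrite (word3_sum J1J1 J1J2 (n := n) (x := psi) (v0 := vac)
  (k1 := mu (fun i => z1 i * om i) s - mu (fun i => z1 i * om i) n)
  (k2 := mu (fun i => z2 i * om i) s - mu (fun i => z2 i * om i) n)); first last.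
- by move=> p q pq; apply: cur_vac_raise.
- by move=> p q pq; rewrite [LHS]cur0_root_vec_raise.
- by move=> p q pq; rewrite [LHS]cur0_root_vec_raise.
under eq_bigr => p _ do rewrite J1_cube.
rewrite sum_comb.
have -> : osum2 (fun p q => J1 p p (J2 p p psi - J2 q q psi) + J1 q q (J2 p p psi - J2 q q psi))
  = osum2 (fun p q => comb ((m1 p + m1 q) * (m2 p - m2 q))
    (- a * ((m2 p - m2 q) * (eta p + eta q))
     - a ^+ 2 * ((eta p - eta q) * (mu z1 p + mu z1 q)))
    (- a ^+ 2 * (eta p ^+ 2 - eta q ^+ 2)
     - a * ((eta p - eta q) * (mu z1 p + mu z1 q)))
    (- a * (eta p ^+ 2 - eta q ^+ 2))).
  by apply: eq_osum2 => p q _; rewrite J1_pair.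
rewrite osum2_comb.
have -> : osum3 (fun p q r => J3 p p psi - 2 *: J3 q q psi + J3 r r psi)
  = osum3 (fun p q r => comb (m3 p - 2 * m3 q + m3 r)
      (- a ^+ 3 * (eta p - 2 * eta q + eta r))
      (- a ^+ 2 * (eta p - 2 * eta q + eta r))
      (- a * (eta p - 2 * eta q + eta r))).
  by apply: eq_osum3 => p q r _; rewrite J3_triple.
rewrite osum3_comb !cur_weight_coroot // coroot1 coroot2.
set K := (s < n)%:R *: _.
have n3 : (3 : F) != 0 by rewrite pnatr_eq0.
apply: (scalerI n3); rewrite scalerA mulfV // scale1r.
have E3 : 3 * cubic_symbol m1 m2 m3 = 2 * (\sum_p m1 p ^+ 3)
    + 3 * osum2 (fun p q => (m1 p + m1 q) * (m2 p - m2 q))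
    + 2 * osum3 (fun p q r => m3 p - 2 * m3 q + m3 r).
  by rewrite /cubic_symbol; field.
transitivity ((3 * cubic_symbol m1 m2 m3) *: psi + (
   (3 * (- 2 * a * ((mu z1 n - mu z1 s) * sigma + a * sigma)
     - a * (wt n * mu z2 n - wt s * mu z2 s + sigma2 + a ^+ 2 * (wt n + wt s))
     - a ^+ 2 * (wt n * mu z1 n - wt s * mu z1 s - sigma)
     - a ^+ 3 / 2 * (wt n ^+ 2 - wt s ^+ 2))) *: f1
   + (3 * (- 2 * a * sigma - a ^+ 2 * (wt n + wt s)
     - a * (wt n * mu z1 n - wt s * mu z1 s - sigma)
     - a ^+ 2 / 2 * (wt n ^+ 2 - wt s ^+ 2))) *: f2
   + (3 * (- a * (wt n + wt s) - a / 2 * (wt n ^+ 2 - wt s ^+ 2))) *: f3) + K).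
  rewrite E3 -coef_f1 -coef_f2 -coef_f3 /comb.
  set Q1 := \sum_p m1 p ^+ 3.
  move: K => K; lmod_ring.
have cw1 := cur_weight_coroot M_ge3 lam n z1; have cw2 := cur_weight_coroot M_ge3 lam n z2.
rewrite -/ell -/ell2 -/phi in cw1 cw2.
case sn : (s < n)%N; rewrite /K sn.
  have i0 := is0_lt sn; rewrite i0 !mul0r !subr0 in cw1 cw2 *.
  have sE : s%:R = n%:R - 1 :> F.
    by rewrite -[X in _ = X%:R - 1](ord_pred_ltn sn) -natr1 addrK.
  have hE : (M - n.+1)%:R - s%:R = wt n + 1.
    rewrite natrB ?ltn_ord // sE /wt /pweight -natr1; ring.
  have deg0 c : cur c (delta_mx n s) 0 vac = root_vec T n c by rewrite /root_vec i0.
  have v1 : J1 n s vac = f1 by exact: deg0.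
  have v2 : J2 n s vac = f2 by exact: deg0.
  have v3 p : J1 n s (J1 p p vac) = mu z1 p *: f1.
    by rewrite -v1 -(linearZ_LR (J1 n s)); congr (J1 n s _); apply: cur_vac_diag.
  rewrite hE !v3 v1 v2 (wt_sE sn) /sigma2 -cw1 -cw2 /sigma.
  have e k : k / 2 * (wt n ^+ 2 - (wt n + 2) ^+ 2) = - k * (2 * wt n + 2) by field.
  rewrite !e; have -> : true%:R = 1 :> F by [].
  by lmod_ring.
have [wn ws i0] := wt_n0 sn; rewrite i0 in cw1 *.
have -> : ell = mu z1 s - mu z1 n + phi by rewrite cw1; ring.
have e k : k / 2 * (wt n ^+ 2 - wt s ^+ 2) = 0 by rewrite wn ws; ring.
rewrite !e wn ws /sigma2 /sigma; have -> : false%:R = 0 :> F by [].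
by lmod_ring.
Qed.

Let sum_pick2 (p q : 'I_M) (H : 'I_M -> 'I_M -> T) :
  \sum_i \sum_k ((k == p) && (i == q))%:R *: H i k = H q p.
Proof.
rewrite (bigD1 q) //= [X in _ + X]big1 ?addr0 => [|i /negbTE iq].
  rewrite (bigD1 p) //= !eqxx scale1r big1 ?addr0 // => k /negbTE kp.
  by rewrite kp scale0r.
by rewrite big1 // => k _; rewrite iq andbF scale0r.
Qed.

(** The products containing a mode of degree 1 occur in colour 0 only. *)
Lemma mode1_root_vec :
  let K p q := cur z1 (delta_mx p q) in
  \sum_i \sum_j \sum_k (K i j (-1) (K j k 0 (K k i 1 psi))
    + K i j (-1) (K k i 0 (K j k 1 psi)))
  = ((is0 n)%:R * (- a * ell * sigma)) *: f1.
Proof.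
move=> K; pose k := (is0 n)%:R * (- a * ell).
have K1 p q : K p q 1 psi = ((p == s) && (q == n))%:R *: (k *: vac).
  by rewrite [LHS]cur1_root_vec // coroot1 scalerA; congr (_ *: _); rewrite /k; ring.
have KZ p q m c x : K p q m (c *: x) = c *: K p q m x by exact: linearZ_LR.
have [n0|n0] := posnP n; last first.
  have i0 : is0 n = 0%N by rewrite /is0 (gtn_eqF n0).
  have k0 : k = 0 by rewrite /k i0 mul0r.
  rewrite i0 mul0r scale0r big1 // => i _; rewrite big1 // => j _; rewrite big1 // => l _.
  by rewrite !K1 k0 scale0r !scaler0 /K !raddf0 addr0.
have i1 : is0 n = 1%N by rewrite /is0 /= n0.
have Kf : K n s (-1) vac = f1 by rewrite /f1 /root_vec i1.
have s_max (p : 'I_M) : p != s -> (p < s)%N.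
  move=> ps; have ps' : (nat_of_ord p != nat_of_ord s) by exact: ps.
  by have := ltn_ord p; have := ord_pred_first n0; lia.
have n_min (p : 'I_M) : p != n -> (n < p)%N by rewrite -val_eqE /= n0 lt0n.
have S1 : \sum_i \sum_j \sum_l K i j (-1) (K j l 0 (K l i 1 psi)) = (k * mu z1 s) *: f1.
  rewrite exchange_big (bigD1 s) //= [X in _ + X]big1 => [|j js].
    under eq_bigr => i _ do under eq_bigr => l _ do rewrite K1 !KZ.
    rewrite (sum_pick2 s n (fun i l => k *: K i s (-1) (K s l 0 vac))) addr0.
    by rewrite {2}/K cur_vac_diag // KZ Kf scalerA.
  under eq_bigr => i _ do under eq_bigr => l _ do rewrite K1 !KZ.
  rewrite (sum_pick2 s n (fun i l => k *: K i j (-1) (K j l 0 vac))).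
  by rewrite {2}/K cur_vac_raise ?s_max // /K raddf0 scaler0.
have S2 : \sum_i \sum_j \sum_l K i j (-1) (K l i 0 (K j l 1 psi)) = (k * mu z1 n) *: f1.
  rewrite (bigD1 n) //= [X in _ + X]big1 => [|j js].
    rewrite exchange_big; under eq_bigr => i _ do under eq_bigr => l _ do rewrite K1 !KZ.
    rewrite (sum_pick2 s n (fun i l => k *: K n l (-1) (K i n 0 vac))) addr0.
    by rewrite {2}/K cur_vac_diag // KZ Kf scalerA.
  rewrite exchange_big; under eq_bigr => i _ do under eq_bigr => l _ do rewrite K1 !KZ.
  rewrite (sum_pick2 s n (fun i l => k *: K j l (-1) (K i j 0 vac))).
  by rewrite {2}/K cur_vac_raise ?n_min // /K raddf0 scaler0.
transitivity ((k * mu z1 s) *: f1 + (k * mu z1 n) *: f1); last first.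
  by rewrite -scalerDl /k /sigma; congr (_ *: _); ring.
rewrite -S1 -S2 -big_split; apply: eq_bigr => i _; rewrite -big_split.
by apply: eq_bigr => j _; rewrite -big_split.
Qed.

(** The action of [q z] on the Bethe vector. The terms off the vector occur in
    colour 0 only, where the coefficients of [f1] and [f2] are those of the twisted
    derivative of [(a * sigma) *: f1]. *)
Lemma q_root_vec (A : finType) (I : A -> 'M[F]_M) : orthonormal_basis I ->
  q zs I z psi = cubic_symbol m1 m2 m3 *: psi
  + ((is0 n)%:R * M%:R) *: ((- a ^+ 2 * sigma - a * sigma2
        - 2 / M%:R * phi * (a * sigma)) *: f1 - (a * sigma) *: f2).
Proof.
move=> I_basis; rewrite (q_units M_gt0 zs I_basis); last exact: depth1_root_vec.
rewrite mode1_root_vec.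
rewrite [X in 3^-1 *: X + _](_ : _ = \sum_i \sum_j \sum_k word3 J1 psi i j k) //.
rewrite cubic_root_vec.
have Mn0 : (M%:R : F) != 0 by rewrite pnatr_eq0 -lt0n.
have e : M%:R * (- a ^+ 2 * sigma - a * sigma2 - 2 / M%:R * phi * (a * sigma))
  = - M%:R * (a ^+ 2 * sigma + a * sigma2) - 2 * phi * (a * sigma) by field.
transitivity (cubic_symbol m1 m2 m3 *: psi + (is0 n)%:R *:
  ((M%:R * (- a ^+ 2 * sigma - a * sigma2 - 2 / M%:R * phi * (a * sigma))) *: f1
   - (M%:R * (a * sigma)) *: f2)); last by lmod_ring.
by rewrite e; lmod_ring.
Qed.

End CubicOnOneRoot.

(** * Rational dependence on the spectral parameter *)

Section RationalCurrents.
Context (F : numFieldType) (N : nat) (zs : 'I_N -> F).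

Lemma has_rat_zpow i : has_rat (fun z => zpow zs z 1 i : F^o) (fun z => - zpow zs z 2 i : F^o).
Proof.
by apply: has_rat_ext (has_rat_inv (zs i)) _; apply: generically_true.
Qed.

Lemma has_rat_zpow2 i :
  has_rat (fun z => zpow zs z 2 i : F^o) (fun z => - 2 * zpow zs z 3 i : F^o).
Proof.
apply: has_rat_ext (has_rat_mul (has_rat_zpow i) (has_rat_zpow i)) _.
apply: generically_true => z; rewrite /zpow; split; first by rewrite expr1 -expr2.
by rewrite expr1; ring.
Qed.

Section Vectors.
Context (W : lmodType F) (v : 'I_N -> W).

Lemma has_rat_sum_zpow : has_rat (fun z => \sum_i zpow zs z 1 i *: v i)
  (fun z => - \sum_i zpow zs z 2 i *: v i).
Proof.
apply: has_rat_ext (has_rat_sum _ (fun i => has_rat_scalel (v i) (has_rat_zpow i))) _.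
apply: generically_true => z; split=> //.
by rewrite -sumrN; apply: eq_bigr => i _; rewrite scaleNr.
Qed.

Lemma has_rat_sum_zpow2 : has_rat (fun z => \sum_i zpow zs z 2 i *: v i)
  (fun z => - (2 *: \sum_i zpow zs z 3 i *: v i)).
Proof.
apply: has_rat_ext (has_rat_sum _ (fun i => has_rat_scalel (v i) (has_rat_zpow2 i))) _.
apply: generically_true => z; split=> //.
by rewrite scaler_sumr -sumrN; apply: eq_bigr => i _; rewrite mulNr scaleNr scalerA.
Qed.

End Vectors.
End RationalCurrents.

Section OneRootRational.
Context (F : numFieldType) (M N : nat) (M_ge3 : (3 <= M)%N).
Context (lam : 'I_N -> weight F M) (V : forall j, verma (lam j)).
Context (T : tensor_product V) (zs : 'I_N -> F) (n : 'I_M) (w : F).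
Let M_gt0 : (0 < M)%N. Proof. exact: leq_trans M_ge3. Qed.
Let Mn0 : (M%:R : F) != 0. Proof. by rewrite pnatr_eq0 -lt0n. Qed.
Local Notation s := (ord_pred n).

(** The diagonal coefficients of the Cartan currents on the Bethe vector and, up to
    a factor [(-1)^k k!], their [k]-th derivatives. *)
Definition root_weight k z p : F :=
  cur_weight lam (zpow zs z k.+1) p + (z - w)^-1 ^+ k.+1 * root_eps F n p.

Lemma twist_cur_level z : twist lam zs z = cur_level lam (zpow zs z 1).
Proof. by apply: eq_bigr => i _; rewrite mulrC. Qed.

Lemma has_rat_twist : has_rat (twist lam zs : F -> F^o)
  (fun z => - cur_level lam (zpow zs z 2) : F^o).
Proof.
apply: has_rat_ext (has_rat_sum_zpow zs (fun i => level (lam i) : F^o)) _.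
by apply: generically_true => z; rewrite twist_cur_level.
Qed.

Lemma has_rat_root_weight p :
  has_rat (fun z => root_weight 0 z p : F^o) (fun z => - root_weight 1 z p : F^o).
Proof.
have hw := has_rat_sum_zpow zs (fun i => gl_weight (lam i) p : F^o).
have ha := has_rat_scalel (root_eps F n p : F^o) (has_rat_inv w).
apply: has_rat_ext (has_rat_add hw ha) _; apply: generically_true => z; split=> //.
by rewrite /root_weight opprD; congr (_ + _); exact: mulNr.
Qed.

Lemma has_rat_root_weight1 p :
  has_rat (fun z => root_weight 1 z p : F^o) (fun z => - 2 * root_weight 2 z p : F^o).
Proof.
have hw := has_rat_sum_zpow2 zs (fun i => gl_weight (lam i) p : F^o).
have ha := has_rat_scalel (root_eps F n p : F^o) (has_rat_mul (has_rat_inv w) (has_rat_inv w)).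
apply: has_rat_ext (has_rat_add hw ha) _; apply: generically_true => z; split=> //.
rewrite /root_weight mulrDr; congr (_ + _); first by rewrite mulNr.
rewrite -[LHS]/((_ * _ + _ * _) * _); ring.
Qed.

Lemma has_rat_shift_primitive :
  has_rat (fun z => shift_primitive (root_weight 0 z) (root_weight 1 z) (twist lam zs z) : F^o)
    (fun z => shift_primitive' (root_weight 0 z) (root_weight 1 z) (root_weight 2 z)
       (twist lam zs z) (- cur_level lam (zpow zs z 2)) : F^o).
Proof.
have hsum (g g' : 'I_M -> F -> F^o) (k : 'I_M -> F) : (forall p, has_rat (g p) (g' p)) ->
    has_rat (fun z => \sum_p k p * g p z : F^o) (fun z => \sum_p k p * g' p z : F^o).
  by move=> hg; apply: has_rat_sum => p; apply: (has_rat_scaler (k p) (hg p)).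
have h1 := hsum _ _ (pweight F (M := M))
  (fun p => has_rat_mul (has_rat_root_weight p) (has_rat_root_weight p)).
have h2 := hsum _ _ (fun p => pweight F p ^+ 2) has_rat_root_weight1.
have h3 := hsum _ _ (fun p => pweight F p ^+ 2) has_rat_root_weight.
have := has_rat_add (has_rat_add (has_rat_scaler (- 2^-1) h1) (has_rat_scaler (- 4^-1) h2))
  (has_rat_scaler (4 * M%:R)^-1 (has_rat_mul has_rat_twist h3)).
move=> /has_rat_ext; apply; apply: generically_true => z.
have scE (b c : F) : b *: (c : F^o) = b * c by [].
split; rewrite !scE /shift_primitive /shift_primitive'.
  set S1 := \sum_p _; set S2 := \sum_p _; set S3 := \sum_p _.
  rewrite -[LHS]/(- 2^-1 * S1 + - 4^-1 * S2 + (4 * M%:R)^-1 * (twist lam zs z * S3)).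
  by field.
have -> : \sum_p pweight F p * (- root_weight 1 z p * root_weight 0 z p
      + root_weight 0 z p * - root_weight 1 z p)
    = - 2 * \sum_p pweight F p * (root_weight 0 z p * root_weight 1 z p).
  by rewrite mulr_sumr; apply: eq_bigr => p _; ring.
have -> : \sum_p pweight F p ^+ 2 * (- 2 * root_weight 2 z p)
    = - 2 * \sum_p pweight F p ^+ 2 * root_weight 2 z p.
  by rewrite mulr_sumr; apply: eq_bigr => p _; ring.
have -> : \sum_p pweight F p ^+ 2 * - root_weight 1 z p
    = - \sum_p pweight F p ^+ 2 * root_weight 1 z p.
  by rewrite -sumrN; apply: eq_bigr => p _; ring.
by field.
Qed.

End OneRootRational.

(** * Comparison with the Miura oper *)

Section MiuraComparison.
Context (F : numFieldType) (M N : nat) (M_ge3 : (3 <= M)%N).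
Context (lam : 'I_N -> weight F M) (zs : 'I_N -> F) (n : 'I_M) (w : F).
Let M_gt0 : (0 < M)%N. Proof. exact: leq_trans M_ge3. Qed.
Let Mn0 : (M%:R : F) != 0. Proof. by rewrite pnatr_eq0 -lt0n. Qed.
Local Notation rw := (root_weight lam zs n w).

Lemma sum_root_weight k z : \sum_p rw k z p = 0.
Proof.
rewrite big_split /= -mulr_sumr.
have -> : \sum_p root_eps F n p = 0.
  rewrite -[RHS](subrr 1) -(sum_root_eps n (fun=> 1)).
  by apply: eq_bigr => p _; rewrite mulr1.
rewrite mulr0 addr0 exchange_big big1 // => i _ /=.
by rewrite -mulr_sumr sum_gl_weight // mulr0.
Qed.

Lemma root_eps_pred i : root_eps F n (ord_pred i) - root_eps F n i = - (cartan i n)%:~R.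
Proof.
have -> : (cartan i n)%:~R = 2 * (i == n)%:R - (ordS i == n)%:R - (ord_pred i == n)%:R :> F.
  by rewrite /cartan !rmorphB rmorphM.
rewrite /root_eps (inj_eq (can_inj (@ord_predK M))) (can2_eq (@ordSK M) (@ord_predK M)).
by ring.
Qed.

Lemma pweight_pred (i : 'I_M) :
  pweight F (ord_pred i) - pweight F i = 2 - 2 * M%:R * (is0 i)%:R.
Proof.
rewrite /pweight /is0; have [i0|i0] := eqVneq (val i) 0%N.
  rewrite (ord_pred_first i0) (_ : (i : nat) = 0%N) // -subn1 natrB //=.
  by ring.
rewrite -lt0n in i0; have <- : (ord_pred i).+1%:R = i%:R :> F.
  by rewrite (ord_pred_succ i0).
by rewrite -natr1 mulr0; ring.
Qed.

(** The equation that characterizes, among sequences of sum 0, the differences met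
    on the side of the oper. *)
Lemma root_weight_pred z i :
  rho_shift (rw 0 z) (twist lam zs z) (ord_pred i) - rho_shift (rw 0 z) (twist lam zs z) i
  = - on_coroot (miura_u lam zs n w z) i - twist lam zs z / M%:R.
Proof.
have -> : - on_coroot (miura_u lam zs n w z) i
    = \sum_j (z - zs j)^-1 * on_coroot (lam j) i - (z - w)^-1 * (cartan i n)%:~R.
  rewrite /miura_u on_corootD -[X in - (X + _)]/(coroot_at i _) raddfN raddf_sum /=.
  rewrite /coroot_at opprD opprK; congr (_ + _).
    by apply: eq_bigr => j _; rewrite /on_coroot /= !mxE.
  by congr (- _); rewrite -on_coroot_alpha /on_coroot /= !mxE.
have -> : \sum_j (z - zs j)^-1 * on_coroot (lam j) i
    = cur_weight lam (zpow zs z 1) (ord_pred i) - cur_weight lam (zpow zs z 1) i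
      + (is0 i)%:R * twist lam zs z.
  rewrite /twist mulr_sumr -sumrB -big_split; apply: eq_bigr => j _ /=.
  by rewrite -mulrBr gl_weight_pred // /zpow /zeta expr1; ring.
have -> : (cartan i n)%:~R = - (root_eps F n (ord_pred i) - root_eps F n i) :> F.
  by rewrite root_eps_pred opprK.
rewrite /rho_shift /root_weight expr1.
have -> : pweight F (ord_pred i) = pweight F i + (2 - 2 * M%:R * (is0 i)%:R).
  by rewrite -pweight_pred addrC subrK.
set a := (z - w)^-1.
by field.
Qed.

Context (L : dual_affine F M) (B : L -> L -> F) (B_form : invariant_form B).
Context (p : nat -> L) (p_principal : principal_elements B p).
Context (v2 : ratfun F^o) (v2P : is_v2 p (miura_u lam zs n w) (twist lam zs) v2).

(** The symbol is the eigenvalue, up to a twisted derivative. *)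
Lemma cubic_symbol_v2 : exists g g' : F -> F^o, has_rat g g' /\
  generically (fun z => cubic_symbol (rw 0 z) (rw 1 z) (rw 2 z)
    = - (2 * M%:R * rf_eval v2 z) + (g' z - 2 / M%:R * twist lam zs z * g z)).
Proof.
have [x [x' [b [b' [hx hb hv]]]]] := is_v2_expansion M_ge3 B_form p_principal v2P.
pose y z i : F := rho_shift (rw 0 z) (twist lam zs z) i.
pose y' z i : F := rho_shift (fun i => - rw 1 z i) (- cur_level lam (zpow zs z 2)) i.
have hy i : has_rat (fun z => y z i : F^o) (fun z => y' z i : F^o).
  have h2 := has_rat_scaler (- (pweight F i / (2 * M%:R))) (has_rat_twist lam zs).
  apply: has_rat_ext (has_rat_add (has_rat_root_weight lam zs n w i) h2) _.
  have scE (c d : F) : c *: (d : F^o) = c * d by [].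
  apply: generically_true => z; rewrite !scE; split; rewrite /y /y' /rho_shift;
    by field.
have sy z : \sum_i y z i = 0.
  rewrite /y /rho_shift sumrB sum_root_weight sub0r -mulr_suml -mulr_suml.
  by rewrite sum_pweight !mul0r oppr0.
(* Both sides solve the same difference equation, so differ by a constant; they sum to 0. *)
have xy : generically (fun z => forall i, x i z = y z i).
  apply: generically_mono hv => z [hpred xsum _] i.
  pose D i := x i z - y z i.
  have Dc : forall q, D (ord_pred q) = D q.
    move=> q; apply/eqP; rewrite -subr_eq0 /D.
    have -> : x (ord_pred q) z - y z (ord_pred q) - (x q z - y z q)
      = (x (ord_pred q) z - x q z) - (y z (ord_pred q) - y z q) by ring.
    by rewrite hpred root_weight_pred subrr.
  have : \sum_q D q = 0 by rewrite sumrB xsum sy subrr.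
  rewrite (eq_bigr (fun=> D i)) => [|q _]; last exact: cyclic_const.
  rewrite sumr_const card_ord -mulr_natl => /eqP; rewrite mulf_eq0 (negbTE Mn0) /=.
  by rewrite subr_eq0 => /eqP.
have xy' : generically (fun z => forall i, x' i z = y' z i).
  apply: generically_all => i; apply: has_rat_uniq (hx i) _.
  apply: has_rat_ext (hy i) _; apply: generically_mono xy => z hxy.
  by split => //; rewrite hxy.
have hS := has_rat_shift_primitive M_ge3 lam zs n w.
have := has_rat_add hS (has_rat_scaler (- 2) hb); set g := fun z => _; set g' := fun z => _.
move=> hg; exists g, g'; split=> //.
apply: generically_mono (generically_and hv (generically_and xy xy')).
move=> z [[_ _ E] [hxy hxy']].
rewrite (cubic_symbol_shift M_gt0 (twist lam zs z) (- cur_level lam (zpow zs z 2)))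
  ?sum_root_weight // -/(y z) -/(y' z).
rewrite E /g /g'.
have -> : \sum_i x i z ^+ 3 = \sum_i y z i ^+ 3 by apply: eq_bigr => i _; rewrite hxy.
have -> : osum2 (fun i j => x i z * x' j z - x j z * x' i z) = apair (y z) (y' z).
  by apply: eq_osum2 => i j _; rewrite !hxy !hxy'.
have scE (c d : F) : c *: (d : F^o) = c * d by [].
by rewrite !scE; field.
Qed.

End MiuraComparison.

(** * The eigenvalue equation *)

Section BetheEigenvector.
Context (F : numFieldType) (M N : nat) (M_ge3 : (3 <= M)%N).
Context (lam : 'I_N -> weight F M) (V : forall j, verma (lam j)).
Context (T : tensor_product V) (zs : 'I_N -> F) (n : 'I_M) (w : F).
Context (w_neq_zs : forall j, w != zs j).
Context (bethe : 0 = \sum_j on_coroot (lam j) n / (w - zs j)).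
Context (A : finType) (I : A -> 'M[F]_M) (I_basis : orthonormal_basis I).
Context (L : dual_affine F M) (B : L -> L -> F) (B_form : invariant_form B).
Context (p : nat -> L) (p_principal : principal_elements B p).
Context (v2 : ratfun F^o) (v2P : is_v2 p (miura_u lam zs n w) (twist lam zs) v2).
Let M_gt0 : (0 < M)%N. Proof. exact: leq_trans M_ge3. Qed.
Local Notation psi := (bethe_vector T zs n w).

Lemma bethe_root_vec : psi = root_vec T n (zeta zs w).
Proof.
by rewrite /bethe_vector current_cur // tr_delta_mx eq_sym (negbTE (ord_pred_neq _ _)).
Qed.

(** The twisted primitive of the terms off the Bethe vector; it occurs in colour 0 only. *)
Let cross z : T := ((z - w)^-1 * (cur_weight lam (zpow zs z 1) n
  + cur_weight lam (zpow zs z 1) (ord_pred n))) *: root_vec T n (zpow zs z 1).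

(** The derivative of [cross]. *)
Let cross' z : T := (- (z - w)^-1 ^+ 2 * (cur_weight lam (zpow zs z 1) n
    + cur_weight lam (zpow zs z 1) (ord_pred n))
  - (z - w)^-1 * (cur_weight lam (zpow zs z 2) n
    + cur_weight lam (zpow zs z 2) (ord_pred n))) *: root_vec T n (zpow zs z 1)
  - ((z - w)^-1 * (cur_weight lam (zpow zs z 1) n
    + cur_weight lam (zpow zs z 1) (ord_pred n))) *: root_vec T n (zpow zs z 2).

Let has_rat_cross : has_rat cross cross'.
Proof.
have hm q := has_rat_sum_zpow zs (fun i => gl_weight (lam i) q : F^o).
have hf := has_rat_sum_zpow zs (fun i => tp_op T i (slpart (delta_mx n (ord_pred n)))
  (- (is0 n)%:Z) (vac T)).
have := has_rat_scale (has_rat_mul (has_rat_inv w) (has_rat_add (hm n) (hm (ord_pred n)))) hf.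
move/has_rat_ext; apply; apply: generically_true => z; split => //.
rewrite scalerN /cross'; congr (_ *: _ - _).
by rewrite -opprD mulrN.
Qed.

Theorem q_bethe_vector : exists e e' : F -> T, has_rat e e' /\
  generically (fun z => q zs I z psi = (- (2 * M%:R * rf_eval v2 z)) *: psi
    + (e' z - (2 / M%:R * twist lam zs z) *: e z)).
Proof.
have [g [g' [hg hsym]]] := cubic_symbol_v2 M_ge3 B_form p_principal v2P.
have := has_rat_add (has_rat_scalel psi hg) (has_rat_scaler ((is0 n)%:R * M%:R) has_rat_cross).
set e := fun z : F => _ *: _ + _; set e' := fun z : F => _ + _ => he; exists e, e'; split=> //.
have hzs := generically_all (fun j => generically_neq (zs j)).
apply: generically_mono (generically_and hsym (generically_and hzs (generically_neq w))).
move=> z [hz [z_zs z_w]].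
rewrite bethe_root_vec (q_root_vec M_ge3 T w_neq_zs z_zs z_w (esym bethe) I_basis).
cbv zeta; rewrite [cubic_symbol _ _ _]hz -bethe_root_vec /e /e' /cross /cross'.
rewrite -twist_cur_level.
lmod_ring.
Qed.

End BetheEigenvector.

(** * Regularity away from the punctures *)

Section RegularOff.
Context (F : numFieldType) (N : nat) (zs : 'I_N -> F).

(** The product of the [X - zs j]. *)
Definition pole_poly : {poly F} := \prod_j ('X - (zs j)%:P).

Lemma pole_poly_neq0 z : (forall j, z != zs j) -> pole_poly.[z] != 0.
Proof.
move=> hz; rewrite horner_prod; apply/prodf_neq0 => j _.
by rewrite hornerXsubC subr_eq0.
Qed.

(** Vector-valued rational functions without poles off the points [zs j]. *)
Definition regular_off (W : lmodType F) (f : F -> W) : Prop :=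
  exists k s, forall z, (forall j, z != zs j) -> f z = (pole_poly.[z] ^+ k)^-1 *: lin_eval s z.

Section Closure.
Context (W : lmodType F).
Implicit Types f g : F -> W.

Lemma regular_off_const (v : W) : regular_off (fun=> v).
Proof.
exists 0%N, [:: (1%:P, v)] => z _.
by rewrite /lin_eval big_seq1 hornerC expr0 invr1 !scale1r.
Qed.

Lemma regular_off_add f g :
  regular_off f -> regular_off g -> regular_off (fun z => f z + g z).
Proof.
move=> [k [s hs]] [l [t ht]].
exists (k + l)%N, (lin_mul (pole_poly ^+ l) s ++ lin_mul (pole_poly ^+ k) t) => z hz.
have D0 := pole_poly_neq0 hz.
rewrite hs // ht // lin_eval_cat !lin_eval_mul !horner_exp scalerDr !scalerA.
have ha : pole_poly.[z] ^+ k != 0 by rewrite expf_neq0.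
have hb : pole_poly.[z] ^+ l != 0 by rewrite expf_neq0.
rewrite exprD; set a := _ ^+ k in ha *; set b := _ ^+ l in hb *.
by congr (_ *: _ + _ *: _); field; rewrite ha hb.
Qed.

Lemma regular_off_sum (J : Type) (r : seq J) (f : J -> F -> W) :
  (forall j, regular_off (f j)) -> regular_off (fun z => \sum_(j <- r) f j z).
Proof.
move=> hf; elim: r => [|j r [k [s hs]]].
  have [k [s hs]] := regular_off_const 0; exists k, s => z hz.
  by rewrite big_nil; exact: hs.
have [l [t ht]] := regular_off_add (hf j) (ex_intro _ k (ex_intro _ s hs)).
by exists l, t => z hz; rewrite big_cons ht.
Qed.

Lemma regular_off_zeta i f : regular_off f -> regular_off (fun z => zeta zs z i *: f z).
Proof.
move=> [k [s hs]].
exists k.+1, (lin_mul (\prod_(j < N | j != i) ('X - (zs j)%:P)) s) => z hz.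
rewrite hs // lin_eval_mul !scalerA; congr (_ *: _).
have zi : z - zs i != 0 by rewrite subr_eq0.
have rest : (\prod_(j < N | j != i) ('X - (zs j)%:P)).[z] != 0.
  rewrite horner_prod; apply/prodf_neq0 => j _.
  by rewrite hornerXsubC subr_eq0.
have -> : pole_poly.[z] ^+ k.+1 = pole_poly.[z] ^+ k * (z - zs i)
    * (\prod_(j < N | j != i) ('X - (zs j)%:P)).[z].
  rewrite exprSr -mulrA; congr (_ * _).
  by rewrite /pole_poly (bigD1 i) //= hornerM hornerXsubC.
have Dk : pole_poly.[z] ^+ k != 0 by rewrite expf_neq0 // pole_poly_neq0.
rewrite /zeta; set d := _ ^+ k in Dk *.
by field; rewrite rest zi Dk.
Qed.

End Closure.

Lemma regular_off_linear (W W' : lmodType F) (l : {linear W -> W'}) (f : F -> W) :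
  regular_off f -> regular_off (fun z => l (f z)).
Proof.
move=> [k [s hs]]; exists k, [seq (pv.1, l pv.2) | pv <- s] => z hz.
rewrite hs // linearZ_LR; congr (_ *: _).
rewrite /lin_eval big_map linear_sum; apply: eq_bigr => pv _.
by rewrite linearZ_LR.
Qed.

Lemma regular_off_scale (W : lmodType F) (a : F) (f : F -> W) :
  regular_off f -> regular_off (fun z => a *: f z).
Proof. exact: (regular_off_linear (GRing.scale a)). Qed.

Lemma regular_off_poly (f : F -> F^o) : regular_off f ->
  exists k (P : {poly F}), forall z, (forall j, z != zs j) -> f z = P.[z] / pole_poly.[z] ^+ k.
Proof.
move=> [k [s hs]]; exists k, (\sum_(pv <- s) pv.1 * (pv.2 : F)%:P) => z hz.
rewrite hs // [RHS]mulrC; congr (_ * _); rewrite /lin_eval horner_sum.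
by apply: eq_bigr => pv _; rewrite hornerM hornerC.
Qed.

End RegularOff.

Section RegularCurrents.
Context (F : numFieldType) (M N : nat) (M_ge3 : (3 <= M)%N).
Context (lam : 'I_N -> weight F M) (V : forall j, verma (lam j)).
Context (T : tensor_product V) (zs : 'I_N -> F).
Let M_gt0 : (0 < M)%N. Proof. exact: leq_trans M_ge3. Qed.

Lemma regular_off_cur X m (f : F -> T) : regular_off zs f ->
  regular_off zs (fun z => cur (zeta zs z) X m (f z)).
Proof.
move=> hf; apply: regular_off_sum => i; apply: regular_off_zeta.
exact: (regular_off_linear (tp_op T i (slpart X) m)).
Qed.

Lemma regular_off_q (A : finType) (I : A -> 'M[F]_M) n c : orthonormal_basis I ->
  regular_off zs (fun z => q zs I z (root_vec T n c)).
Proof.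
move=> I_basis.
suff [k [s hs]] : regular_off zs (fun z => let J p r := cur (zeta zs z) (delta_mx p r) in
    let x := root_vec T n c in
  3^-1 *: (\sum_i \sum_j \sum_k
    (J i j 0 (J j k 0 (J k i 0 x)) + J i j 0 (J k i 0 (J j k 0 x))))
  + 2 *: (\sum_i \sum_j \sum_k
    (J i j (-1) (J j k 0 (J k i 1 x)) + J i j (-1) (J k i 0 (J j k 1 x))))).
  by exists k, s => z hz; rewrite -hs // (q_units M_gt0 zs I_basis) //; exact: depth1_root_vec.
have h3 X Y Z m m' m'' : regular_off zs (fun z => cur (zeta zs z) X m
    (cur (zeta zs z) Y m' (cur (zeta zs z) Z m'' (root_vec T n c)))).
  by do 3!apply: regular_off_cur; exact: regular_off_const.
have hs (G : 'I_M -> 'I_M -> 'I_M -> F -> T) : (forall i j k, regular_off zs (G i j k)) ->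
    regular_off zs (fun z => \sum_i \sum_j \sum_k G i j k z).
  move=> hG; apply: (@regular_off_sum _ _ zs T _ _ (fun i z => \sum_j \sum_k G i j k z)) => i.
  apply: (@regular_off_sum _ _ zs T _ _ (fun j z => \sum_k G i j k z)) => j.
  exact: (@regular_off_sum _ _ zs T _ _ (fun k z => G i j k z)).
pose J z p r : int -> T -> T := cur (zeta zs z) (delta_mx p r).
pose x := root_vec T n c.
apply: (regular_off_add (regular_off_scale 3^-1 (hs (fun i j k z =>
    J z i j 0 (J z j k 0 (J z k i 0 x)) + J z i j 0 (J z k i 0 (J z j k 0 x))) _))
  (regular_off_scale 2 (hs (fun i j k z =>
    J z i j (-1) (J z j k 0 (J z k i 1 x)) + J z i j (-1) (J z k i 0 (J z j k 1 x))) _))).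
  by move=> i j k; apply: regular_off_add; apply: h3.
by move=> i j k; apply: regular_off_add; apply: h3.
Qed.

End RegularCurrents.

(** * Poles of solutions of first order equations *)

Section PoleCancellation.
Context (F : numFieldType).

(** A rational function that solves, off finitely many points, a first order
    differential equation with regular coefficients is regular: its derivative would
    have a pole of higher order. Denominators have been cleared, [K] collecting those
    of the equation. *)
Lemma rational_solution_regular (K S T : {poly F}) (e : ratfun F^o) :
  generically (fun z => K.[z] * rf_deriv e z = S.[z] + T.[z] * rf_eval e z) ->
  exists e' : ratfun F^o, (forall z, K.[z] != 0 -> (rf_den e').[z] != 0) /\
    forall z, K.[z] != 0 -> K.[z] * rf_deriv e' z = S.[z] + T.[z] * rf_eval e' z.
Proof.
have [m] := ubnP (size (rf_den e)); elim: m e => // m IH e.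
rewrite ltnS => em he.
set P := rf_poly e; set Q := rf_den e.
have Q0 : Q != 0 := rf_den_neq0 e.
have E : K * (P^`() * Q - P * Q^`()) = S * Q ^+ 2 + T * P * Q.
  apply: generically_horner_eq.
  apply: generically_mono (generically_and he (generically_nonroot Q0)).
  move=> z [+ z0]; rewrite rf_deriv_poly rf_eval_poly -/P -/Q => h.
  rewrite !(hornerM, hornerD, hornerN, horner_exp).
  transitivity (K.[z] * ((P^`().[z] * Q.[z] - P.[z] * Q^`().[z]) / Q.[z] ^+ 2) * Q.[z] ^+ 2).
    by field.
  by rewrite h; field.
have [[x [Kx Qx]]|noroot] := pselect (exists x, K.[x] != 0 /\ Q.[x] = 0); last first.
  have Qn z : K.[z] != 0 -> Q.[z] != 0.
    by move=> Kz; apply: contra_notN noroot => /eqP Qz; exists z.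
  exists e; split=> // z Kz; have Qz := Qn z Kz.
  rewrite rf_deriv_poly rf_eval_poly -/P -/Q.
  have := congr1 (fun p => p.[z]) E.
  rewrite !(hornerM, hornerD, hornerN, horner_exp) => h.
  transitivity (K.[z] * (P^`().[z] * Q.[z] - P.[z] * Q^`().[z]) / Q.[z] ^+ 2).
    by field.
  by rewrite h; field.
have [k [Q1 Q1x Qk]] := multiplicity_XsubC Q x.
rewrite Q0 /= in Q1x.
case: k Qk => [|k] Qk.
  by move: Q1x; rewrite /root -[Q1]mulr1 -(expr0 ('X - x%:P)) -Qk Qx eqxx.
have Px : P.[x] = 0.
  have X0 : ('X - x%:P) ^+ k != 0 by rewrite expf_neq0 // polyXsubC_eq0.
  have [R E3] : exists R : {poly F}, K * (P^`() * Q1 * ('X - x%:P)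
      - P * (Q1^`() * ('X - x%:P) + Q1 *+ k.+1)) = R * ('X - x%:P).
    (* Divided by the common power of X - x, all terms but one are multiples of X - x. *)
    have key (a b c d h f g s t y : {poly F}) :
        a * (b * (c * (d * h)) - f * (g * (d * h) + c * (h * y)))
        = s * (c * (d * h)) ^+ 2 + t * f * (c * (d * h)) ->
        h * (a * (b * c * d - f * (g * d + c * y)))
        = h * ((s * c ^+ 2 * (d * h) + t * f * c) * d).
      move=> E2; transitivity (a * (b * (c * (d * h)) - f * (g * (d * h) + c * (h * y)))).
        by ring.
      by rewrite E2; ring.
    exists (S * Q1 ^+ 2 * (('X - x%:P) * ('X - x%:P) ^+ k) + T * P * Q1).
    apply: (mulfI X0); rewrite -(mulr_natr Q1); apply: key; rewrite -exprS -Qk.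
    rewrite mulr_natr -E; congr (_ * (_ - _ * _)).
    by rewrite [in RHS]Qk derivM deriv_exp derivXsubC mul1r.
  have := congr1 (fun p => p.[x]) E3.
  rewrite !(hornerM, hornerD, hornerN, hornerMn, hornerX, hornerC) subrr !mulr0 !add0r => /eqP.
  rewrite mulrN oppr_eq0 !mulf_eq0 (negbTE Kx) mulrn_eq0 /= => /orP[/eqP //|].
  by rewrite (rootPf Q1x).
(* The numerator vanishes where the denominator does: cancel a common factor. *)
have [P1 P1E] : exists P1, P = P1 * ('X - x%:P) by apply/factor_theorem/rootP.
have Q2E : Q = (Q1 * ('X - x%:P) ^+ k) * ('X - x%:P) by rewrite Qk exprSr mulrA.
move: (Q1 * _) Q2E => Q2 Q2E.
have Q20 : Q2 != 0 by apply: contraNneq Q0 => Q20; rewrite Q2E Q20 mul0r.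
pose e2 := @RatFun F F^o [:: (P1, 1)] Q2 Q20.
have P1e2 : rf_poly e2 = P1 by rewrite /rf_poly big_seq1 mulr1.
apply: (IH e2).
  apply: leq_trans em; rewrite -/Q Q2E (size_Mmonic Q20 (monicXsubC x)).
  by rewrite (size_XsubC x) addn2.
apply: generically_mono (generically_and he
  (generically_and (generically_nonroot Q0) (generically_neq x))).
move=> z [+ [Qz zx]]; rewrite !rf_deriv_poly !rf_eval_poly P1e2 -/P -/Q /= P1E.
move: Qz; rewrite Q2E !derivM derivXsubC !(hornerM, hornerD, hornerN, hornerX, hornerC).
rewrite mulf_eq0 negb_or => /andP[Q2z _].
have zx0 : z - x != 0 by rewrite subr_eq0.
move=> E2; transitivity (S.[z] + T.[z] * (P1.[z] * (z - x) / (Q2.[z] * (z - x)))).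
  by rewrite -E2; field; rewrite Q2z zx0.
by congr (_ + _ * _); field; rewrite Q2z zx0.
Qed.

End PoleCancellation.

(** * The eigenvalue equation under a linear form *)

Section ScalarEquation.
Context (F : numFieldType) (M N : nat) (M_ge3 : (3 <= M)%N).
Context (lam : 'I_N -> weight F M) (V : forall j, verma (lam j)).
Context (T : tensor_product V) (zs : 'I_N -> F) (n : 'I_M) (w : F).
Context (w_neq_zs : forall j, w != zs j).
Context (bethe : 0 = \sum_j on_coroot (lam j) n / (w - zs j)).
Context (A : finType) (I : A -> 'M[F]_M) (I_basis : orthonormal_basis I).
Context (L : dual_affine F M) (B : L -> L -> F) (B_form : invariant_form B).
Context (p : nat -> L) (p_principal : principal_elements B p).
Context (v2 : ratfun F^o) (v2P : is_v2 p (miura_u lam zs n w) (twist lam zs) v2).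
Local Notation psi := (bethe_vector T zs n w).

Lemma regular_off_twist : regular_off zs (twist lam zs : F -> F^o).
Proof.
have [k [s hs]] := @regular_off_sum _ _ zs F^o _ (index_enum 'I_N)
  (fun i z => zeta zs z i *: (level (lam i) : F^o))
  (fun i => regular_off_zeta i (regular_off_const zs (level (lam i) : F^o))).
exists k, s => z hz; rewrite -hs //; apply: eq_bigr => i _.
exact: mulrC.
Qed.

(** Since [q z] is regular away from the punctures, the rational function [E] can
    be taken regular wherever [v2] is. *)
Lemma q_bethe_scalar (l : {scalar T}) : exists E : ratfun F^o, forall z,
  (forall j, z != zs j) -> (rf_den v2).[z] != 0 ->
  (rf_den E).[z] != 0 /\
  l (q zs I z psi) = - (2 * M%:R * rf_eval v2 z) * l psi
    + (rf_deriv E z - 2 / M%:R * twist lam zs z * rf_eval E z).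
Proof.
have [e [e' [[er her] hq]]] := q_bethe_vector M_ge3 T w_neq_zs bethe I_basis B_form
  p_principal v2P.
have [k [P hP]] : exists k (P : {poly F}), forall z, (forall j, z != zs j) ->
    l (q zs I z psi) = P.[z] / (pole_poly zs).[z] ^+ k.
  apply: (@regular_off_poly _ _ zs (fun z => l (q zs I z psi))).
  rewrite bethe_root_vec //.
  exact: (regular_off_linear l (regular_off_q M_ge3 T zs n _ I_basis)).
have [k' [P' hP']] := regular_off_poly regular_off_twist.
pose D := pole_poly zs; pose K := D ^+ k * D ^+ k' * rf_den v2.
pose S := P * D ^+ k' * rf_den v2
  + (2 * M%:R * l psi) *: (rf_poly v2 * D ^+ k * D ^+ k').
pose U := (2 / M%:R) *: (P' * D ^+ k * rf_den v2).
have Kn z : (forall j, z != zs j) -> (rf_den v2).[z] != 0 ->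
    [/\ K.[z] = D.[z] ^+ k * D.[z] ^+ k' * (rf_den v2).[z], D.[z] ^+ k != 0,
     D.[z] ^+ k' != 0 & K.[z] != 0].
  move=> hz dz; have D0 := pole_poly_neq0 hz.
  by rewrite /K !hornerM !horner_exp !mulf_neq0 ?expf_neq0.
have eqv z y y' : (forall j, z != zs j) -> (rf_den v2).[z] != 0 ->
    (K.[z] * y' = S.[z] + U.[z] * y) <->
    (l (q zs I z psi) = - (2 * M%:R * rf_eval v2 z) * l psi
      + (y' - 2 / M%:R * twist lam zs z * y)).
  move=> hz dz; have [KE a0 b0 K0] := Kn z hz dz.
  have SE : S.[z] / K.[z] = l (q zs I z psi) + 2 * M%:R * rf_eval v2 z * l psi.
    rewrite hP // rf_eval_poly KE /S hornerD hornerZ !hornerM !horner_exp -/D.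
    set a := _ ^+ k in a0 *; set b := _ ^+ k' in b0 *.
    by field; rewrite a0 b0 dz.
  have UE : U.[z] / K.[z] = 2 / M%:R * twist lam zs z.
    rewrite [twist _ _ _]hP' // KE /U hornerZ !hornerM !horner_exp -/D.
    set a := _ ^+ k in a0 *; set b := _ ^+ k' in b0 *; set c := 2 / M%:R.
    by field; rewrite a0 b0 dz.
  rewrite -UE; have -> : l (q zs I z psi) = S.[z] / K.[z] - 2 * M%:R * rf_eval v2 z * l psi.
    by rewrite SE addrK.
  split=> [h|/eqP].
    have -> : y' = (S.[z] + U.[z] * y) / K.[z] by rewrite -h mulrC mulKf.
    by field.
  rewrite -subr_eq0 => /eqP h; apply/eqP; rewrite -subr_eq0; apply/eqP.
  transitivity (- K.[z] * (S.[z] / K.[z] - 2 * M%:R * rf_eval v2 z * l psi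
    - (- (2 * M%:R * rf_eval v2 z) * l psi + (y' - U.[z] / K.[z] * y)))).
    by field.
  by rewrite h mulr0.
have [|E [E0 E1]] := @rational_solution_regular _ K S U (rf_map l er).
  have hzs := generically_all (fun j => generically_neq (zs j)).
  apply: generically_mono (generically_and (generically_and her hq)
    (generically_and hzs (generically_nonroot (rf_den_neq0 v2)))).
  move=> z [[[he he'] h] [hz dz]].
  have [_ X] := eqv z (rf_eval (rf_map l er) z) (rf_deriv (rf_map l er) z) hz dz; apply: X.
  have -> : rf_eval (rf_map l er) z = l (e z) by rewrite -he; apply: rf_eval_map.
  have -> : rf_deriv (rf_map l er) z = l (e' z) by rewrite -he'; apply: rf_deriv_map.
  have lB x y : l (x - y) = l x - l y by apply: linearB.
  have lZ a x : l (a *: x) = a * l x by apply: linearZ.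
  rewrite h -[l (_ + _)]/(l (_ + _)) -lZ -lZ -lB.
  exact: linearD.
exists E => z hz dz; have [_ _ _ K0] := Kn z hz dz; split; first exact: E0.
have [X _] := eqv z (rf_eval E z) (rf_deriv E z) hz dz; apply: X; exact: E1.
Qed.

End ScalarEquation.

(** * Complex-valued functions of a real variable *)

Section ComplexLimits.
Context (R : realType).
Local Open Scope classical_set_scope.
Local Open Scope ring_scope.
Implicit Types (x y l k d e : R[i]) (t s : R) (f g : R -> R[i]).
Local Notation Re := complex.Re.
Local Notation Im := complex.Im.

Lemma complex_ext x y : Re x = Re y -> Im x = Im y -> x = y.
Proof. by case: x y => [a b] [c d] /= -> ->. Qed.

Lemma cReD x y : Re (x + y) = Re x + Re y. Proof. by case: x y => [? ?] [? ?]. Qed.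
Lemma cImD x y : Im (x + y) = Im x + Im y. Proof. by case: x y => [? ?] [? ?]. Qed.
Lemma cReN x : Re (- x) = - Re x. Proof. by case: x. Qed.
Lemma cImN x : Im (- x) = - Im x. Proof. by case: x. Qed.
Lemma cReM x y : Re (x * y) = Re x * Re y - Im x * Im y.
Proof. by case: x y => [? ?] [? ?]. Qed.
Lemma cImM x y : Im (x * y) = Re x * Im y + Im x * Re y.
Proof. by case: x y => [? ?] [? ?]. Qed.
Lemma cReV x : Re x^-1 = Re x / (Re x ^+ 2 + Im x ^+ 2). Proof. by case: x. Qed.
Lemma cImV x : Im x^-1 = - (Im x / (Re x ^+ 2 + Im x ^+ 2)). Proof. by case: x. Qed.

Lemma sqr_norm_neq0 x : x != 0 -> Re x ^+ 2 + Im x ^+ 2 != 0.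
Proof.
case: x => a b /=; rewrite eq_complex /= negb_and => ab.
by rewrite paddr_eq0 ?sqr_ge0 // !sqrf_eq0 negb_and.
Qed.

(** Limits of complex-valued functions, componentwise. *)
Definition ccvg (G : set_system R) f l : Prop :=
  (fun t => Re (f t)) @ G --> Re l /\ (fun t => Im (f t)) @ G --> Im l.

Section Limits.
Context (G : set_system R) {FG : Filter G}.

Lemma ccvg_const l : ccvg G (fun=> l) l.
Proof. by split; exact: cvg_cst. Qed.

Lemma ccvgD f g l k : ccvg G f l -> ccvg G g k -> ccvg G (fun t => f t + g t) (l + k).
Proof.
move=> [fr fi] [gr gi]; rewrite /ccvg cReD cImD.
under eq_fun do rewrite cReD; under [X in X @ _ --> _ + Im k]eq_fun do rewrite cImD.
by split; exact: cvgD.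
Qed.

Lemma ccvgM f g l k : ccvg G f l -> ccvg G g k -> ccvg G (fun t => f t * g t) (l * k).
Proof.
move=> [fr fi] [gr gi]; rewrite /ccvg cReM cImM.
split.
  by under eq_fun do rewrite cReM; apply: cvgB; exact: cvgM.
by under eq_fun do rewrite cImM; apply: cvgD; exact: cvgM.
Qed.

Lemma ccvgV f l : l != 0 -> ccvg G f l -> ccvg G (fun t => (f t)^-1) l^-1.
Proof.
move=> l0 [fr fi]; have n0 := sqr_norm_neq0 l0; rewrite /ccvg cReV cImV.
have hn : (fun t => (Re (f t) ^+ 2 + Im (f t) ^+ 2)^-1) @ G --> (Re l ^+ 2 + Im l ^+ 2)^-1.
  by apply: cvgV => //; rewrite !expr2; apply: cvgD; exact: cvgM.
split.
  by under eq_fun do rewrite cReV; exact: cvgM.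
by under eq_fun do rewrite cImV; apply: cvgN; exact: cvgM.
Qed.

Lemma ccvg_cexp f l : ccvg G f l -> ccvg G (fun t => cexp (f t)) (cexp l).
Proof.
move=> [fr fi]; split; apply: cvgM.
- by apply: continuous_cvg fr; exact: continuous_expR.
- by apply: continuous_cvg fi; exact: continuous_cos.
- by apply: continuous_cvg fr; exact: continuous_expR.
- by apply: continuous_cvg fi; exact: continuous_sin.
Qed.

Lemma ccvg_sum (J : Type) (r : seq J) (f : J -> R -> R[i]) (l : J -> R[i]) :
  (forall j, ccvg G (f j) (l j)) ->
  ccvg G (fun t => \sum_(j <- r) f j t) (\sum_(j <- r) l j).
Proof.
move=> hf; elim: r => [|j r IH].
  rewrite big_nil (_ : (fun t => _) = fun=> 0); first exact: ccvg_const.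
  by apply/funext => t; rewrite big_nil.
rewrite big_cons (_ : (fun t => _) = fun t => f j t + \sum_(j <- r) f j t).
  exact: ccvgD.
by apply/funext => t; rewrite big_cons.
Qed.

Lemma ccvg_horner (P : {poly R[i]}) f l : ccvg G f l -> ccvg G (fun t => P.[f t]) P.[l].
Proof.
move=> hf; elim/poly_ind: P => [|P c IH].
  rewrite horner0 (_ : (fun t => _) = fun=> 0); first exact: ccvg_const.
  by apply/funext => t; rewrite horner0.
rewrite hornerMXaddC (_ : (fun t => _) = fun t => P.[f t] * f t + c).
  by apply: ccvgD; [exact: ccvgM|exact: ccvg_const].
by apply/funext => t; rewrite hornerMXaddC.
Qed.

End Limits.

(** The derivative of a complex-valued function of a real variable. *)
Definition cis_derive f t (d : R[i]) : Prop :=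
  is_derive t 1 (fun s => Re (f s)) (Re d) /\ is_derive t 1 (fun s => Im (f s)) (Im d).

Lemma cis_derive_const c t : cis_derive (fun=> c) t 0.
Proof. by split; exact: is_derive_cst. Qed.

Lemma cis_deriveD f g t d e :
  cis_derive f t d -> cis_derive g t e -> cis_derive (fun s => f s + g s) t (d + e).
Proof.
move=> [fr fi] [gr gi]; rewrite /cis_derive cReD cImD; split.
  by rewrite (_ : (fun s => _) = (fun s => Re (f s)) + (fun s => Re (g s)));
    [exact: is_deriveD|apply/funext => s; exact: cReD].
by rewrite (_ : (fun s => _) = (fun s => Im (f s)) + (fun s => Im (g s)));
  [exact: is_deriveD|apply/funext => s; exact: cImD].
Qed.

Lemma cis_deriveM f g t d e : cis_derive f t d -> cis_derive g t e ->
  cis_derive (fun s => f s * g s) t (d * g t + f t * e).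
Proof.
move=> [fr fi] [gr gi]; split.
  rewrite (_ : (fun s => _) = (fun s => Re (f s)) * (fun s => Re (g s))
    - (fun s => Im (f s)) * (fun s => Im (g s))); last by apply/funext => s; exact: cReM.
  apply: (is_derive_eq (is_deriveB (is_deriveM fr gr) (is_deriveM fi gi))).
  by rewrite !(cReD, cReM) /GRing.scale /=; ring.
rewrite (_ : (fun s => _) = (fun s => Re (f s)) * (fun s => Im (g s))
  + (fun s => Im (f s)) * (fun s => Re (g s))); last by apply/funext => s; exact: cImM.
apply: (is_derive_eq (is_deriveD (is_deriveM fr gi) (is_deriveM fi gr))).
by rewrite !(cImD, cImM) /GRing.scale /=; ring.
Qed.

Lemma cis_deriveV f t d : f t != 0 -> cis_derive f t d ->
  cis_derive (fun s => (f s)^-1) t (- d / f t ^+ 2).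
Proof.
move=> f0 [fr fi]; have n0 := sqr_norm_neq0 f0.
pose n := (fun s => Re (f s)) * (fun s => Re (f s)) + (fun s => Im (f s)) * (fun s => Im (f s)).
have hn : is_derive t 1 n (2 * (Re (f t) * Re d + Im (f t) * Im d)).
  apply: (is_derive_eq (is_deriveD (is_deriveM fr fr) (is_deriveM fi fi))).
  by rewrite /GRing.scale /=; ring.
have nE s : n s = Re (f s) ^+ 2 + Im (f s) ^+ 2 by rewrite !expr2.
have hV := is_deriveV (f := n) (etrans (congr1 (fun u => u != 0) (nE t)) n0) hn.
have dE : - d / f t ^+ 2 = - (d * (f t)^-1 * (f t)^-1).
  by rewrite mulNr -exprVn expr2 mulrA.
split.
  rewrite (_ : (fun s => _) = (fun s => Re (f s)) * (fun s => (n s)^-1)); last first.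
    by apply/funext => s; rewrite cReV -nE.
  apply: (is_derive_eq (is_deriveM fr hV));
  rewrite dE !(cReN, cImN, cReM, cImM, cReV, cImV) nE /GRing.scale /=.
  by field.
rewrite (_ : (fun s => _) = - ((fun s => Im (f s)) * (fun s => (n s)^-1))); last first.
  by apply/funext => s; rewrite cImV -nE.
apply: (is_derive_eq (is_deriveN (is_deriveM fi hV)));
  rewrite dE !(cReN, cImN, cReM, cImM, cReV, cImV) nE /GRing.scale /=.
by field.
Qed.

Lemma cis_derive_cexp f t d : cis_derive f t d ->
  cis_derive (fun s => cexp (f s)) t (d * cexp (f t)).
Proof.
move=> [fr fi].
have he : is_derive t 1 (expR \o (fun s => Re (f s))) (expR (Re (f t)) * Re d).
  exact: is_derive1_comp.
have hc : is_derive t 1 (cos \o (fun s => Im (f s))) (- sin (Im (f t)) * Im d).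
  exact: is_derive1_comp.
have hs : is_derive t 1 (sin \o (fun s => Im (f s))) (cos (Im (f t)) * Im d).
  exact: is_derive1_comp.
split.
  rewrite (_ : (fun s => _) = (expR \o (fun s => Re (f s))) * (cos \o (fun s => Im (f s)))) //.
  by apply: (is_derive_eq (is_deriveM he hc)); rewrite cReM /GRing.scale /=; ring.
rewrite (_ : (fun s => _) = (expR \o (fun s => Re (f s))) * (sin \o (fun s => Im (f s)))) //.
by apply: (is_derive_eq (is_deriveM he hs)); rewrite cImM /GRing.scale /=; ring.
Qed.

Lemma cis_derive_sum (J : Type) (r : seq J) (f : J -> R -> R[i]) t (d : J -> R[i]) :
  (forall j, cis_derive (f j) t (d j)) ->
  cis_derive (fun s => \sum_(j <- r) f j s) t (\sum_(j <- r) d j).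
Proof.
move=> hf; elim: r => [|j r IH].
  rewrite big_nil (_ : (fun t => _) = fun=> 0); first exact: cis_derive_const.
  by apply/funext => s; rewrite big_nil.
rewrite big_cons (_ : (fun t => _) = fun t => f j t + \sum_(j <- r) f j t).
  exact: cis_deriveD.
by apply/funext => s; rewrite big_cons.
Qed.

Lemma cis_derive_horner (P : {poly R[i]}) f t d : cis_derive f t d ->
  cis_derive (fun s => P.[f s]) t (d * P^`().[f t]).
Proof.
move=> hf; elim/poly_ind: P => [|P c IH].
  rewrite deriv0 horner0 mulr0 (_ : (fun t => _) = fun=> 0); first exact: cis_derive_const.
  by apply/funext => s; rewrite horner0.
rewrite derivMXaddC (_ : (fun t => _) = fun s => P.[f s] * f s + c); last first.
  by apply/funext => s; rewrite hornerMXaddC.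
have -> : d * (P + P^`() * 'X).[f t] = (d * P^`().[f t] * f t + P.[f t] * d) + 0.
  by rewrite hornerD hornerMX; ring.
by apply: cis_deriveD; [exact: cis_deriveM|exact: cis_derive_const].
Qed.

End ComplexLimits.

(** * The derivative of a continuous logarithm *)

Section LogDerivative.
Context (R : realType).
Local Open Scope classical_set_scope.
Local Open Scope ring_scope.
Local Notation Re := complex.Re.
Local Notation Im := complex.Im.

Lemma cexpD (x y : R[i]) : cexp (x + y) = cexp x * cexp y.
Proof.
apply: complex_ext; rewrite /cexp ?cReM ?cImM /= cReD cImD expRD ?cosD ?sinD; ring.
Qed.

Lemma cexp0 : cexp 0 = 1 :> R[i].
Proof. by apply: complex_ext; rewrite /cexp /= expR0 ?cos0 ?sin0 ?mulr1 ?mulr0. Qed.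

Lemma cexpNK (x : R[i]) : cexp (- x) * cexp x = 1.
Proof. by rewrite -cexpD addNr cexp0. Qed.

Lemma cexp_neq0 (x : R[i]) : cexp x != 0.
Proof.
apply/eqP => x0; have /eqP := cexpNK x.
by rewrite x0 mulr0 eq_sym (negbTE (oner_neq0 _)).
Qed.

Lemma cexpN (x : R[i]) : cexp (- x) = (cexp x)^-1.
Proof. by rewrite -[RHS]mul1r -(cexpNK x) mulfK // cexp_neq0. Qed.

(** Near [t], the real part of the logarithm is half the logarithm of the squared
    norm, and its imaginary part the arctangent of a slope, after the rotation that
    makes [c t] real. *)
Lemma cis_derive_log (l c : R -> R[i]) (t : R) (d : R[i]) :
  (\forall s \near t, cexp (l s) = c s) -> ccvg (nbhs t) l (l t) ->
  cis_derive c t d -> cis_derive l t (d / c t).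
Proof.
move=> lc [_ li] [cr ci].
have lct : cexp (l t) = c t := nbhs_singleton lc.
have n0 : Re (c t) ^+ 2 + Im (c t) ^+ 2 != 0 by rewrite sqr_norm_neq0 // -lct cexp_neq0.
pose n := (fun s => Re (c s)) * (fun s => Re (c s)) + (fun s => Im (c s)) * (fun s => Im (c s)).
have hn : is_derive t 1 n (2 * (Re (c t) * Re d + Im (c t) * Im d)).
  apply: (is_derive_eq (is_deriveD (is_deriveM cr cr) (is_deriveM ci ci))).
  by rewrite /GRing.scale /=; ring.
have nE s : n s = Re (c s) ^+ 2 + Im (c s) ^+ 2 by rewrite !expr2.
have nt0 : 0 < n t by rewrite lt0r nE n0 addr_ge0 ?sqr_ge0.
split.
  have hl : is_derive t 1 (@ln R \o n) ((n t)^-1 * (2 * (Re (c t) * Re d + Im (c t) * Im d))).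
    by apply: is_derive1_comp; exact: is_derive1_ln.
  apply: (near_eq_is_derive (f := 2^-1 \*: (@ln R \o n))).
    near=> s; have cs : cexp (l s) = c s by near: s.
    rewrite /= nE -cs /cexp /= !exprMn -mulrDr cos2Dsin2 mulr1 -expRM_natl expRK.
    by rewrite /GRing.scale /=; field.
  apply: (is_derive_eq (is_deriveZ _ hl)).
  by rewrite cReM cReV cImV nE /GRing.scale /=; field.
pose r := Re (c t) \*: (fun s => Re (c s)) + Im (c t) \*: (fun s => Im (c s)).
pose i := Re (c t) \*: (fun s => Im (c s)) - Im (c t) \*: (fun s => Re (c s)).
have it : i t = 0 by rewrite /i /= /GRing.scale /= -[LHS]/(_ * _ - _ * _); ring.
have rt : r t = n t by rewrite nE /r /= /GRing.scale /= -[LHS]/(_ * _ + _ * _); ring.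
have rt0 : r t != 0 by rewrite rt gt_eqF.
have hr : is_derive t 1 r (Re (c t) * Re d + Im (c t) * Im d).
  exact: (is_deriveD (is_deriveZ _ cr) (is_deriveZ _ ci)).
have hi : is_derive t 1 i (Re (c t) * Im d - Im (c t) * Re d).
  exact: (is_deriveB (is_deriveZ _ ci) (is_deriveZ _ cr)).
pose u := i * (fun s => (r s)^-1).
have hu := is_deriveM hi (is_deriveV rt0 hr).
have ha := is_derive1_comp (is_derive1_atan (u t)) hu.
apply: (near_eq_is_derive (f := cst (Im (l t)) + (@atan R \o u))).
  near=> s; have cs : cexp (l s) = c s by near: s.
  rewrite -[LHS]/(Im (l t) + atan (u s)).
  have ps : `|Im (l t) - Im (l s)| < pi / 2.
    near: s; move/cvgrPdist_lt : li; apply.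
    by rewrite divr_gt0 ?pi_gt0.
  have uE : u s = tan (Im (l s) - Im (l t)).
    rewrite -[LHS]/((Re (c t) * Im (c s) - Im (c t) * Re (c s))
      / (Re (c t) * Re (c s) + Im (c t) * Im (c s))).
    rewrite /tan sinB cosB -cs -lct /cexp /=.
    have e1 := expR_gt0 (Re (l s)); have e2 := expR_gt0 (Re (l t)).
    have k0 : cos (Im (l s) - Im (l t)) != 0.
      by rewrite gt_eqF // cos_gt0_pihalf // -ltr_norml distrC.
    rewrite cosB in k0.
    set a := expR _ in e1 *; set b := expR _ in e2 *.
    set A := cos (Im (l s)) in k0 *; set B := sin (Im (l s)) in k0 *.
    set A' := cos (Im (l t)) in k0 *; set B' := sin (Im (l t)) in k0 *.
    have -> : b * A' * (a * B) - b * B' * (a * A) = (a * b) * (B * A' - A * B') by ring.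
    have -> : b * A' * (a * A) + b * B' * (a * B) = (a * b) * (A * A' + B * B') by ring.
    by rewrite -mulf_div divff ?mul1r // mulf_neq0 ?gt_eqF.
  rewrite uE tanK ?subrKC // in_itv /= -ltr_norml distrC //.
apply: (is_derive_eq (is_deriveD (is_derive_cst _ _ _) ha)).
rewrite cImM cReV cImV -nE it -[u t]/(i t * _) it mul0r rt add0r /GRing.scale /=.
have nn : n t != 0 by rewrite gt_eqF.
by field.
Unshelve. all: by end_near.
Qed.

End LogDerivative.

(** * Piecewise differentiable functions and their integrals *)

Section Piecewise.
Context (R : realType).
Local Open Scope classical_set_scope.
Local Open Scope ring_scope.
Implicit Types (a b c : R) (P Q : R -> R -> Prop).

(** [piecewise P a b]: the segment from [a] to [b] is a finite chain of segments
    satisfying [P]. *)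
Inductive piecewise P : R -> R -> Prop :=
| piecewise_one a b of a < b & P a b : piecewise P a b
| piecewise_cat a c b of piecewise P a c & piecewise P c b : piecewise P a b.

Lemma piecewise_lt P a b : piecewise P a b -> a < b.
Proof. by elim=> // {}a c {}b _ ac _; exact: lt_trans. Qed.

Lemma piecewise_mono P Q a0 b0 a b :
  (forall a b, a0 <= a -> a < b -> b <= b0 -> P a b -> Q a b) ->
  piecewise P a b -> a0 <= a -> b <= b0 -> piecewise Q a b.
Proof.
move=> PQ; elim=> {a b} [a b ab Pab a0a bb0|a c b pac IHa pcb IHb a0a bb0].
  by apply: piecewise_one => //; exact: PQ.
have ac := piecewise_lt pac; have cb := piecewise_lt pcb.
apply: (@piecewise_cat _ a c); [apply: IHa|apply: IHb] => //.
  by apply: le_trans bb0; exact: ltW.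
by apply: le_trans a0a _; exact: ltW.
Qed.

(** Stability under restriction to a smaller segment. *)
Definition hereditary P : Prop :=
  forall a b a' b', P a b -> a <= a' -> a' < b' -> b' <= b -> P a' b'.

Lemma piecewise_restrict P a b a' b' : hereditary P ->
  piecewise P a b -> a <= a' -> a' < b' -> b' <= b -> piecewise P a' b'.
Proof.
move=> hP pab; elim: pab a' b' => {a b} [a b ab Pab|a c b _ IHa _ IHb] a' b' aa' ab' bb'.
  by apply: piecewise_one => //; exact: hP Pab _ _ _.
have [b'c|cb'] := leP b' c; first exact: IHa.
have [ca'|a'c] := leP c a'; first exact: IHb.
by apply: (@piecewise_cat _ a' c); [apply: IHa|apply: IHb].
Qed.

(** Two finite subdivisions have a common refinement. *)
Lemma piecewise_and P Q a b : hereditary P -> hereditary Q ->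
  piecewise P a b -> piecewise Q a b -> piecewise (fun a b => P a b /\ Q a b) a b.
Proof.
move=> hP hQ; elim=> {a b} [a b ab Pab|a c b pac IHa pcb IHb] qab.
  apply: (piecewise_mono (a0 := a) (b0 := b) _ qab) => // a' b' aa' ab' bb' Qab'.
  by split=> //; exact: hP Pab _ _ _.
have ac := piecewise_lt pac; have cb := piecewise_lt pcb.
apply: (@piecewise_cat _ a c); [apply: IHa|apply: IHb].
  by apply: (piecewise_restrict hQ qab) => //; exact: ltW.
by apply: (piecewise_restrict hQ qab) => //; exact: ltW.
Qed.

Lemma C1_on_hereditary (f : R -> R) : hereditary (fun a b => C1_on a b f).
Proof.
move=> a b a' b' [fc fd [g gc fg]] aa' ab' bb'.
have sub : `[a', b'] `<=` `[a, b] by exact: subset_itv.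
have suboo t : t \in `]a', b'[ -> t \in `]a, b[ by apply: subset_itv.
split; first exact: continuous_subspaceW fc.
  by move=> t /suboo /fd.
by exists g; [exact: continuous_subspaceW gc|move=> t /suboo /fg].
Qed.

Lemma piecewise_C1P (f : R -> R) :
  piecewise_C1 f -> piecewise (fun a b => C1_on a b f) 0 1.
Proof.
move=> [s [sp sl sC]].
have s0 : s != [::] by apply: contra_eqN sl => /eqP ->; rewrite eq_sym oner_eq0.
suff H a : s != [::] -> path <%R a s ->
    (forall i, (i < size s)%N -> C1_on (nth 0 (a :: s) i) (nth 0 s i) f) ->
    piecewise (fun a b => C1_on a b f) a (last a s) by rewrite -sl; exact: H.
elim: s {s0 sl sp sC} a => // b s IH a _ /= /andP[ab sp] sC.
have Cab := sC 0%N isT; rewrite /= in Cab.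
have p1 : piecewise (fun a b => C1_on a b f) a b by exact: piecewise_one.
case: s IH sp sC => [|b' s] IH sp sC //=.
apply: (piecewise_cat p1); apply: (IH b) => // i si.
exact: sC i.+1 si.
Qed.

End Piecewise.

Section PiecewiseIntegral.
Context (R : realType).
Local Open Scope classical_set_scope.
Local Open Scope ring_scope.
Local Notation mu := (@lebesgue_measure R).
Implicit Types (a b c : R) (f H : R -> R).

(** On the open interval, [f] is the restriction of a continuous function on the
    segment. The values of [f] at the endpoints do not matter. *)
Definition extends_continuously f a b : Prop :=
  exists2 g, {within `[a, b], continuous g} & {in `]a, b[, f =1 g}.

Lemma extends_continuously_integrable f a b : a < b -> extends_continuously f a b ->
  mu.-integrable `[a, b] (EFin \o f).
Proof.
move=> ab [g gc fg].
have gi : mu.-integrable `[a, b] (EFin \o g).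
  by apply: continuous_compact_integrable => //; exact: segment_compact.
have fi : mu.-integrable `]a, b[ (EFin \o f).
  apply: (@eq_integrable _ _ _ mu _ _ (EFin \o g)) => //.
    by move=> t; rewrite inE /= => /fg ->.
  by apply: integrableS gi => //; exact: subset_itv_oo_cc.
have /integrableP[mf ff] := fi; apply/integrableP; split.
  by apply/emeasurable_fun_itv_bndo_bndcP/emeasurable_fun_itv_obnd_cbndP.
rewrite integral_itv_bndoo //; exact: measurableT_comp.
Qed.

Lemma integrable_itv_cat f a b c : a < c -> c < b ->
  mu.-integrable `[a, c] (EFin \o f) -> mu.-integrable `[c, b] (EFin \o f) ->
  mu.-integrable `[a, b] (EFin \o f).
Proof.
move=> ac cb fac fcb.
have acb : [set` `[a, b]] = `[a, c] `|` `]c, b] :> set R.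
  by rewrite -itv_bndbnd_setU // bnd_simp; exact: ltW.
have fcb' : mu.-integrable `]c, b] (EFin \o f).
  by apply: integrableS fcb => //; exact: subset_itv_oc_cc.
have /integrableP[m1 i1] := fac; have /integrableP[m2 i2] := fcb'.
have m : measurable_fun `[a, b] (EFin \o f) by rewrite acb; apply/measurable_funU.
apply/integrableP; split=> //; rewrite acb ge0_integral_setU //.
- exact: lte_add_pinfty.
- by rewrite -acb; exact: measurableT_comp.
- apply/disj_setPS => t [/=]; rewrite 2!in_itv/= => /andP[_ tc] /andP[].
  by rewrite ltNge tc.
Qed.

Lemma piecewise_integrable f a b : piecewise (extends_continuously f) a b ->
  mu.-integrable `[a, b] (EFin \o f).
Proof.
elim=> {a b} [a b|a c b pac IHa pcb IHb]; first exact: extends_continuously_integrable.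
by apply: (@integrable_itv_cat f a b c) => //; apply: piecewise_lt; [exact: pac|exact: pcb].
Qed.

(** The fundamental theorem of calculus for a continuous primitive with a piecewise
    continuous derivative. *)
Lemma piecewise_FTC f H a b :
  piecewise (fun a b => [/\ extends_continuously f a b, {within `[a, b], continuous H}
    & forall t, t \in `]a, b[ -> is_derive t 1 H (f t)]) a b ->
  \int[mu]_(t in `[a, b]) f t = H b - H a.
Proof.
elim=> {a b} [a b ab [fab Hc Hd]|a c b pac IHa pcb IHb].
  have fi := extends_continuously_integrable ab fab.
  have [g gc fg] := fab.
  have sub : `]a, b[ `<=` `[a, b] := @subset_itv_oo_cc _ _ _ _.
  have mg : measurable_fun `]a, b[ (EFin \o g).
    apply/measurable_EFinP; apply: (@measurable_funS _ _ _ _ `[a, b]) => //.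
    exact: subspace_continuous_measurable_fun.
  have mf : measurable_fun `]a, b[ (EFin \o f).
    apply: (@measurable_funS _ _ _ _ `[a, b]) => //; exact: measurable_int fi.
  rewrite /Rintegral integral_itv_bndoo //.
  have -> : (\int[mu]_(t in `]a, b[) (f t)%:E = \int[mu]_(t in `[a, b]) (g t)%:E)%E.
    rewrite (integral_itv_bndoo true false mg).
    by apply: eq_integral => t; rewrite inE /= => /fg ->.
  rewrite (@continuous_FTC2 _ g H) //.
    have [_ Ha Hb] := (continuous_within_itvP H ab).1 Hc.
    by split=> // t tab; have [] := Hd t tab.
  by move=> t tab; rewrite derive1E; have [_ ->] := Hd t tab; exact: fg.
have ac := piecewise_lt pac; have cb := piecewise_lt pcb.
have ifb : mu.-integrable `[a, b] (EFin \o f).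
  apply: piecewise_integrable; apply: (@piecewise_cat _ _ a c).
    by apply: piecewise_mono pac (lexx _) (lexx _) => ? ? _ _ _ [].
  by apply: piecewise_mono pcb (lexx _) (lexx _) => ? ? _ _ _ [].
have := Rintegral_itvB (x := c) ifb; rewrite !bnd_simp => /(_ (ltW ac) (ltW cb)).
rewrite Rintegral_itv_obnd_cbnd; last first.
  apply: integrableS ifb => //; move=> t /=; rewrite !in_itv /=.
  by case/andP => ct ->; rewrite (le_trans (ltW ac) (ltW ct)).
rewrite IHa IHb => E.
have -> : \int[mu]_(t in `[a, b]) f t = H b - H c + (H c - H a) by rewrite -E subrK.
by rewrite addrA subrK.
Qed.

End PiecewiseIntegral.

(** * Integrals over twisted cycles *)

Section TwistedCycles.
Context (R : realType) (N : nat) (zs e : 'I_N -> R[i]) (gam : twisted_cycle zs e).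
Local Open Scope classical_set_scope.
Local Open Scope ring_scope.
Local Notation Re := complex.Re.
Local Notation Im := complex.Im.
Local Notation mu := (@lebesgue_measure R).
Local Notation path := (tc_path gam).
Local Notation branch := (tc_branch gam).
Local Notation speed := (tc_speed gam).
Implicit Types (F : R[i] -> R[i]) (a b t : R).

Lemma tc_path_neq t j : t \in `[0, 1] -> path t != zs j.
Proof. by move=> t01; rewrite -subr_eq0 -(tc_logP gam j t01) cexp_neq0. Qed.

Lemma tc_branchV t : (branch t)^-1 = cexp (\sum_j - e j * tc_log gam j t).
Proof.
rewrite -cexpN -sumrN; congr cexp; apply: eq_bigr => j _.
by rewrite mulNr.
Qed.

Let branchV_fun : (fun t => (branch t)^-1) = fun t => cexp (\sum_j - e j * tc_log gam j t).
Proof. by apply/funext => t; exact: tc_branchV. Qed.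

Lemma within_ccvg (A : set R) (f : R -> R[i]) t :
  {within A, continuous (fun s => Re (f s))} ->
  {within A, continuous (fun s => Im (f s))} -> A t -> ccvg (within A (nbhs t)) f (f t).
Proof. by move=> fr fi At; split; apply/(subspace_continuousP _ _).1. Qed.

Lemma ccvg_within (A : set R) (f : R -> R[i]) :
  (forall t, A t -> ccvg (within A (nbhs t)) f (f t)) ->
  {within A, continuous (fun s => Re (f s))} /\ {within A, continuous (fun s => Im (f s))}.
Proof. by move=> fA; split; apply/subspace_continuousP => t /fA[]. Qed.

(** The pieces on which both components of the path are of class C1. *)
Let smooth a b := C1_on a b (fun t => Re (path t)) /\ C1_on a b (fun t => Im (path t)).

Let piecewise_smooth : piecewise smooth 0 1.
Proof.
apply: piecewise_and; [exact: C1_on_hereditary|exact: C1_on_hereditary| |].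
  by apply: piecewise_C1P; exact: tc_Re.
by apply: piecewise_C1P; exact: tc_Im.
Qed.

Let sub01 a b : 0 <= a -> b <= 1 -> `[a, b] `<=` `[0, 1].
Proof. by move=> a0 b1; apply: subset_itv; rewrite bnd_simp. Qed.

Let path_ccvg a b t : smooth a b -> t \in `[a, b] -> ccvg (within `[a, b] (nbhs t)) path (path t).
Proof. by move=> [[rc _ _] [ic _ _]] tab; exact: within_ccvg. Qed.

Let log_ccvg j t : t \in `[0, 1] ->
  ccvg (within `[0, 1] (nbhs t)) (tc_log gam j) (tc_log gam j t).
Proof.
by move=> t01; apply: within_ccvg => //; [exact: tc_log_Re|exact: tc_log_Im].
Qed.

Let branchV_ccvg t : t \in `[0, 1] ->
  ccvg (within `[0, 1] (nbhs t)) (fun s => (branch s)^-1) (branch t)^-1.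
Proof.
move=> t01; rewrite branchV_fun tc_branchV.
apply: ccvg_cexp; apply: ccvg_sum => j; apply: ccvgM; first exact: ccvg_const.
exact: log_ccvg.
Qed.

Let ccvg_sub (A B : set R) t (f : R -> R[i]) l : A `<=` B ->
  ccvg (within B (nbhs t)) f l -> ccvg (within A (nbhs t)) f l.
Proof.
by move=> AB [fr fi]; split; [apply: cvg_trans fr|apply: cvg_trans fi];
  apply: cvg_app; exact: within_subset.
Qed.

Let path_derive a b t : smooth a b -> t \in `]a, b[ -> cis_derive path t (speed t).
Proof.
move=> [[_ rd _] [_ im _]] tab; split; (apply: DeriveDef; last by rewrite /tc_speed /= derive1E).
  exact: rd.
exact: im.
Qed.

Let log_derive a b t j : smooth a b -> 0 <= a -> b <= 1 -> t \in `]a, b[ ->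
  cis_derive (tc_log gam j) t (speed t / (path t - zs j)).
Proof.
move=> sab a0 b1 tab.
have ab : a < b by move: tab; rewrite in_itv /= => /andP[]; exact: lt_trans.
have t01 : t \in `]0, 1[ by apply: subset_itv tab; rewrite bnd_simp.
have nt : \forall s \near t, s \in `]0, 1[ by exact: near_in_itvoo.
apply: (cis_derive_log (c := fun s => path s + - zs j)).
- near=> s; have s01 : s \in `]0, 1[ by near: s.
  by rewrite (tc_logP gam j) //; exact: subset_itv_oo_cc s01.
- by split; apply: (@within_continuous_continuous _ _ _ 0 1) => //;
    [exact: tc_log_Re|exact: tc_log_Im].
- rewrite -[speed t]addr0; apply: cis_deriveD; last exact: cis_derive_const.
  exact: path_derive tab.
Unshelve. all: by end_near.
Qed.

Let branchV_derive a b t : smooth a b -> 0 <= a -> b <= 1 -> t \in `]a, b[ ->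
  cis_derive (fun s => (branch s)^-1) t
    (- (\sum_j e j / (path t - zs j)) * speed t * (branch t)^-1).
Proof.
move=> sab a0 b1 tab; rewrite branchV_fun tc_branchV.
have hj j : cis_derive (fun s => - e j * tc_log gam j s) t
    (- (e j / (path t - zs j)) * speed t).
  have := cis_deriveM (cis_derive_const (- e j) t) (log_derive j sab a0 b1 tab).
  by rewrite mul0r add0r mulNr mulrCA (mulrC (speed t)) -mulNr.
have := cis_derive_cexp (cis_derive_sum (index_enum 'I_N) hj).
by rewrite -mulr_suml sumrN.
Qed.

(** Continuity of [F] at the points of the contour. *)
Definition continuous_along F : Prop := forall t, t \in `[0, 1] ->
  forall G : set_system R, Filter G -> ccvg G path (path t) ->
    ccvg G (fun s => F (path s)) (F (path t)).

Lemma continuous_along_ratio (P Q : {poly R[i]}) :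
  (forall t, t \in `[0, 1] -> Q.[path t] != 0) -> continuous_along (fun z => P.[z] / Q.[z]).
Proof.
move=> Q0 t t01 G FG hG; apply: ccvgM; first exact: ccvg_horner.
by apply: ccvgV; [exact: Q0|exact: ccvg_horner].
Qed.

Lemma continuous_alongD F F' : continuous_along F -> continuous_along F' ->
  continuous_along (fun z => F z + F' z).
Proof. by move=> hF hF' t t01 G FG hG; apply: ccvgD; [exact: hF|exact: hF']. Qed.

Lemma continuous_alongM F F' : continuous_along F -> continuous_along F' ->
  continuous_along (fun z => F z * F' z).
Proof. by move=> hF hF' t t01 G FG hG; apply: ccvgM; [exact: hF|exact: hF']. Qed.

Lemma continuous_along_const c : continuous_along (fun=> c).
Proof. by move=> t t01 G FG hG; exact: ccvg_const. Qed.

Lemma continuous_along_poles : continuous_along (fun z => \sum_j e j / (z - zs j)).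
Proof.
move=> t t01 G FG hG; apply: ccvg_sum => j; apply: ccvgM; first exact: ccvg_const.
apply: ccvgV; first by rewrite subr_eq0 tc_path_neq.
by apply: ccvgD => //; exact: ccvg_const.
Qed.

Lemma continuous_along_rf_eval (E : ratfun R[i]^o) :
  (forall t, t \in `[0, 1] -> (rf_den E).[path t] != 0) -> continuous_along (rf_eval E).
Proof.
move=> den0; rewrite (_ : rf_eval E = fun z => (rf_poly E).[z] / (rf_den E).[z]).
  exact: continuous_along_ratio.
by apply/funext => z; exact: rf_eval_poly.
Qed.

Lemma continuous_along_twisted_deriv (E : ratfun R[i]^o) :
  (forall t, t \in `[0, 1] -> (rf_den E).[path t] != 0) ->
  continuous_along (fun z => rf_deriv E z - (\sum_j e j / (z - zs j)) * rf_eval E z).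
Proof.
move=> den0; set P := rf_poly E; set Q := rf_den E.
rewrite (_ : (fun z => _) = fun z => (P^`() * Q - P * Q^`()).[z] / (Q ^+ 2).[z]
    + -1 * ((\sum_j e j / (z - zs j)) * rf_eval E z)); last first.
  by apply/funext => z; rewrite rf_deriv_poly hornerD hornerN !hornerM mulN1r.
apply: continuous_alongD.
  by apply: continuous_along_ratio => t t01; rewrite horner_exp expf_neq0 ?den0.
apply: continuous_alongM; first exact: continuous_along_const.
apply: continuous_alongM; first exact: continuous_along_poles.
exact: continuous_along_rf_eval.
Qed.

Local Notation integrand F := (fun t => (branch t)^-1 * F (path t) * speed t).

Let integrand_extends F a b : continuous_along F -> smooth a b -> 0 <= a -> b <= 1 ->
  extends_continuously (fun t => Re (integrand F t)) a b /\
  extends_continuously (fun t => Im (integrand F t)) a b.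
Proof.
move=> hF sab a0 b1; have [[_ _ [gr grc grE]] [_ _ [gi gic giE]]] := sab.
pose g t := gr t +i* gi t.
pose h t := (branch t)^-1 * F (path t) * g t.
have hE t : t \in `]a, b[ -> integrand F t = h t.
  by move=> tab; rewrite /h /g -grE // -giE.
have [hr hi] : {within `[a, b], continuous (fun s => Re (h s))} /\
    {within `[a, b], continuous (fun s => Im (h s))}.
  apply: ccvg_within => t tab; have t01 : t \in `[0, 1] := sub01 a0 b1 tab.
  apply: ccvgM; last exact: within_ccvg.
  apply: ccvgM; last by apply: hF => //; exact: path_ccvg.
  exact: ccvg_sub (sub01 a0 b1) (branchV_ccvg t01).
split; [exists (fun s => Re (h s)) => //|exists (fun s => Im (h s)) => //];
  by move=> t tab; rewrite hE.
Qed.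

Let integrand_integrable F : continuous_along F ->
  mu.-integrable `[0, 1] (EFin \o (fun t => Re (integrand F t))) /\
  mu.-integrable `[0, 1] (EFin \o (fun t => Im (integrand F t))).
Proof.
move=> hF; split; apply: piecewise_integrable;
  apply: (piecewise_mono _ piecewise_smooth (lexx 0) (lexx 1)) => a b a0 _ b1 sab;
  by have [] := integrand_extends hF sab a0 b1.
Qed.

Lemma twisted_integral_linear c F G : continuous_along F -> continuous_along G ->
  twisted_integral gam (fun z => c * F z + G z)
  = c * twisted_integral gam F + twisted_integral gam G.
Proof.
move=> hF hG.
have [Fr Fi] := integrand_integrable hF; have [Gr Gi] := integrand_integrable hG.
have ZI (k : R) (f : R -> R) : mu.-integrable `[0, 1] (EFin \o f) ->
    mu.-integrable `[0, 1] (EFin \o (fun t => k * f t)).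
  move=> fi; apply: eq_integrable (integrableZl _ k fi) => //.
have lin (k l : R) (f g h : R -> R) : mu.-integrable `[0, 1] (EFin \o f) ->
    mu.-integrable `[0, 1] (EFin \o g) -> mu.-integrable `[0, 1] (EFin \o h) ->
    \int[mu]_(t in `[0, 1]) (k * f t + l * g t + h t)
    = k * \int[mu]_(t in `[0, 1]) f t + l * \int[mu]_(t in `[0, 1]) g t
      + \int[mu]_(t in `[0, 1]) h t.
  move=> fi gi hi; rewrite RintegralD //; last first.
    by apply: eq_integrable (integrableD _ (ZI k _ fi) (ZI l _ gi)).
  by rewrite RintegralD ?RintegralZl //; exact: ZI.
have E t : integrand (fun z => c * F z + G z) t = c * integrand F t + integrand G t by ring.
apply: complex_ext; rewrite /twisted_integral /cintegral01 ?cReD ?cImD ?cReM ?cImM /=.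
  rewrite -mulNr -lin //; apply: eq_Rintegral => t _.
  by rewrite E cReD cReM mulNr.
rewrite -lin //; apply: eq_Rintegral => t _.
by rewrite E cImD cImM.
Qed.

Lemma eq_twisted_integral F G : (forall t, t \in `[0, 1] -> F (path t) = G (path t)) ->
  twisted_integral gam F = twisted_integral gam G.
Proof.
move=> FG; apply: complex_ext; rewrite /twisted_integral /cintegral01 /=;
  by apply: eq_Rintegral => t; rewrite inE => /FG ->.
Qed.

(** The integral of a twisted derivative over a closed contour vanishes. *)
Lemma twisted_integral_exact (E : ratfun R[i]^o) :
  (forall t, t \in `[0, 1] -> (rf_den E).[path t] != 0) ->
  twisted_integral gam
    (fun z => rf_deriv E z - (\sum_j e j / (z - zs j)) * rf_eval E z) = 0.
Proof.
move=> den0; set P := rf_poly E; set Q := rf_den E.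
pose D z := (P^`().[z] * Q.[z] - P.[z] * Q^`().[z]) / Q.[z] ^+ 2
  - (\sum_j e j / (z - zs j)) * (P.[z] / Q.[z]).
have hD := continuous_along_twisted_deriv den0.
have DE : (fun z => rf_deriv E z - (\sum_j e j / (z - zs j)) * rf_eval E z) = D.
  by apply/funext => z; rewrite rf_deriv_poly rf_eval_poly.
rewrite DE in hD *.
(* The primitive of the integrand, which takes the same value at both ends of the contour. *)
pose H t := (branch t)^-1 * (P.[path t] / Q.[path t]).
have H01 : H 1 = H 0 by rewrite /H /tc_branch -(tc_univalued gam) -(tc_closed gam).
have HC a b : smooth a b -> 0 <= a -> b <= 1 ->
    {within `[a, b], continuous (fun s => Re (H s))} /\
    {within `[a, b], continuous (fun s => Im (H s))}.
  move=> sab a0 b1; apply: ccvg_within => t tab; have t01 : t \in `[0, 1] := sub01 a0 b1 tab.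
  apply: ccvgM; first exact: ccvg_sub (sub01 a0 b1) (branchV_ccvg t01).
  exact: (@continuous_along_ratio P Q den0 t t01 _ _ (path_ccvg sab tab)).
have HD a b t : smooth a b -> 0 <= a -> b <= 1 -> t \in `]a, b[ ->
    cis_derive H t (integrand D t).
  move=> sab a0 b1 tab.
  have Q0 : Q.[path t] != 0.
    by apply: den0; apply: (sub01 a0 b1); exact: subset_itv_oo_cc tab.
  have hp := path_derive sab tab.
  have hr := cis_deriveM (cis_derive_horner P hp) (cis_deriveV Q0 (cis_derive_horner Q hp)).
  have := cis_deriveM (branchV_derive sab a0 b1 tab) hr.
  set x := _ + _; set y := integrand D t; suff -> : x = y by [].
  rewrite /x /y /D; set s := \sum_j _; set bv := _^-1.
  by field.
have fin (f h : R -> R) : (forall a b, smooth a b -> 0 <= a -> b <= 1 ->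
      [/\ extends_continuously f a b, {within `[a, b], continuous h}
        & forall t, t \in `]a, b[ -> is_derive t 1 h (f t)]) ->
    h 1 = h 0 -> \int[mu]_(t in `[0, 1]) f t = 0.
  move=> hf h01; rewrite (piecewise_FTC (H := h)) ?h01 ?subrr //.
  apply: (piecewise_mono _ piecewise_smooth (lexx 0) (lexx 1)) => a b a0 _ b1 sab.
  exact: hf.
apply: complex_ext; rewrite /twisted_integral /cintegral01 /=.
  apply: (fin _ (fun t => Re (H t))); last by rewrite H01.
  move=> a b sab a0 b1; split.
  - by have [] := integrand_extends hD sab a0 b1.
  - by have [] := HC a b sab a0 b1.
  - by move=> t tab; have [] := HD a b t sab a0 b1 tab.
apply: (fin _ (fun t => Im (H t))); last by rewrite H01.
move=> a b sab a0 b1; split.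
- by have [] := integrand_extends hD sab a0 b1.
- by have [] := HC a b sab a0 b1.
- by move=> t tab; have [] := HD a b t sab a0 b1 tab.
Qed.

End TwistedCycles.

(** * Eigenvalue of the operator and of its periods *)

(* The constant is 2M and not M: with t_abc = tr(I_a I_b I_c + I_b I_a I_c)   *)
(* the part of q cubic in the Cartan currents h is (2/3) tr h^3, which is     *)
(* 2 \sum_i u_i (u_(i+1)^2 - u_(i-1)^2), the leading part of - 2M v_2.        *)
Theorem proposition5p3 (R : realType) (M : nat) (M_ge3 : (3 <= M)%N)
    (N : nat) (N_gt0 : (0 < N)%N)
    (zs : 'I_N -> R[i]) (zs_inj : injective zs)
    (lam : 'I_N -> weight R[i] M)
    (noncritical : forall j, level (lam j) != - M%:R)
    (V : forall j, verma (lam j)) (T : tensor_product V)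
    (A : finType) (I : A -> 'M[R[i]]_M) (I_basis : orthonormal_basis I)
    (L : dual_affine R[i] M)
    (B : L -> L -> R[i]) (B_form : invariant_form B)
    (p : nat -> L) (p_principal : principal_elements B p)
    (w : R[i]) (w_neq_zs : forall j, w != zs j) (n : 'I_M)
    (bethe : 0 = \sum_j on_coroot (lam j) n / (w - zs j))
    (v2 : ratfun R[i]^o)
    (v2P : is_v2 p (miura_u lam zs n w) (twist lam zs) v2) :
  (exists eps : ratfun T,
     forall z : R[i], (forall j, z != zs j) ->
       (rf_den v2).[z] != 0 -> (rf_den eps).[z] != 0 ->
       q zs I z (bethe_vector T zs n w) =
         (- (2 * M%:R * rf_eval v2 z)) *: bethe_vector T zs n w
         + twisted_deriv lam zs 2 eps z)
  /\
  (forall gam : twisted_cycle zs (fun j => 2 / M%:R * level (lam j)),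
     (forall t : R, t \in `[0, 1] -> (rf_den v2).[tc_path gam t] != 0) ->
     has_twisted_integral gam (fun z => q zs I z (bethe_vector T zs n w))
       ((- (2 * M%:R * twisted_integral gam (rf_eval v2))) *:
          bethe_vector T zs n w)).

Proof.
have [e [e' [he hq]]] := q_bethe_vector M_ge3 T w_neq_zs bethe I_basis B_form p_principal v2P.
split.
  have [eps epsP] := has_rat_den he hq; exists eps => z _ _ /epsP[-> eE e'E].
  by rewrite /twisted_deriv eE e'E.
move=> gam v2_den l.
have [E EP] := q_bethe_scalar M_ge3 w_neq_zs bethe I_basis B_form p_principal v2P l.
set psi := bethe_vector T zs n w in EP *.
have zsP t j : t \in `[0, 1]%R -> tc_path gam t != zs j by exact: tc_path_neq.
have E_den t : t \in `[0, 1]%R -> (rf_den E).[tc_path gam t] != 0.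
  by move=> t01; have [] := EP _ (fun j => zsP t j t01) (v2_den t t01).
pose c := - (2 * M%:R) * l psi.
pose dE z := rf_deriv E z - (\sum_j 2 / M%:R * level (lam j) / (z - zs j)) * rf_eval E z.
(* On the contour, the equation holds without exceptional points. *)
have -> : twisted_integral gam (fun z => l (q zs I z psi))
    = twisted_integral gam (fun z => c * rf_eval v2 z + dE z).
  apply: eq_twisted_integral => t t01.
  have [_ ->] := EP _ (fun j => zsP t j t01) (v2_den t t01).
  have tE : \sum_j 2 / M%:R * level (lam j) / (tc_path gam t - zs j)
      = 2 / M%:R * twist lam zs (tc_path gam t).
    by rewrite mulr_sumr; apply: eq_bigr => j _; rewrite mulrA.
  rewrite /dE tE.
  by congr (_ + _); rewrite /c mulNr !mulNr mulrAC.
rewrite twisted_integral_linear; last 2 first.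
- exact: continuous_along_rf_eval.
- exact: continuous_along_twisted_deriv.
rewrite twisted_integral_exact // addr0.
have -> : l (- (2 * M%:R * twisted_integral gam (rf_eval v2)) *: psi)
  = - (2 * M%:R * twisted_integral gam (rf_eval v2)) * l psi by apply: linearZ.
by rewrite /c !mulNr mulrAC.
Qed.
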